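(* For every prime $p$ the following identities of formal power series in two variables $t,u$ (with real coefficients) hold: $$\sum_{d\ge0}\mathcal{A}_d(pt)u^d=\Big(\sum_{d\ge0}\mathcal{B}_d(t)u^d\Big)^p,$$ $$\sum_{d\ge0}\mathcal{R}_d(t)u^d=\Big(\sum_{d\ge0}\mathcal{A}_d(pt)u^d\Big)\Big(\sum_{d\ge0}\mathcal{B}_d(t)u^d\Big)=\Big(\sum_{d\ge0}\mathcal{B}_d(t)u^d\Big)^{p+1},$$ and, for every $d\ge0$, $$\mathcal{B}_d(t)-t\,\mathcal{B}_d(t/p)=\Phi\big(\mathcal{A}_d(t)-t\,\mathcal{A}_d(pt)\big),$$ where $\Phi$ is the linear operator on power series in $t$ sending $\sum_n c_nt^n$ to $\sum_n p^{-\binom{n}{2}}c_nt^n$.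
   Context: Fix a prime $p$ and let $\mathbb{Z}_p,\mathbb{Q}_p$ be the $p$-adic integers and numbers. Random polynomials: (i) a random polynomial of degree $n$ over $\mathbb{Z}_p$ is $f=c_nx^n+\dots+c_0$ with $(c_0,\dots,c_n)\in\mathbb{Z}_p^{n+1}$ distributed according to the Haar measure normalized to total mass $1$; (ii) a random monic polynomial of degree $n$ is $f=x^n+a_{n-1}x^{n-1}+\dots+a_0$ with $(a_0,\dots,a_{n-1})\in\mathbb{Z}_p^n$ Haar-distributed with total mass $1$; (iii) a random monic polynomial of degree $n$ reducing to $x^n$ mod $p$ is $f=x^n+a_{n-1}x^{n-1}+\dots+a_0$ with $(a_0,\dots,a_{n-1})$ Haar-distributed on $(p\mathbb{Z}_p)^n$ normalized to total mass $1$. For $f\neq0$ let $X(f)$ be the number of distinct roots of $f$ in $\mathbb{Q}_p$. Define $\rho(n,d)=\mathbb{E}\binom{X}{d}$ for model (i), $\alpha(n,d)=\mathbb{E}\binom{X}{d}$ for model (ii), $\beta(n,d)=\mathbb{E}\binom{X}{d}$ for model (iii), for all integers $n,d\ge0$ (so these vanish when $d>n$). Generating functions: $\mathcal{A}_d(t)=(1-t)\sum_{n\ge0}\alpha(n,d)t^n$, $\mathcal{B}_d(t)=(1-t)\sum_{n\ge0}\beta(n,d)t^n$, $\mathcal{R}_d(t)=(1-t)(1-pt)\sum_{n\ge0}(p^n+p^{n-1}+\dots+1)\rho(n,d)t^n$. *)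

(* Defs.v *)
From HB Require Import structures.
From mathcomp Require Import all_boot all_order all_algebra.
From mathcomp Require Import finmap.
From mathcomp Require Import all_classical all_reals all_analysis.
Set Implicit Arguments. Unset Strict Implicit. Unset Printing Implicit Defensive.
Import Order.TTheory GRing.Theory Num.Theory.
Local Open Scope ring_scope.
Local Open Scope classical_set_scope.

(* A p-adic integer is represented by its (unique) base-p digit sequence
   u : nat -> nat with u i < p, i.e. u = sum_i u_i p^i.  Its truncation
   modulo p^k is trunc p u k = sum_(i<k) u_i p^i. *)
Definition digits := nat -> nat.

Definition trunc (p : nat) (u : digits) (k : nat) : int :=
  \sum_(i < k) (u i)%:Z * (p ^ i)%:Z.

Definition is_Zp (p : nat) (u : digits) : Prop := forall i, (u i < p)%N.

(* A nonzero element of Q_p is uniquely p^v * u with v : int and u a p-adic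
   unit (digit 0 nonzero).  Q_p is represented by option (int * digits):
   None = 0, Some (v, u) = p^v u (only pairs with is_Zp u and u 0 != 0
   represent elements of Q_p). *)

(* The polynomial f = sum_(i <= n) c_i x^i with c_i in Z_p.
   x = 0 is a root iff c_0 = 0 (all truncations vanish).
   x = p^v u is a root iff p^(w n) f(p^v u) = 0 in Z_p, w = max(0,-v),
   iff this element of Z_p vanishes modulo p^k for every k; modulo p^k it
   is computed from the truncations of the c_i and of u. *)
Definition scaled_value (p n : nat) (c : nat -> digits) (v : int) (u : digits)
    (k : nat) : int :=
  \sum_(i < n.+1)
     trunc p (c i) k * (p ^ (if (0 <= v)%R then (`|v| * i)%N else (`|v| * (n - i))%N))%:Z
       * (trunc p u k) ^+ i.

Definition Qp_roots (p n : nat) (c : nat -> digits) : set (option (int * digits)) :=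
  [set x | match x with
           | None => forall k, ((p ^ k)%:Z %| trunc p (c 0%N) k)%Z
           | Some (v, u) => is_Zp p u /\ u 0%N != 0%N /\
                            forall k, ((p ^ k)%:Z %| scaled_value p n c v u k)%Z
           end].

(* X(f) = number of distinct roots of f in Q_p (finite when f <> 0;
   for f = 0, a null event, fset_set of an infinite set gives 0). *)
Definition nroots (p n : nat) (c : nat -> digits) : nat :=
  (#|` fset_set (Qp_roots p n c)|)%fset.

(* Haar measure on Z_p^N is realised as the image of Lebesgue measure on
   [0,1[ : the base-p digits of a uniform x in [0,1[ are i.i.d. uniform in
   {0..p-1}; digit number j + N*i becomes digit i of the j-th coordinate. *)
Definition digit (R : realType) (p : nat) (x : R) (m : nat) : nat :=
  `|(Num.floor (x * (p%:R) ^+ m.+1) %% (p%:Z))%Z|%N.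

Definition coord (R : realType) (p N : nat) (x : R) (j : nat) : digits :=
  fun i => digit p x (j + N * i).

Definition one_digits : digits := fun i => if i == 0%N then 1%N else 0%N.
Definition times_p (u : digits) : digits :=
  fun i => if i is i'.+1 then u i' else 0%N.

Definition expect (R : realType) (g : R -> R) : R :=
  fine (\int[@lebesgue_measure R]_(x in `[0%R, 1%R[) (g x)%:E)%E.

Definition rho (R : realType) (p n d : nat) : R :=
  expect (fun x : R => ('C(nroots p n (coord p n.+1 x), d))%:R).
Definition alpha (R : realType) (p n d : nat) : R :=
  expect (fun x : R => ('C(nroots p n
     (fun i => if (i < n)%N then coord p n x i else one_digits), d))%:R).
Definition beta (R : realType) (p n d : nat) : R :=
  expect (fun x : R => ('C(nroots p n
     (fun i => if (i < n)%N then times_p (coord p n x i) else one_digits), d))%:R).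

Definition fps_mul (R : realType) (f g : nat -> R) : nat -> R :=
  fun n => \sum_(i < n.+1) f i * g (n - i)%N.
Definition fps_scale (R : realType) (a : R) (f : nat -> R) : nat -> R :=
  fun n => a ^+ n * f n.
Definition fps_shift (R : realType) (f : nat -> R) : nat -> R :=
  fun n => if n is m.+1 then f m else 0.
Definition fps_sub (R : realType) (f g : nat -> R) : nat -> R := fun n => f n - g n.
Definition one_minus (R : realType) (a : R) : nat -> R :=
  fun n => if n == 0%N then 1 else if n == 1%N then - a else 0.
Definition Phi (R : realType) (p : nat) (f : nat -> R) : nat -> R :=
  fun n => (p%:R ^+ 'C(n, 2))^-1 * f n.

(* two variables t,u: F n d = coefficient of t^n u^d *)
Definition fps2_mul (R : realType) (F G : nat -> nat -> R) : nat -> nat -> R :=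
  fun n d => \sum_(i < n.+1) \sum_(j < d.+1) F i j * G (n - i)%N (d - j)%N.
Definition fps2_one (R : realType) : nat -> nat -> R :=
  fun n d => ((n == 0%N) && (d == 0%N))%:R.
Definition fps2_exp (R : realType) (F : nat -> nat -> R) (k : nat) :=
  iter k (fps2_mul F) (@fps2_one R).

Definition genA (R : realType) (p d : nat) : nat -> R :=
  fps_mul (one_minus 1) (fun n => alpha R p n d).
Definition genB (R : realType) (p d : nat) : nat -> R :=
  fps_mul (one_minus 1) (fun n => beta R p n d).
Definition genR (R : realType) (p d : nat) : nat -> R :=
  fps_mul (fps_mul (one_minus 1) (one_minus p%:R))
    (fun n => (\sum_(i < n.+1) p%:R ^+ i) * rho R p n d).

Definition serA (R : realType) (p : nat) : nat -> nat -> R :=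
  fun n d => fps_scale p%:R (genA R p d) n.
Definition serB (R : realType) (p : nat) : nat -> nat -> R :=
  fun n d => genB R p d n.
Definition serR (R : realType) (p : nat) : nat -> nat -> R :=
  fun n d => genR R p d n.

(* Main.v *)
Require Import Defs.
From HB Require Import structures.
From mathcomp Require Import all_boot all_order all_algebra boolp.
From mathcomp Require Import zify ring.
Set Implicit Arguments.
Unset Strict Implicit.
Unset Printing Implicit Defensive.
Import Order.TTheory GRing.Theory Num.Theory.
Local Open Scope ring_scope.

(* Everything is computed at finite levels. For f over Z/p^K let N(f) be the number
   of classes modulo p^k (k <= K) that contain a root of f. The number of roots of a
   p-adic polynomial is the limit over k of the limits over K of N, and N is bounded
   by the degree once it has stabilised, so by dominated convergence each expectation
   is an iterated limit of averages over polynomials with coefficients in Z/p^K.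
   For these averages the identities are exact. Write A = Z/p^K and m for its
   nonunits, and call distinguished the monic polynomials congruent to a power of x.
   (1) A monic f factors uniquely as h g with h distinguished and g(0) a unit; as g
   has no root in m and h none outside, splitting off the residue classes one at a
   time gives the p-th power.
   (2) A primitive f factors uniquely as c h w with c a unit, h monic and w the
   reversal of a distinguished polynomial: this gives the product of the two
   generating functions. Dividing by p reduces general polynomials to primitive ones.
   (3) If f is distinguished of degree n, write f(py) = p^j g(y) with j maximal;
   either j = n and g is uniformly distributed among monic polynomials, or g is a
   uniformly distributed primitive polynomial of degree < j perturbed by a polynomial
   with coefficients in m, and g is a monic polynomial times a unit of A[x].
   Uniqueness of the factorisations comes from lifting coprimality modulo m, and
   existence from counting both sides. *)

(** * Factorisations over a finite local ring *)

(** A p-adic root reduces to many roots modulo p^K, and some roots modulo p^K do not lift. Hence two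
    precisions: letting K grow first removes the classes without p-adic root, by compactness;
    letting k grow afterwards separates the roots. Roots outside the p-adic integers are counted as
    roots divisible by p of the reversed polynomial. A polynomial has weight z^N, and z is finally
    taken to be 1 + X, whose N-th power has coefficients binom(N, d): the variable u of the theorem
    becomes the variable of [{poly R}], and additivity of N over factors becomes multiplicativity of
    weights. Cardinalities produce the constants: the ratio p^n between the numbers of monic and of
    distinguished polynomials gives the argument pt, the number of primitive polynomials divided by
    (p-1) p^((K-1)(n+1)) gives 1 + p + ... + p^n, and the probability that p^n divides f(py) gives
    p^(-binom(n, 2)). *)

Section FinitePolynomials.
Variable A : finComUnitRingType.

Definition lowp n (c : {ffun 'I_n -> A}) : {poly A} := \sum_(i < n) c i *: 'X^i.
Definition mon n (c : {ffun 'I_n -> A}) : {poly A} := 'X^n + lowp c.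
Definition cof n (P : {poly A}) : {ffun 'I_n -> A} := [ffun i : 'I_n => P`_i].

Lemma lowpE n (c : {ffun 'I_n -> A}) :
  lowp c = \poly_(i < n) (if insub i is Some j then c j else 0).
Proof.
rewrite poly_def; apply: eq_bigr => i _; rewrite insubT //= => h.
by congr (c _ *: _); apply: val_inj.
Qed.

Lemma coef_lowp n (c : {ffun 'I_n -> A}) (i : 'I_n) : (lowp c)`_i = c i.
Proof.
rewrite lowpE coef_poly ltn_ord insubT //= => h.
by congr (c _); apply: val_inj.
Qed.

Lemma size_lowp n (c : {ffun 'I_n -> A}) : (size (lowp c) <= n)%N.
Proof. by rewrite lowpE size_poly. Qed.

Lemma lowp_cof n (P : {poly A}) : (size P <= n)%N -> lowp (cof n P) = P.
Proof.
move=> hP; apply/polyP => i; case: (ltnP i n) => hi.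
  by rewrite (coef_lowp _ (Ordinal hi)) ffunE.
by rewrite !nth_default //; [apply: leq_trans hi|apply: leq_trans (size_lowp _) hi].
Qed.

Lemma coef_mon n (c : {ffun 'I_n -> A}) (i : 'I_n) : (mon c)`_i = c i.
Proof.
by rewrite coefD coefXn coef_lowp ltn_eqF // add0r.
Qed.

Lemma size_mon n (c : {ffun 'I_n -> A}) : size (mon c) = n.+1.
Proof. by rewrite size_polyDl size_polyXn // ltnS size_lowp. Qed.

Lemma monic_mon n (c : {ffun 'I_n -> A}) : mon c \is monic.
Proof.
by rewrite monicE lead_coefDl ?lead_coefXn // size_polyXn ltnS size_lowp.
Qed.

Lemma cof_mon n (c : {ffun 'I_n -> A}) : cof n (mon c) = c.
Proof. by apply/ffunP => i; rewrite ffunE coef_mon. Qed.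

Lemma mon_inj n : injective (@mon n).
Proof. by move=> c d e; rewrite -(cof_mon c) e cof_mon. Qed.

Lemma mon_cof n (P : {poly A}) : P \is monic -> size P = n.+1 -> mon (cof n P) = P.
Proof.
move=> /monicP lP sP; apply/polyP => i; case: (ltngtP i n) => [hi|hi|->].
- by rewrite (coef_mon _ (Ordinal hi)) ffunE.
- by rewrite !nth_default // ?size_mon ?sP.
have := lP; have := monicP (monic_mon (cof n P)).
by rewrite /lead_coef size_mon sP /= => -> ->.
Qed.

Lemma monic_mulI (h u v : {poly A}) : h \is monic -> h * u = h * v -> u = v.
Proof. by move=> /monic_lreg; apply. Qed.

(** Cancelling the monic [h] gives [w * w' = 1]. Sizes add in spite of zero divisors because one
    factor is monic, so [w] is constant, and leading coefficients make it 1. *)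
Lemma monic_dvd_antisym (h h' w w' : {poly A}) : h \is monic -> h' \is monic ->
  h' = h * w -> h = h' * w' -> h = h'.
Proof.
move=> mh mh' e1 e2.
have : h * (w * w') = h * 1 by rewrite mulrA -e1 -e2 mulr1.
move/(monic_mulI mh) => ww.
have w0 : w != 0 by apply/eqP => w0; move: mh'; rewrite e1 w0 mulr0 monicE lead_coef0 eq_sym oner_eq0.
have w0' : w' != 0 by apply/eqP => w'0; move: mh; rewrite e2 w'0 mulr0 monicE lead_coef0 eq_sym oner_eq0.
have e1' : h' = w * h by rewrite mulrC.
have e2' : h = w' * h' by rewrite mulrC.
have s1 : size h' = (size w + size h).-1 by rewrite e1' size_Mmonic.
have s2 : size h = (size w' + size h').-1 by rewrite e2' size_Mmonic.
have sh : (0 < size h)%N by rewrite size_poly_gt0 monic_neq0.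
have sw : (0 < size w)%N by rewrite size_poly_gt0.
have sw' : (0 < size w')%N by rewrite size_poly_gt0.
have sw1 : (size w <= 1)%N by lia.
have wE := size1_polyC sw1.
have : lead_coef h' = w`_0.
  by rewrite e1' lead_coef_Mmonic // wE lead_coefC coefC.
rewrite (monicP mh') => w1.
by rewrite e1 wE -w1 mulr1.
Qed.

End FinitePolynomials.

(** * Local rings whose maximal ideal is generated by a nilpotent element *)

Section LocalRing.
Variables (A : finComUnitRingType) (pi : A) (e : nat).
Hypothesis pi_nilp : pi ^+ e = 0.
Hypothesis nonunit_pi : forall x : A, x \isn't a GRing.unit -> exists y, x = pi * y.

Lemma pi_nonunit y : pi * y \isn't a GRing.unit.
Proof.
rewrite unitrM negb_and; apply/orP; left; apply/negP => u.
by have := unitrX e u; rewrite pi_nilp unitr0.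
Qed.

Lemma unit_addpi x y : (x + pi * y \is a GRing.unit) = (x \is a GRing.unit).
Proof.
apply/idP/idP; apply: contraTT => /nonunit_pi [t ht].
  by rewrite ht -mulrDr pi_nonunit.
have -> : x = pi * (t - y) by rewrite mulrBr -ht addrK.
exact: pi_nonunit.
Qed.

Lemma nonunit_add (x y : A) : x \isn't a GRing.unit ->
  (x + y \is a GRing.unit) = (y \is a GRing.unit).
Proof. by move=> /nonunit_pi[t ->]; rewrite addrC unit_addpi. Qed.

Lemma nonunit_poly (P : {poly A}) : (forall i, P`_i \isn't a GRing.unit) ->
  exists Q, P = pi *: Q /\ (size Q <= size P)%N.
Proof.
move=> hP.
have [f hf] : exists f : nat -> A, forall i, P`_i = pi * f i.
  have h i := nonunit_pi (hP i).
  have h' i : exists y, P`_i == pi * y by case: (h i) => y ->; exists y.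
  by exists (fun i => xchoose (h' i)) => i; apply/eqP/(xchooseP (h' i)).
exists (\poly_(i < size P) f i); split; last exact: size_poly.
apply/polyP => i; rewrite coefZ coef_poly; case: ltnP => [_|hi] //.
by rewrite nth_default // mulr0.
Qed.

(** The element is [c] times 1 minus a nilpotent, so its inverse is a finite geometric series. *)
Lemma unit_poly (c : A) (Q : {poly A}) : c \is a GRing.unit ->
  exists W, (c%:P + pi *: Q) * W = 1.
Proof.
move=> uc; pose y : {poly A} := - (pi *: (c^-1 *: Q)).
have hy : y ^+ e = 0.
  by rewrite /y -scalerN exprZn pi_nilp scale0r.
have hc : c%:P + pi *: Q = c%:P * (1 - y).
  rewrite /y opprK mulrDr mulr1 mul_polyC !scalerA; congr (_ + _ *: _).
  by rewrite mulrAC divrr // mul1r.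
have := subrX1 y e; rewrite hy sub0r => h.
exists ((c^-1)%:P * \sum_(i < e) y ^+ i).
rewrite hc mulrACA -polyCM divrr // mul1r.
by apply: oppr_inj; rewrite -mulNr opprB -h.
Qed.

(* Coprimality modulo [pi] lifts: [h] and [g'] generate the unit ideal, so [h] divides [h']. *)
Lemma coprime_lift_dvd n (h h' g g' Q : {poly A}) :
  h = 'X^n + pi *: Q -> g'.[0] \is a GRing.unit -> h * g = h' * g' ->
  exists w, h' = h * w.
Proof.
move=> hE ug' hg.
have [w hw] : exists w, g' = 'X * w + (g'.[0])%:P.
  have : root (g' - (g'.[0])%:P) 0 by rewrite rootE !hornerE subrr.
  move/factor_theorem => [w hw]; exists w.
  by rewrite subr0 in hw; rewrite mulrC -hw subrK.
set c := g'.[0] in ug' hw.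
(* As g' is congruent to c modulo X, X divides 1 - y, so X^n divides (1 - y)^n, which is 1 modulo
   g'. Thus X^n and g' are comaximal; replacing X^n by h turns 1 into the unit 1 + pi Q V. *)
pose y := (c^-1)%:P * g'.
pose V := (- ((c^-1)%:P * w)) ^+ n.
have hXV : 'X^n * V = (1 - y) ^+ n.
  rewrite /V -exprMn; congr (_ ^+ _).
  rewrite /y hw mulrDr -polyCM mulVr // opprD addrCA subrr addr0 mulrN.
  by rewrite mulrCA.
have [Y hY] : exists Y, (1 - y) ^+ n = 1 + g' * Y.
  exists (- (c^-1)%:P * \sum_(i < n) (1 - y) ^+ i).
  apply/(addIr (-1)); rewrite subrX1 addrAC subrr add0r.
  rewrite addrAC subrr add0r mulrA; congr (_ * _).
  by rewrite /y mulrN mulrC.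
have [W hW] : exists W, (1 + pi *: (Q * V)) * W = 1.
  by apply: unit_poly; rewrite unitr1.
have hV : h * V = 1 + pi *: (Q * V) + g' * Y.
  by rewrite hE mulrDl hXV hY scalerAl addrAC.
have one : 1 = h * (V * W) - g' * (Y * W).
  by rewrite !mulrA hV mulrDl hW -addrA subrr addr0.
exists (h' * (V * W) - g * (Y * W)).
transitivity (h' * (h * (V * W) - g' * (Y * W))); first by rewrite -one mulr1.
by rewrite !mulrBr !mulrA hg [h' * h]mulrC.
Qed.

Lemma unit_factor_inj (h h' u u' W W' : {poly A}) : h \is monic -> h' \is monic ->
  u * W = 1 -> u' * W' = 1 -> h * u = h' * u' -> h = h' /\ u = u'.
Proof.
move=> mh mh' uW uW' huE.
have hh : h = h'.
  apply: (@monic_dvd_antisym _ h h' (u * W') (u' * W)) => //.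
    by rewrite mulrA huE -mulrA uW' mulr1.
  by rewrite mulrA -huE -mulrA uW mulr1.
split=> //; rewrite -hh in huE; exact: (monic_mulI mh huE).
Qed.

Lemma coprime_factor_inj n n' (h h' g g' Q Q' : {poly A}) : h \is monic -> h' \is monic ->
  h = 'X^n + pi *: Q -> h' = 'X^n' + pi *: Q' ->
  g.[0] \is a GRing.unit -> g'.[0] \is a GRing.unit ->
  h * g = h' * g' -> h = h' /\ g = g'.
Proof.
move=> mh mh' hE hE' ug ug' hg.
have [w e1] := coprime_lift_dvd hE ug' hg.
have [w' e2] := coprime_lift_dvd hE' ug (esym hg).
have hh := monic_dvd_antisym mh mh' e1 e2.
split=> //; rewrite -hh in hg; exact: (monic_mulI mh hg).
Qed.

End LocalRing.

(** An injection between finite sets of equal size is onto. This takes the place of a Hensel lifting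
    argument for the existence of factorisations. *)
Lemma sum_inj_card (L : nmodType) (I J : finType) (P : pred I) (Q : pred J)
    (phi : I -> J) (F : J -> L) :
  (forall i, P i -> Q (phi i)) ->
  (forall i i', P i -> P i' -> phi i = phi i' -> i = i') ->
  #|P| = #|Q| -> \sum_(j | Q j) F j = \sum_(i | P i) F (phi i).
Proof.
move=> hPQ hinj hc.
have him : [set phi i | i in P] = [set j | Q j].
  apply/eqP; rewrite eqEcard; apply/andP; split.
    by apply/subsetP => j /imsetP[i iP ->]; rewrite inE hPQ.
  rewrite card_in_imset ?hc; last by move=> i i' iP iP'; apply: hinj.
  by rewrite cardsE.
transitivity (\sum_(j in [set phi i | i in P]) F j).
  by rewrite him; apply: eq_bigl => j; rewrite inE.
by rewrite big_imset //= => i i' iP iP'; apply: hinj.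
Qed.

Lemma card_sigma (I : finType) (T : I -> finType) (P : forall i, pred (T i)) :
  #|[pred t : {i : I & T i} | P (tag t) (tagged t)]| = (\sum_i #|P i|)%N.
Proof.
rewrite -sum1_card -(@sig_big_dep _ _ _ _ _ predT P (fun _ _ => 1%N)) /=.
by apply: eq_bigr => i _; rewrite sum1_card.
Qed.

Lemma card_forall_ffun (A : finType) n (P : pred A) :
  #|[pred c : {ffun 'I_n -> A} | [forall i, P (c i)]]| = (#|P| ^ n)%N.
Proof.
rewrite -[in RHS](card_ord n) -(@card_ffun_on 'I_n A P); apply: eq_card => c.
by apply/forallP/ffun_onP.
Qed.

(** * Splitting off the nonunit roots of a monic polynomial *)

Section Peel.
Variables (A : finComUnitRingType) (pi : A) (e : nat).
Hypothesis pi_nilp : pi ^+ e = 0.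
Hypothesis nonunit_pi : forall x : A, x \isn't a GRing.unit -> exists y, x = pi * y.
Variables (T : finZmodType) (cl : A -> T).
Hypothesis cl_add : {morph cl : x y / x + y}.
Hypothesis cl_sep : forall x y, cl x = cl y -> x - y \isn't a GRing.unit.

Definition nonunits : {set A} := [set x | x \isn't a GRing.unit].
Definition units : {set A} := [set x | x \is a GRing.unit].
(** Roots are counted up to [cl], which will be reduction from Z/p^K to Z/p^k: the number of roots
    modulo p^K itself can grow with K. *)
Definition nz (S : {set A}) (f : {poly A}) := #|[set cl r | r in S & root f r]|.

Lemma card_nonunits_units : (#|nonunits| + #|units| = #|A|)%N.
Proof.
rewrite addnC -(cardsC units); congr (_ + #|pred_of_set _|)%N.
by apply/setP => x; rewrite !inE.
Qed.


Lemma eq_nz (S : {set A}) (f g : {poly A}) : {in S, root f =1 root g} -> nz S f = nz S g.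
Proof.
move=> h; rewrite /nz; suff -> : [set r in S | root f r] = [set r in S | root g r] by [].
by apply/setP => r; rewrite !inE; case: (boolP (r \in S)) => //= /h ->.
Qed.

(** By [cl_sep], elements whose difference is a unit lie in different classes, so no class is
    counted twice. *)
Lemma nzU (S S' : {set A}) (f : {poly A}) : (forall x y, x \in S -> y \in S' -> x - y \is a GRing.unit) ->
  nz (S :|: S') f = (nz S f + nz S' f)%N.
Proof.
move=> h; rewrite /nz.
have -> : [set r in S :|: S' | root f r] = [set r in S | root f r] :|: [set r in S' | root f r].
  by apply/setP => r; rewrite !inE andb_orl.
rewrite imsetU cardsU.
set I := _ :&: _; suff -> : I = set0 by rewrite cards0 subn0.
apply/setP => t; rewrite !inE; apply/negbTE/negP => /andP[/imsetP[x]].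
rewrite inE => /andP[xS _] -> /imsetP[y]; rewrite inE => /andP[yS _] /cl_sep.
by rewrite (h _ _ xS yS).
Qed.

Lemma card_forall_nonunit n :
  #|[pred d : {ffun 'I_n -> A} | [forall i, d i \isn't a GRing.unit]]| = (#|nonunits| ^ n)%N.
Proof.
rewrite (card_forall_ffun n (fun x => x \isn't a GRing.unit)); congr (_ ^ _)%N.
by apply: eq_card => x; rewrite inE.
Qed.

Lemma card_first_unit n :
  #|[pred g : {ffun 'I_n.+1 -> A} | g ord0 \is a GRing.unit]| = (#|units| * #|A| ^ n)%N.
Proof.
pose F (i : 'I_n.+1) : pred A := fun x => (i == ord0) ==> (x \is a GRing.unit).
transitivity (#|family F|).
  apply: eq_card => g; apply/idP/familyP => [h i|/(_ ord0)]; rewrite ?inE /F /=.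
    by case: eqVneq => // ->.
  by rewrite unfold_in /= ?eqxx.
rewrite card_family foldrE big_map big_enum big_ord_recl /=; congr (_ * _)%N.
  by apply: eq_card => x; rewrite !inE /F eqxx.
rewrite (eq_bigr (fun=> #|A|)); first by rewrite prod_nat_const card_ord.
by [].
Qed.

Lemma card_mon0_unit n :
  #|[pred g : {ffun 'I_n -> A} | (mon g).[0] \is a GRing.unit]| =
    (if n is m.+1 then #|units| * #|A| ^ m else 1)%N.
Proof.
case: n => [|n].
  rewrite -[RHS](@card1 _ [ffun i : 'I_0 => (0 : A)]); apply: eq_card => g.
  rewrite !inE horner_coef0 coefD coefXn eqxx /lowp big_ord0 coef0 addr0 unitr1.
  by apply/esym/eqP/ffunP => -[].
rewrite -card_first_unit; apply: eq_card => g.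
by rewrite !inE horner_coef0 (coef_mon g ord0).
Qed.

(** Counts pairs of a distinguished polynomial of degree m and a monic one of degree n - m with unit
    constant term. In the induction the term m = 0 contributes the units, the others |nonunits|
    times the preceding case. *)
Lemma card_mon0_unit_sum n :
  (\sum_(m < n.+1) #|nonunits| ^ m *
    #|[pred g : {ffun 'I_(n - m) -> A} | (mon g).[0%R] \is a GRing.unit]| = #|A| ^ n)%N.
Proof.
elim: n => [|n IH]; first by rewrite big_ord1 card_mon0_unit expn0.
rewrite big_ord_recl /= card_mon0_unit subn0.
under eq_bigr do rewrite /bump /= add1n subSS expnS -mulnA.
by rewrite -big_distrr /= IH mul1n -mulnDl addnC card_nonunits_units expnS.
Qed.

Lemma mon_nonunit n (d : {ffun 'I_n -> A}) : [forall i, d i \isn't a GRing.unit] ->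
  exists Q, mon d = 'X^n + pi *: Q.
Proof.
move=> /forallP hd; have [] := @nonunit_poly _ _ nonunit_pi (lowp d).
  move=> i; rewrite lowpE coef_poly; case: ltnP => hi; rewrite ?unitr0 //.
  by rewrite insubT.
by move=> Q [hQ _]; exists Q; rewrite /mon hQ.
Qed.

Lemma root_mulr (f g : {poly A}) x : g.[x] \is a GRing.unit -> root (f * g) x = root f x.
Proof.
move=> u; rewrite !rootE hornerM; apply/eqP/eqP => [h|->]; last by rewrite mul0r.
by apply: (mulIr u); rewrite h mul0r.
Qed.

Lemma horner_pi (f Q : {poly A}) x :
  ((f + pi *: Q).[x] \is a GRing.unit) = (f.[x] \is a GRing.unit).
Proof. by rewrite hornerD hornerZ (unit_addpi pi_nilp nonunit_pi). Qed.

Lemma horner_nonunit (f : {poly A}) x : x \isn't a GRing.unit ->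
  (f.[x] \is a GRing.unit) = (f.[0] \is a GRing.unit).
Proof.
have : root (f - (f.[0])%:P) 0 by rewrite rootE !hornerE subrr.
move/factor_theorem => [w]; rewrite subr0 => hw /nonunit_pi[y hx].
have -> : f.[x] = f.[0] + pi * (w.[x] * y).
  rewrite -[f in LHS](subrK (f.[0])%:P) hw hornerD hornerM hornerX hornerC.
  by rewrite {2}hx addrC mulrCA.
exact: (unit_addpi pi_nilp nonunit_pi).
Qed.

(** Separate weights are kept because the second factor does not involve [w]: w = z and w = 1 give
    two sums with the same cofactor, which can then be eliminated. *)
Lemma sum_monic_peel (L : comPzRingType) (z w : L) (S : {set A}) n : S \subset units ->
  \sum_(c : {ffun 'I_n -> A}) z ^+ nz S (mon c) * w ^+ nz nonunits (mon c) =
  \sum_(m < n.+1)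
    (\sum_(d : {ffun 'I_m -> A} | [forall i, d i \isn't a GRing.unit])
        w ^+ nz nonunits (mon d)) *
    (\sum_(g : {ffun 'I_(n - m) -> A} | (mon g).[0] \is a GRing.unit) z ^+ nz S (mon g)).
Proof.
move=> hS.
pose J (m : 'I_n.+1) : finType := ({ffun 'I_m -> A} * {ffun 'I_(n - m) -> A})%type.
pose P (m : 'I_n.+1) (t : J m) := [forall i, t.1 i \isn't a GRing.unit]
  && ((mon t.2).[0] \is a GRing.unit).
pose phi (t : {m : 'I_n.+1 & J m}) := cof n (mon (tagged t).1 * mon (tagged t).2).
have size_prod (t : {m : 'I_n.+1 & J m}) :
    size (mon (tagged t).1 * mon (tagged t).2) = n.+1.
  case: t => m [d g] /=; rewrite size_monicM ?monic_mon ?monic_neq0 ?monic_mon //.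
  by rewrite !size_mon addnS /= addSn subnKC // -ltnS.
have phiE t : mon (phi t) = mon (tagged t).1 * mon (tagged t).2.
  by rewrite /phi mon_cof ?size_prod // monicMl ?monic_mon.
rewrite (@sum_inj_card _ _ _ (fun t : {m : 'I_n.+1 & J m} => P (tag t) (tagged t)) _ phi) //=.
- rewrite -(@sig_big_dep _ _ _ _ _ predT P (fun m (t : J m) =>
    z ^+ nz S (mon (phi (Tagged J t))) * w ^+ nz nonunits (mon (phi (Tagged J t))))) /=.
  apply: eq_bigr => m _; rewrite big_distrlr pair_big /=.
  apply: eq_bigr => -[d g] /andP[/= hd hg]; rewrite phiE /= mulrC; congr (_ * _).
    congr (_ ^+ _); apply: eq_nz => x; rewrite inE => hx.
    by rewrite root_mulr // horner_nonunit.
  congr (_ ^+ _); apply: eq_nz => x /(subsetP hS); rewrite inE => hx.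
  rewrite mulrC root_mulr //; have [Q ->] := mon_nonunit hd.
  by rewrite horner_pi hornerXn unitrX.
- move=> [m [d g]] [m' [d' g']] /= /andP[/= hd hg] /andP[/= hd' hg'] /(congr1 (@mon A n)).
  rewrite !phiE /= => E.
  have [Q hQ] := mon_nonunit hd; have [Q' hQ'] := mon_nonunit hd'.
  have [e1 e2] := coprime_factor_inj pi_nilp (monic_mon d) (monic_mon d') hQ hQ' hg hg' E.
  have mm : m = m'.
    by apply/val_inj/succn_inj; rewrite /= -(size_mon d) -(size_mon d') e1.
  by subst m'; rewrite (mon_inj e1) (mon_inj e2).
- rewrite (card_sigma P) card_ffun card_ord -card_mon0_unit_sum.
  apply: eq_bigr => m _; rewrite -card_forall_nonunit -cardX.
  by apply: eq_card => t; rewrite !inE.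
Qed.

End Peel.

(** * Reversal with respect to a prescribed degree *)

Section ReversePoly.
Variable R : comNzRingType.
Implicit Types P Q : {poly R}.

(** This is x^n P(1/x) with n prescribed rather than read off P: leading coefficients may vanish
    modulo p^K, and reversal has to commute with reduction. *)
Definition revp n P : {poly R} := \sum_(i < n.+1) P`_i *: 'X^(n - i).

Lemma revpD n P Q : revp n (P + Q) = revp n P + revp n Q.
Proof. by rewrite /revp -big_split; apply: eq_bigr => i _; rewrite coefD scalerDl. Qed.

Lemma revpZ n a P : revp n (a *: P) = a *: revp n P.
Proof. by rewrite /revp scaler_sumr; apply: eq_bigr => i _; rewrite coefZ scalerA. Qed.

Lemma revp_sum n (I : finType) (F : I -> {poly R}) :
  revp n (\sum_i F i) = \sum_i revp n (F i).
Proof.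
apply: (big_morph (revp n) (revpD n)).
by rewrite /revp big1 // => i _; rewrite coef0 scale0r.
Qed.

Lemma revpXn n m : (m <= n)%N -> revp n 'X^m = 'X^(n - m).
Proof.
move=> mn; rewrite /revp (bigD1 (Ordinal (mn : (m < n.+1)%N))) //= big1 ?addr0.
  by rewrite coefXn eqxx scale1r.
by move=> i im; rewrite coefXn -[i == m :> nat]/(i == Ordinal (mn : (m < n.+1)%N)) (negbTE im) scale0r.
Qed.

Lemma coef_revp n P k : (k <= n)%N -> (revp n P)`_k = P`_(n - k).
Proof.
move=> kn; rewrite /revp coef_sum.
have h : (n - k < n.+1)%N by rewrite ltnS leq_subr.
rewrite (bigD1 (Ordinal h)) //= big1 ?addr0.
  by rewrite coefZ coefXn subKn // eqxx mulr1.
move=> i ik; rewrite coefZ coefXn; case: eqP => [E|]; last by rewrite mulr0.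
by case/eqP: ik; apply/val_inj; rewrite /= E subKn // -ltnS.
Qed.

Lemma size_revp n P : (size (revp n P) <= n.+1)%N.
Proof.
apply: leq_trans (size_sum _ _ _) _; apply/bigmax_leqP => i _.
by apply: leq_trans (size_scale_leq _ _) _; rewrite size_polyXn ltnS leq_subr.
Qed.

Lemma revpK n P : (size P <= n.+1)%N -> revp n (revp n P) = P.
Proof.
move=> sP; apply/polyP => i; case: (leqP i n) => hi.
  by rewrite !coef_revp ?leq_subr // subKn.
by rewrite !nth_default // ?(leq_trans sP) ?(leq_trans (size_revp _ _)).
Qed.

Lemma poly_sum_ord n P : (size P <= n)%N -> P = \sum_(i < n) P`_i *: 'X^i.
Proof.
move=> sP; rewrite -poly_def; apply/polyP => i; rewrite coef_poly.
by case: ltnP => // hi; rewrite nth_default // (leq_trans sP).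
Qed.

Lemma revpM a b P Q : (size P <= a.+1)%N -> (size Q <= b.+1)%N ->
  revp (a + b) (P * Q) = revp a P * revp b Q.
Proof.
move=> sP sQ; rewrite {1}(poly_sum_ord sP) {1}(poly_sum_ord sQ).
rewrite big_distrlr /= revp_sum /revp big_distrlr /=.
apply: eq_bigr => i _; rewrite -!/(revp _ _) revp_sum; apply: eq_bigr => j _.
rewrite -scalerAl -scalerAr -exprD !revpZ revpXn; last first.
  by rewrite leq_add // -ltnS.
rewrite -scalerAl -scalerAr -exprD; congr (_ *: (_ *: 'X^ _)).
by have := ltn_ord i; have := ltn_ord j; lia.
Qed.

End ReversePoly.

(** * Translation, and factorisation of primitive polynomials *)

Section Factor.
Variables (A : finComUnitRingType) (pi : A) (e : nat).
Hypothesis pi_nilp : pi ^+ e = 0.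
Hypothesis nonunit_pi : forall x : A, x \isn't a GRing.unit -> exists y, x = pi * y.
Variables (T : finZmodType) (cl : A -> T).
Hypothesis cl_add : {morph cl : x y / x + y}.
Notation nz := (nz cl).
Notation nonunits := (nonunits A).
Notation units := (units A).

Lemma comp_mon_monic n (c : {ffun 'I_n -> A}) a :
  (mon c \Po ('X + a%:P)) \is monic /\ size (mon c \Po ('X + a%:P)) = n.+1.
Proof.
have sX : size (('X + a%:P) ^+ n) = n.+1.
  by rewrite -[a]opprK polyCN size_exp_XsubC.
have mX : ('X + a%:P) ^+ n \is monic by rewrite monic_exp // monicXaddC.
have sl : (size (lowp c \Po ('X + a%:P)) < size (('X + a%:P) ^+ n)%R)%N.
  rewrite sX ltnS; case: n c {sX mX} => [|n] c.
    by rewrite /lowp big_ord0 comp_poly0 size_poly0.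
  apply: leq_trans (size_comp_poly_leq _ _) _; rewrite size_XaddC muln1 ltnS.
  by have := size_lowp c; case: (size _).
rewrite /mon comp_polyD comp_Xn_poly monicE lead_coefDl // size_polyDl //.
Qed.

Lemma sum_monic_translate (L : nmodType) n (a : A) (G : {poly A} -> L) :
  \sum_(c : {ffun 'I_n -> A}) G (mon c) =
  \sum_(c : {ffun 'I_n -> A}) G (mon c \Po ('X + a%:P)).
Proof.
pose phi b (c : {ffun 'I_n -> A}) := cof n (mon c \Po ('X + b%:P)).
have phiE b c : mon (phi b c) = mon c \Po ('X + b%:P).
  by have [m s] := comp_mon_monic c b; rewrite mon_cof.
have phiK b : cancel (phi b) (phi (- b)).
  move=> c; apply: (@mon_inj A n); rewrite !phiE -comp_polyA.
  have -> : ('X + b%:P) \Po ('X + (- b)%:P) = 'X :> {poly A}.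
    by rewrite comp_polyD comp_polyX comp_polyC polyCN addrNK.
  by rewrite comp_polyXr.
have phiK' b : cancel (phi (- b)) (phi b) by move=> c; have := phiK (- b) c; rewrite opprK.
rewrite (reindex (phi a)) /=; first by apply: eq_bigr => c _; rewrite phiE.
by apply: onW_bij; exists (phi (- a)).
Qed.

Lemma nz_translate (S S' : {set A}) (a : A) (f : {poly A}) :
  (forall x, (x \in S) = (x + a \in S')) ->
  nz S (f \Po ('X + a%:P)) = nz S' f.
Proof.
move=> hS; rewrite /nz -[LHS](card_imset _ (@addIr _ (cl a))) -imset_comp.
suff -> : [set r in S' | root f r] =
    (fun x => x + a) @: [set r in S | root (f \Po ('X + a%:P)) r].
  rewrite -imset_comp; congr #|pred_of_set _|; apply: eq_imset => x /=.
  by rewrite cl_add.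
have hr x : root (f \Po ('X + a%:P)) x = root f (x + a).
  by rewrite !rootE horner_comp !hornerE.
apply/setP => x; apply/idP/imsetP => [|[y]]; rewrite !inE.
  move=> hx; exists (x - a); last by rewrite subrK.
  by rewrite inE hr hS subrK.
by rewrite hr hS => h ->.
Qed.

(** The terms count triples of a monic polynomial of degree s, a unit, and a distinguished
    polynomial of degree j - 1 - s; the last summand counts the nonprimitive polynomials of degree <
    j. Both factorisations of primitive polynomials below are counted this way. *)
Lemma sum_card_factor j :
  (\sum_(s < j) #|A| ^ s * (#|units| * #|nonunits| ^ (j.-1 - s)) + #|nonunits| ^ j = #|A| ^ j)%N.
Proof.
elim: j => [|j IH]; first by rewrite big_ord0.
rewrite big_ord_recr /= subnn expn0 muln1.
rewrite (eq_bigr (fun s : 'I_j => #|nonunits| * (#|A| ^ s * (#|units| * #|nonunits| ^ (j.-1 - s)))))%N.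
  rewrite -big_distrr /= -addnA [X in (_ + X)%N]addnC addnA expnS -mulnDr IH mulnC -mulnDr.
  by rewrite card_nonunits_units mulnC -expnS.
move=> s _; rewrite [RHS]mulnCA; congr (_ * _)%N; rewrite [RHS]mulnCA; congr (_ * _)%N.
rewrite -expnS; by congr (_ ^ _)%N; have := ltn_ord s; lia.
Qed.

Lemma card_primitive j :
  #|[pred g : {ffun 'I_j -> A} | ~~ [forall i, g i \isn't a GRing.unit]]| =
  (\sum_(s < j) #|A| ^ s * (#|units| * #|nonunits| ^ (j.-1 - s)))%N.
Proof.
have := sum_card_factor j; rewrite -card_forall_nonunit.
have := cardC [pred g : {ffun 'I_j -> A} | [forall i, g i \isn't a GRing.unit]].
rewrite card_ffun card_ord => <-; rewrite [X in X = _]addnC => /eqP; rewrite eqn_add2l => /eqP ->.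
by apply: eq_card => g; rewrite !inE.
Qed.

(** Otherwise the leading coefficient 1 of [h] would be a multiple of pi; so such products are
    primitive. *)
Lemma pi_neq_unit (h u W Q : {poly A}) : h \is monic -> u * W = 1 -> h * u != pi *: Q.
Proof.
move=> mh uW; apply/eqP => E.
have : h = pi *: (Q * W) by rewrite scalerAl -E -mulrA uW mulr1.
move/(congr1 lead_coef); rewrite (monicP mh) /lead_coef coefZ => h1.
by have := @pi_nonunit _ _ _ pi_nilp ((Q * W)`_(size (pi *: (Q * W))).-1); rewrite -h1 unitr1.
Qed.

Lemma lowp_nonunit n (d : {ffun 'I_n -> A}) : [forall i, d i \isn't a GRing.unit] ->
  exists Q, lowp d = pi *: Q.
Proof.
by move=> /(mon_nonunit nonunit_pi)[Q] /addrI ->; exists Q.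
Qed.

Lemma revp_mon_nonunit n (d : {ffun 'I_n -> A}) : [forall i, d i \isn't a GRing.unit] ->
  exists Q, revp n (mon d) = 1 + pi *: Q.
Proof.
move=> /(mon_nonunit nonunit_pi)[Q ->]; exists (revp n Q).
by rewrite revpD revpXn // subnn expr0 revpZ.
Qed.

(** In f = h (c w) the second factor is a unit constant plus a multiple of pi, so it has unit values
    and f has the roots of h. After reversal h has constant term 1, hence no nonunit root, and the
    nonunit roots left are those of d. *)
Lemma sum_primitive (L : comPzRingType) (z : L) n :
  \sum_(f : {ffun 'I_n.+1 -> A} | ~~ [forall i, f i \isn't a GRing.unit])
     z ^+ (nz setT (lowp f) + nz nonunits (revp n (lowp f))) =
  \sum_(s < n.+1) (\sum_(h : {ffun 'I_s -> A}) z ^+ nz setT (mon h)) *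
     ((\sum_(d : {ffun 'I_(n - s) -> A} | [forall i, d i \isn't a GRing.unit])
          z ^+ nz nonunits (mon d)) *+ #|units|).
Proof.
pose J (s : 'I_n.+1) : finType := ({ffun 'I_s -> A} * ({ffun 'I_(n - s) -> A} * A))%type.
pose P (s : 'I_n.+1) (t : J s) := [forall i, t.2.1 i \isn't a GRing.unit] && (t.2.2 \is a GRing.unit).
pose w (t : {s : 'I_n.+1 & J s}) := revp (n - tag t) (mon (tagged t).2.1).
pose F (t : {s : 'I_n.+1 & J s}) := mon (tagged t).1 * ((tagged t).2.2 *: w t).
pose phi t := cof n.+1 (F t).
have sw t : (size (w t) <= (n - tag t).+1)%N by rewrite size_revp.
have phiE t : lowp (phi t) = F t.
  rewrite lowp_cof //; apply: leq_trans (size_polyMleq _ _) _; rewrite size_mon.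
  have := leq_trans (size_scale_leq (tagged t).2.2 (w t)) (sw t).
  have := ltn_ord (tag t); move: (tag t) (size _) => m k; lia.
have unitW (t : {s : 'I_n.+1 & J s}) : P (tag t) (tagged t) ->
    exists Q, (tagged t).2.2 *: w t = ((tagged t).2.2)%:P + pi *: Q.
  move=> /andP[/revp_mon_nonunit [Q hQ] uc]; rewrite /w hQ.
  by exists ((tagged t).2.2 *: Q); rewrite scalerDr alg_polyC !scalerA mulrC.
rewrite (@sum_inj_card _ _ _ (fun t : {s : 'I_n.+1 & J s} => P (tag t) (tagged t)) _ phi) //=.
- rewrite -(@sig_big_dep _ _ _ _ _ predT P (fun m (t : J m) =>
    z ^+ (nz setT (lowp (phi (Tagged J t))) + nz nonunits (revp n (lowp (phi (Tagged J t))))))) /=.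
  apply: eq_bigr => s _; set a := (X in X * _); set b := (X in X *+ _).
  have -> : b *+ #|units| = \sum_(dc : {ffun 'I_(n - s) -> A} * A |
      [forall i, dc.1 i \isn't a GRing.unit] && (dc.2 \is a GRing.unit))
      z ^+ nz nonunits (mon dc.1).
    rewrite -(pair_big (fun d : {ffun 'I_(n - s) -> A} => [forall i, d i \isn't a GRing.unit])
      (fun c : A => c \is a GRing.unit) (fun d _ => z ^+ nz nonunits (mon d))) /=.
    rewrite /b -sumrMnl; apply: eq_bigr => d _; rewrite sumr_const.
    by congr (_ *+ _); apply: eq_card => x; rewrite inE.
  rewrite /a big_distrlr pair_big /=; apply: eq_bigr => -[h [d c]] Pt.
  rewrite phiE -exprD; congr (_ ^+ (_ + _)).
    apply: eq_nz => x _; rewrite /F root_mulr //=.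
    have [Q ->] := unitW (Tagged J (h, (d, c))) Pt.
    by rewrite (horner_pi pi_nilp nonunit_pi) hornerC; case/andP: Pt.
  apply: eq_nz => x; rewrite inE => hx.
  have sn : (s + (n - s) = n)%N by rewrite subnKC // -ltnS.
  rewrite -[X in revp X]sn /F revpM ?size_mon //; last first.
    by apply: leq_trans (size_scale_leq _ _) _; rewrite sw.
  rewrite revpZ /w revpK ?size_mon //= mulrC root_mulr.
    rewrite !rootE hornerZ; case/andP: Pt => _ /= uc.
    by apply/eqP/eqP => [h0|->]; [apply: (mulrI uc); rewrite h0 mulr0|rewrite mulr0].
  rewrite (horner_nonunit pi_nilp nonunit_pi) // horner_coef0 coef_revp // subn0.
  by have := monicP (monic_mon h); rewrite /lead_coef size_mon /= => ->; rewrite unitr1.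
- move=> t Pt; have [Q hQ] := unitW t Pt.
  have [W hW] := unit_poly pi_nilp Q (andP Pt).2.
  apply/negP => /lowp_nonunit [Q' hQ'].
  have := pi_neq_unit Q' (monic_mon (tagged t).1) hW.
  by rewrite -hQ -hQ' phiE eqxx.
- move=> [s [h [d c]]] [s' [h' [d' c']]] Pt Pt' /(congr1 (@lowp A n.+1)); rewrite !phiE.
  have [Q hQ] := unitW _ Pt; have [W hW] := unit_poly pi_nilp Q (andP Pt).2.
  have [Q' hQ'] := unitW _ Pt'; have [W' hW'] := unit_poly pi_nilp Q' (andP Pt').2.
  rewrite -hQ in hW; rewrite -hQ' in hW'.
  move=> /(unit_factor_inj (monic_mon h) (monic_mon h') hW hW') /= [e1 e2].
  have ss : s = s'.
    by apply/val_inj/succn_inj; rewrite /= -(size_mon h) -(size_mon h') e1.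
  subst s'; move: e2; rewrite /w /= => e2.
  (* The reversal of a monic polynomial has constant term 1, so [c] is the constant coefficient of
     [c *: w]. *)
  have cc : c = c'.
    move/(congr1 (fun P : {poly A} => P`_0)): e2; rewrite !coefZ !coef_revp // subn0.
    have := monicP (monic_mon d); have := monicP (monic_mon d').
    by rewrite /lead_coef !size_mon /= => -> ->; rewrite !mulr1.
  subst c'; rewrite (mon_inj e1); congr (Tagged J (_, (_, _))).
  have uc : c \is a GRing.unit by case/andP: Pt.
  move/(congr1 (fun P => revp (n - s) (c^-1 *: P))): e2; rewrite !scalerA mulVr // !scale1r.
  by rewrite !revpK ?size_mon // => /mon_inj.
- rewrite (card_sigma P) card_primitive /=; apply: eq_bigr => s _.
  transitivity (#|{: {ffun 'I_s -> A}}| *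
    (#|[pred d : {ffun 'I_(n - s) -> A} | [forall i, d i \isn't a GRing.unit]]| * #|units|))%N.
    by rewrite -!cardX; apply: eq_card => -[h [d c]]; rewrite !inE.
  by rewrite card_ffun card_ord card_forall_nonunit [(_ * #|units|)%N]mulnC.
Qed.

(** Here s is the degree of g modulo pi, c its coefficient at s, and d its coefficients above s.
    Given s, h, c and d, exactly one choice of the coefficients below s makes h divide g + U, and
    the quotient is a unit of A[x], so only h has roots. The choices of c and d give the
    multiplicity. *)
Lemma sum_primitive_perturbed (L : comPzRingType) (z : L) j (U : {poly A}) :
  (forall i, U`_i \isn't a GRing.unit) ->
  \sum_(g : {ffun 'I_j -> A} | ~~ [forall i, g i \isn't a GRing.unit])
     z ^+ nz setT (lowp g + U) =
  \sum_(s < j) (\sum_(h : {ffun 'I_s -> A}) z ^+ nz setT (mon h)) *+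
     (#|units| * #|nonunits| ^ (j.-1 - s)).
Proof.
move=> Unu.
pose J (s : 'I_j) : finType := ({ffun 'I_s -> A} * ({ffun 'I_(j.-1 - s) -> A} * A))%type.
pose P (s : 'I_j) (t : J s) := [forall i, t.2.1 i \isn't a GRing.unit] && (t.2.2 \is a GRing.unit).
pose up (t : {s : 'I_j & J s}) : {poly A} :=
  (tagged t).2.2 *: 'X^(tag t) + 'X^((tag t).+1) * lowp (tagged t).2.1 + U.
(* Subtracting the remainder, of size at most s, makes [up] divisible by h and touches only
   coefficients below s. *)
pose q t := Pdiv.Ring.rdivp (up t) (mon (tagged t).1).
pose r t := Pdiv.Ring.rmodp (up t) (mon (tagged t).1).
pose phi t := cof j (up t - r t - U).
have upE t : up t = q t * mon (tagged t).1 + r t by apply/Pdiv.RingMonic.rdivp_eq/monic_mon.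
have sr t : (size (r t) <= tag t)%N.
  by rewrite -ltnS -(size_mon (tagged t).1) Pdiv.Ring.ltn_rmodpN0 // monic_neq0 ?monic_mon.
have phiE t : lowp (phi t) + U = mon (tagged t).1 * q t.
  rewrite lowp_cof; first by rewrite subrK {1}upE addrK mulrC.
  rewrite addrAC /up addrK; apply: leq_trans (size_polyD _ _) _.
  rewrite size_polyN geq_max; apply/andP; split; last first.
    by apply: leq_trans (sr t) _; apply: ltnW.
  apply: leq_trans (size_polyD _ _) _; rewrite geq_max; apply/andP; split.
    by apply: leq_trans (size_scale_leq _ _) _; rewrite size_polyXn.
  have [->|nz0] := eqVneq (lowp (tagged t).2.1) 0; first by rewrite mulr0 size_poly0.
  rewrite size_monicM ?monicXn // size_polyXn /=.
  have := size_lowp (tagged t).2.1; have := ltn_ord (tag t).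
  move: (size (lowp (tagged t).2.1)) => b; move: (nat_of_ord (tag t)) => a.
  lia.
have unitW (t : {s : 'I_j & J s}) : P (tag t) (tagged t) ->
    exists Q, q t = ((tagged t).2.2)%:P + pi *: Q.
  move=> /andP[/lowp_nonunit [Q1 hQ1] uc].
  have [|Q2 [hQ2 _]] := nonunit_poly nonunit_pi (P := U); first by [].
  set h := mon (tagged t).1; set c := (tagged t).2.2.
  pose Q3 := 'X^((tag t).+1) * Q1 + Q2.
  have E3 := Pdiv.RingMonic.rdivp_eq (monic_mon (tagged t).1) Q3.
  exists (Pdiv.Ring.rdivp Q3 h); rewrite /q.
  (* The division is made explicit: up = c X^s + pi Q3 and X^s = h - [lowp], so the quotient is c
     plus pi times that of Q3, by uniqueness of division. *)
  have -> : up t = (c%:P + pi *: Pdiv.Ring.rdivp Q3 h) * h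
      + (pi *: Pdiv.Ring.rmodp Q3 h - c *: lowp (tagged t).1).
    have -> : up t = c%:P * 'X^(tag t) + pi%:P * Q3.
      by rewrite /up hQ1 hQ2 /Q3 -/c -!mul_polyC; ring.
    rewrite {1}E3 -/h -!mul_polyC /h /mon; ring.
  rewrite /Pdiv.Ring.rdivp Pdiv.RingMonic.redivp_eq ?monic_mon //.
  rewrite size_mon ltnS; apply: leq_trans (size_polyD _ _) _; rewrite size_polyN geq_max.
  apply/andP; split; apply: leq_trans (size_scale_leq _ _) _; rewrite ?size_lowp //.
  by rewrite -ltnS -(size_mon (tagged t).1) Pdiv.Ring.ltn_rmodpN0 // monic_neq0 ?monic_mon.
rewrite (@sum_inj_card _ _ _ (fun t : {s : 'I_j & J s} => P (tag t) (tagged t)) _ phi) //=.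
- rewrite -(@sig_big_dep _ _ _ _ _ predT P (fun m (t : J m) =>
    z ^+ (nz setT (lowp (phi (Tagged J t)) + U)))) /=.
  apply: eq_bigr => s _.
  rewrite -(pair_big xpredT (fun dc : {ffun 'I_(j.-1 - s) -> A} * A => [forall i, dc.1 i \isn't a GRing.unit]
    && (dc.2 \is a GRing.unit)) (fun h dc => z ^+ nz setT (lowp (phi (Tagged J (h, dc))) + U))) /=.
  rewrite -sumrMnl; apply: eq_bigr => h _.
  rewrite (eq_bigr (fun=> z ^+ nz setT (mon h))).
    rewrite sumr_const; congr (_ *+ _); rewrite mulnC -card_forall_nonunit -cardX.
    by apply: eq_card => -[d c]; rewrite !inE.
  move=> [d c] Pt; rewrite phiE; congr (_ ^+ _); apply: eq_nz => x _; rewrite root_mulr //=.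
  have [Q ->] := unitW (Tagged J (h, (d, c))) Pt.
  by rewrite (horner_pi pi_nilp nonunit_pi) hornerC; case/andP: Pt.
- move=> t Pt; have [Q hQ] := unitW t Pt.
  have [W hW] := unit_poly pi_nilp Q (andP Pt).2; rewrite -hQ in hW.
  have [|Q2 [hQ2 _]] := nonunit_poly nonunit_pi (P := U); first by [].
  apply/negP => /lowp_nonunit [Q' hQ'].
  have := pi_neq_unit (Q' + Q2) (monic_mon (tagged t).1) hW.
  by rewrite -phiE hQ' {1}hQ2 scalerDr eqxx.
- move=> [s [h [d c]]] [s' [h' [d' c']]] Pt Pt' E.
  have : lowp (phi (Tagged J (h, (d, c)))) + U = lowp (phi (Tagged J (h', (d', c')))) + U by rewrite E.
  rewrite !phiE.
  have [Q hQ] := unitW _ Pt; have [W hW] := unit_poly pi_nilp Q (andP Pt).2.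
  have [Q' hQ'] := unitW _ Pt'; have [W' hW'] := unit_poly pi_nilp Q' (andP Pt').2.
  rewrite -hQ in hW; rewrite -hQ' in hW'.
  move=> /(unit_factor_inj (monic_mon h) (monic_mon h') hW hW') /= [e1 e2].
  have ss : s = s'.
    by apply/val_inj/succn_inj; rewrite /= -(size_mon h) -(size_mon h') e1.
  subst s'; move: e1 => /mon_inj e1; subst h'.
  (* Both remainders have size at most s, so the coefficients from s on recover c and d. *)
  have e3 k : (s <= k)%N -> (c *: 'X^s + 'X^(s.+1) * lowp d)`_k = (c' *: 'X^s + 'X^(s.+1) * lowp d')`_k.
    move=> sk; have := upE (Tagged J (h, (d, c))); have := upE (Tagged J (h, (d', c'))).
    rewrite /up /= e2 => E1 E2.
    apply: (@addIr _ U`_k); rewrite -!coefD E1 E2 !coefD; congr (_ + _).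
    by rewrite !nth_default // (leq_trans (sr _)).
  congr (Tagged J (_, (_, _))).
    apply/ffunP => i; have := e3 (i + s.+1)%N.
    rewrite !coefD !coefZ !coefXn !coefXnM gtn_eqF; last by rewrite addnS ltnS leq_addl.
    rewrite ltnNge leq_addl /= addnK !coef_lowp !mulr0 !add0r; apply.
    by rewrite addnS ltnW // ltnS leq_addl.
  have := e3 s (leqnn s).
  by rewrite !coefD !coefZ !coefXn !coefXnM eqxx ltnSn !addr0 !mulr1.
- rewrite (card_sigma P) card_primitive; apply: eq_bigr => s _.
  transitivity (#|{: {ffun 'I_s -> A}}| *
    (#|[pred d : {ffun 'I_(j.-1 - s) -> A} | [forall i, d i \isn't a GRing.unit]]| * #|units|))%N.
    by rewrite -!cardX; apply: eq_card => -[h [d c]]; rewrite !inE.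
  by rewrite card_ffun card_ord card_forall_nonunit [(_ * #|units|)%N]mulnC.
Qed.

End Factor.

(** * Reduction modulo powers of p *)

Section IntegersModulo.
Variable q : nat.
Hypothesis q1 : (1 < q)%N.

Lemma intr_Zq_eq0 (z : int) : (z%:~R == 0 :> 'Z_q) = (q%:Z %| z)%Z.
Proof.
have nat_case (n : nat) : (n%:R == 0 :> 'Z_q) = (q %| n)%N.
  by rewrite -val_eqE /= val_Zp_nat // /dvdn.
case: z => n; first by rewrite -pmulrn nat_case.
by rewrite NegzE mulrNz oppr_eq0 -pmulrn nat_case dvdzE.
Qed.

Lemma Zq_val (x : 'Z_q) : x = ((x : nat)%:Z)%:~R.
Proof. by rewrite -pmulrn natr_Zp. Qed.

Lemma ltn_Zq (x : 'Z_q) : (x < q)%N.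
Proof. by have := ltn_ord x; rewrite [X in (_ < X)%N]Zp_cast. Qed.

Lemma card_Zq : #|'Z_q| = q.
Proof. by rewrite card_ord Zp_cast. Qed.

Lemma intr_Zq_eq (y z : int) : (y%:~R == z%:~R :> 'Z_q) = (q%:Z %| y - z)%Z.
Proof. by rewrite -intr_Zq_eq0 intrB subr_eq0. Qed.

End IntegersModulo.

Section PrimePower.
Variable p : nat.
Hypothesis hp : prime p.

(** ['Z_q] is Z/q only for q > 1 (for q = 1 it has two elements), whence the positivity conditions
    on exponents. *)
Lemma prime_power_gt1 k : (0 < k)%N -> (1 < p ^ k)%N.
Proof. by move=> k0; rewrite -(exp1n k) ltn_exp2r // prime_gt1. Qed.

Lemma intr_Zpk_unit k (z : int) : (0 < k)%N ->
  (z%:~R \is a @GRing.unit 'Z_(p ^ k)) = ~~ (p%:Z %| z)%Z.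
Proof.
move=> k0; have q1 := prime_power_gt1 k0.
have nat_case (n : nat) : (n%:R \is a @GRing.unit 'Z_(p ^ k)) = ~~ (p %| n)%N.
  by rewrite unitZpE // coprime_pexpl // prime_coprime.
case: z => n; first by rewrite -pmulrn nat_case.
by rewrite NegzE mulrNz unitrN -pmulrn nat_case dvdzE.
Qed.

Lemma Zpk_nilp k : (0 < k)%N -> (p%:R : 'Z_(p ^ k)) ^+ k = 0.
Proof. by move=> k0; rewrite -natrX pchar_Zp // prime_power_gt1. Qed.

Lemma Zpk_nonunit k (x : 'Z_(p ^ k)) : (0 < k)%N ->
  x \isn't a GRing.unit -> exists y, x = p%:R * y.
Proof.
move=> k0; rewrite {1}(Zq_val x) intr_Zpk_unit // negbK.
case/dvdzP => m hm; exists (m%:~R).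
by rewrite [LHS]Zq_val hm intrM mulrC -pmulrn.
Qed.

Definition redZ k K (x : 'Z_(p ^ K)) : 'Z_(p ^ k) := (x : nat)%:R.
Arguments redZ : clear implicits.

Lemma redZ_int k K (z : int) : (0 < k)%N -> (k <= K)%N ->
  redZ k K z%:~R = z%:~R.
Proof.
move=> k0 kK; apply/eqP; rewrite /redZ pmulrn intr_Zq_eq ?prime_power_gt1 //.
have K0 := leq_trans k0 kK.
apply: (@dvdz_trans (p ^ K)%:Z); first by rewrite dvdzE /= dvdn_exp2l.
by rewrite -intr_Zq_eq ?prime_power_gt1 // -Zq_val.
Qed.

Lemma redZD k K : (0 < k)%N -> (k <= K)%N -> {morph redZ k K : x y / x + y}.
Proof.
move=> k0 kK x y; rewrite (Zq_val x) (Zq_val y) -intrD !redZ_int //.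
by rewrite intrD.
Qed.

Lemma redZ_sep k K (x y : 'Z_(p ^ K)) : (0 < k)%N -> (k <= K)%N ->
  redZ k K x = redZ k K y -> x - y \isn't a GRing.unit.
Proof.
move=> k0 kK; rewrite (Zq_val x) (Zq_val y) !redZ_int // -intrB intr_Zpk_unit ?(leq_trans k0) //.
move/eqP; rewrite intr_Zq_eq ?prime_power_gt1 // negbK.
by apply: dvdz_trans; rewrite dvdzE /= dvdn_exp.
Qed.

Lemma card_Zpk_nonunits k : (0 < k)%N -> #|nonunits 'Z_(p ^ k)| = (p ^ k.-1)%N.
Proof.
move=> k0; have q1 := prime_power_gt1 k0.
have pk : (p ^ k = p * p ^ k.-1)%N by rewrite -expnS prednK.
pose f (t : 'I_(p ^ k.-1)) : 'Z_(p ^ k) := (p * t)%:R.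
have fval (t : 'I_(p ^ k.-1)) : (f t : nat) = (p * t)%N.
  rewrite /f val_Zp_nat // modn_small //.
  by rewrite [X in (_ < X)%N]pk ltn_pmul2l ?prime_gt0.
rewrite -[RHS]card_ord -(card_imset xpredT (f := f)); last first.
  move=> s t /(congr1 (fun x : 'Z_(p ^ k) => x : nat)); rewrite !fval => /eqP.
  by rewrite eqn_pmul2l ?prime_gt0 // => /eqP; apply: val_inj.
apply: eq_card => x; rewrite inE {1}(Zq_val x) intr_Zpk_unit // negbK dvdzE /=.
apply/idP/imsetP => [/dvdnP [t ht]|[t _ ->]]; last by rewrite fval dvdn_mulr.
have tl : (t < p ^ k.-1)%N.
  have := ltn_Zq q1 x; rewrite ht [X in (_ < X)%N]pk mulnC ltn_pmul2l ?prime_gt0 //.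
exists (Ordinal tl) => //; apply: val_inj; rewrite [RHS]fval /=.
by rewrite [LHS]ht mulnC.
Qed.

(* [shiftZ M K e b] is [p^e b mod p^K]. *)
Definition shiftZ M K e (b : 'Z_(p ^ M)) : 'Z_(p ^ K) := (p ^ e * b)%:R.
Arguments shiftZ : clear implicits.

(** For a = p^e a1 the equation p^e b = a modulo p^K means b = a1 modulo p^(K-e), which holds for
    p^(M-K+e) residues modulo p^M. For e = 0 this counts the lifts of a. *)
Lemma card_shiftZ_fiber M K e (a : 'Z_(p ^ K)) : (0 < K)%N -> (K <= M)%N -> (e <= K)%N ->
  #|[pred b | shiftZ M K e b == a]| = (if (p ^ e %| a)%N then p ^ (M - K + e) else 0)%N.
Proof.
move=> K0 KM eK; have qK := prime_power_gt1 K0; have qM := prime_power_gt1 (leq_trans K0 KM).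
have pK : (p ^ e * p ^ (K - e) = p ^ K)%N by rewrite -expnD subnKC.
have shE b : (shiftZ M K e b == a) = (p ^ e * b == a %[mod p ^ e * p ^ (K - e)])%N.
  rewrite pK /shiftZ -val_eqE /= val_Zp_nat // [X in _ = (_ == X)%N]modn_small //.
  exact: ltn_Zq.
have p0 k : (0 < p ^ k)%N by rewrite expn_gt0 prime_gt0.
have := ltn_Zq qK a; rewrite -[X in (_ < X)%N]pK; move: shE; move: (nat_of_ord a) => an shE aK.
case: ifP => [/dvdnP [a1 ha]|na]; last first.
  apply: eq_card0 => b; rewrite !inE shE; apply/negbTE/negP => /eqP h.
  move/negP: na; apply; have := congr1 (dvdn (p ^ e)) h.
  rewrite -!muln_modr // [(an %% _)%N]modn_small //.
  by rewrite dvdn_mulr // => <-.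
have a1K : (a1 < p ^ (K - e))%N.
  by move: aK; rewrite ha mulnC ltn_pmul2l.
have pM : (p ^ M = p ^ (M - K + e) * p ^ (K - e))%N by rewrite -expnD; congr (_ ^ _)%N; lia.
pose f (t : 'I_(p ^ (M - K + e))) : 'Z_(p ^ M) := (a1 + t * p ^ (K - e))%:R.
have fval (t : 'I_(p ^ (M - K + e))) : (f t : nat) = (a1 + t * p ^ (K - e))%N.
  rewrite /f val_Zp_nat // modn_small //.
  apply: (@leq_trans (t.+1 * p ^ (K - e))%N); first by rewrite mulSn ltn_add2r.
  by rewrite [X in (_ <= X)%N]pM leq_pmul2r // ltn_ord.
rewrite -[RHS]card_ord -(card_imset xpredT (f := f)); last first.
  move=> s t /(congr1 (fun x : 'Z_(p ^ M) => x : nat)); rewrite !fval => /eqP.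
  by rewrite eqn_add2l eqn_pmul2r // => /eqP; apply: val_inj.
apply: eq_card => b; rewrite !inE shE ha [(a1 * _)%N]mulnC -!muln_modr // eqn_pmul2l //.
rewrite [(a1 %% _)%N]modn_small //.
apply/eqP/imsetP => [hb|[t _ ->]]; last by rewrite fval addnC modnMDl modn_small.
have bE := divn_eq b (p ^ (K - e)); rewrite hb addnC in bE.
have tl : (b %/ p ^ (K - e) < p ^ (M - K + e))%N.
  by rewrite ltn_divLR // -pM ltn_Zq.
by exists (Ordinal tl) => //; apply: val_inj; rewrite [RHS]fval.
Qed.

End PrimePower.
Arguments redZ : clear implicits.
Arguments shiftZ : clear implicits.

Lemma sum_pushforward (L : nmodType) (A B : finType) n (phi : 'I_n -> B -> A)
    (F : {ffun 'I_n -> A} -> L) :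
  \sum_(b : {ffun 'I_n -> B}) F [ffun i => phi i (b i)] =
  \sum_(a : {ffun 'I_n -> A}) F a *+ (\prod_(i < n) #|[pred x | phi i x == a i]|).
Proof.
rewrite (partition_big (fun b : {ffun 'I_n -> B} => [ffun i => phi i (b i)]) xpredT) //=.
apply: eq_bigr => a _; rewrite (eq_bigr (fun=> F a)); last by move=> b /eqP ->.
rewrite sumr_const; congr (_ *+ _).
transitivity #|family (fun i => [pred x | phi i x == a i])|.
  apply: eq_card => b; apply/idP/familyP => [E i|h].
    have {}E : [ffun i => phi i (b i)] == a by [].
    by rewrite inE -(eqP E) ffunE.
  suff: [ffun i => phi i (b i)] == a by [].
  by apply/eqP/ffunP => i; rewrite ffunE; apply/eqP; have := h i; rewrite inE.
by rewrite card_family foldrE big_map big_enum.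
Qed.

(** * The identities at finite level *)

Section RootClasses.
Variable p : nat.
Hypothesis hp : prime p.

(** Integer representatives are used instead of elements of Z/p^K, so that dividing by p can change
    k and K without transport between rings. The flag [b] keeps only roots divisible by p. *)
Definition Nint k K (b : bool) (F : {poly int}) : nat :=
  #|[set a : 'Z_(p ^ k) | `[< exists r : int,
      [/\ r%:~R = a, b -> (p%:Z %| r)%Z & ((p ^ K)%:Z %| F.[r])%Z] >]]|.

Lemma root_intr K (F : {poly int}) (r : int) : (0 < K)%N ->
  root (map_poly intr F : {poly 'Z_(p ^ K)}) r%:~R = ((p ^ K)%:Z %| F.[r])%Z.
Proof. by move=> K0; rewrite rootE horner_map intr_Zq_eq0 // prime_power_gt1. Qed.

Lemma Nint_nz k K b (F : {poly int}) : (0 < k)%N -> (k <= K)%N ->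
  Nint k K b F = nz (redZ p k K) (if b then nonunits _ else setT) (map_poly intr F).
Proof.
move=> k0 kK; have K0 := leq_trans k0 kK; rewrite /Nint /nz.
congr #|pred_of_set _|; apply/setP => a; rewrite inE; apply/asboolP/imsetP.
  move=> [r [<- hb hF]]; exists r%:~R; last by rewrite redZ_int.
  rewrite inE root_intr // hF andbT; case: b hb => [/(_ isT)|_]; last by rewrite inE.
  by rewrite inE intr_Zpk_unit // negbK.
move=> [x]; rewrite inE => /andP[hb]; rewrite {1}(Zq_val x) root_intr // => hx ->.
exists (x : nat)%:Z; split=> //.
by move=> bT; move: hb; rewrite bT inE {1}(Zq_val x) intr_Zpk_unit // negbK.
Qed.

Lemma Nint_eq_map k K b (F G : {poly int}) : (0 < k)%N -> (k <= K)%N ->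
  map_poly intr F = map_poly intr G :> {poly 'Z_(p ^ K)} -> Nint k K b F = Nint k K b G.
Proof. by move=> k0 kK E; rewrite !Nint_nz // E. Qed.

(** Multiplication by p is a bijection from the classes modulo p^(k-1) onto the classes modulo p^k
    of multiples of p, so one digit of k is lost. *)
Lemma Nint_rescale k K K' (F G : {poly int}) : (1 < k)%N ->
  (forall y : int, ((p ^ K)%:Z %| F.[p%:Z * y])%Z = ((p ^ K')%:Z %| G.[y])%Z) ->
  Nint k K true F = Nint k.-1 K' false G.
Proof.
move=> k1 hFG.
have k0 : (0 < k)%N by apply: ltnW.
have k0' : (0 < k.-1)%N by case: k k1 {k0} => [|[|]].
have q1 := prime_power_gt1 hp k0; have q1' := prime_power_gt1 hp k0'.
pose f (a : 'Z_(p ^ k.-1)) : 'Z_(p ^ k) := (p%:Z * (a : nat)%:Z)%:~R.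
have pk : ((p ^ k)%:Z = p%:Z * (p ^ k.-1)%:Z) by rewrite -{1}(prednK k0) expnS PoszM.
have p0 : p%:Z != 0 by rewrite eqz_nat -lt0n prime_gt0.
have fE (y : int) : f y%:~R = (p%:Z * y)%:~R.
  apply/eqP; rewrite /f intr_Zq_eq // -mulrBr pk dvdz_mul2l //.
  by rewrite -intr_Zq_eq // -Zq_val.
have finj : injective f.
  move=> a a' /eqP; rewrite /f intr_Zq_eq // -mulrBr pk dvdz_mul2l //.
  by rewrite -intr_Zq_eq // -!Zq_val => /eqP.
rewrite /Nint -[RHS](card_imset _ finj); congr #|pred_of_set _|; apply/setP => a.
rewrite inE; apply/asboolP/imsetP.
  move=> [r [<- /(_ isT) /dvdzP[y hy] hr]]; exists y%:~R; last by rewrite fE hy mulrC.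
  by rewrite inE; apply/asboolP; exists y; split=> //; rewrite -hFG mulrC -hy.
move=> [x]; rewrite inE => /asboolP[y [<- _ hy]] ->; exists (p%:Z * y).
by rewrite fE hFG; split=> // _; rewrite dvdz_mulr.
Qed.

End RootClasses.

(** * Power series as sequences of coefficients *)

Section Convolution.
Variable L : comNzRingType.
Implicit Types f g h : nat -> L.

Definition sermul f g : nat -> L := fun n => \sum_(i < n.+1) f i * g (n - i)%N.
Definition serone : nat -> L := fun n => (n == 0%N)%:R.
Definition om (a : L) : nat -> L :=
  fun n => if n == 0%N then 1 else if n == 1%N then - a else 0.

(** Coefficients up to N depend only on truncations, so the ring laws of polynomials carry over to
    series. *)
Lemma sermul_poly f g N n : (n <= N)%N ->
  sermul f g n = (\poly_(i < N.+1) f i * \poly_(i < N.+1) g i)`_n.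
Proof.
move=> nN; rewrite coefM; apply: eq_bigr => i _; rewrite !coef_poly.
have iN : (i < N.+1)%N by rewrite (leq_trans (ltn_ord i)).
by rewrite iN (leq_ltn_trans (leq_subr _ _)).
Qed.

Lemma sermulC f g : sermul f g = sermul g f.
Proof. by apply/funext => n; rewrite !(@sermul_poly _ _ n) // mulrC. Qed.

Lemma sermulA f g h : sermul f (sermul g h) = sermul (sermul f g) h.
Proof.
apply/funext => n; transitivity
  ((\poly_(i < n.+1) f i * (\poly_(i < n.+1) g i * \poly_(i < n.+1) h i))`_n).
  rewrite coefM; apply: eq_bigr => i _; rewrite coef_poly ltn_ord; congr (_ * _).
  by rewrite -sermul_poly // leq_subr.
rewrite mulrA coefM; apply: eq_bigr => i _; rewrite -sermul_poly; last by rewrite -ltnS.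
by rewrite coef_poly ltnS leq_subr.
Qed.

Lemma sermul1f f : sermul serone f = f.
Proof.
apply/funext => n; rewrite /sermul big_ord_recl /= subn0 mul1r big1 ?addr0 // => i _.
by rewrite mul0r.
Qed.

Lemma sermulCA f g h : sermul f (sermul g h) = sermul g (sermul f h).
Proof. by rewrite !sermulA (sermulC f). Qed.

Lemma sermul_om a f : sermul (om a) f = fun n => if n is m.+1 then f m.+1 - a * f m else f 0%N.
Proof.
apply/funext => -[|n]; first by rewrite /sermul big_ord1 mul1r.
rewrite /sermul big_ord_recl /= mul1r; congr (_ + _); rewrite big_ord_recl /= big1 ?addr0.
  by rewrite mulNr subSS subn0.
by move=> i _; rewrite mul0r.
Qed.

Lemma sermul_om_geom a : sermul (om a) (fun n => a ^+ n) = serone.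
Proof. by rewrite sermul_om; apply/funext => -[|n] //; rewrite exprS subrr. Qed.

End Convolution.

(** * Averages over monic, distinguished and primitive polynomials *)

Section FiniteLevel.
Variable p : nat.
Hypothesis hp : prime p.
Variables (R : realFieldType) (z : {poly R}).
Local Notation L := {poly R}.

Definition wmon k K n : L :=
  \sum_(c : {ffun 'I_n -> 'Z_(p ^ K)}) z ^+ nz (redZ p k K) setT (mon c).
Definition wdis k K n : L :=
  \sum_(d : {ffun 'I_n -> 'Z_(p ^ K)} | [forall i, d i \isn't a GRing.unit])
     z ^+ nz (redZ p k K) (nonunits _) (mon d).
Definition wprim k K n : L :=
  \sum_(f : {ffun 'I_n.+1 -> 'Z_(p ^ K)} | ~~ [forall i, f i \isn't a GRing.unit])
     z ^+ (nz (redZ p k K) setT (lowp f) + nz (redZ p k K) (nonunits _) (revp n (lowp f))).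

Definition alphaF k K n : L := ((p ^ (K * n))%:R)^-1 *: wmon k K n.
Definition betaF k K n : L := ((p ^ (K.-1 * n))%:R)^-1 *: wdis k K n.
(* The total is normalised by [(p - 1) p^((K-1)(n+1))], so that it is (1+p+...+p^n) times an average. *)
Definition primF k K n : L := (((p.-1 * p ^ (K.-1 * n.+1))%N)%:R)^-1 *: wprim k K n.

Variables (k K : nat).
Hypotheses (k0 : (0 < k)%N) (kK : (k <= K)%N).
Let K0 : (0 < K)%N := leq_trans k0 kK.
Local Notation A := 'Z_(p ^ K).
Local Notation cl := (redZ p k K).

Definition low_residues j : {set A} := [set r : A | (r %% p < j)%N].

(** Interpolates between the plain count of monic polynomials (j = 0) and [wmon] (j = p), one
    residue class modulo p at a time. *)
Definition wres j n : L := \sum_(c : {ffun 'I_n -> A}) z ^+ nz cl (low_residues j) (mon c).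

Lemma Zpk_nonunit_dvd (x : A) : (x \isn't a GRing.unit) = (p %| x)%N.
Proof. by rewrite {1}(Zq_val x) intr_Zpk_unit // negbK dvdzE. Qed.

Lemma card_Zpk_units : #|units A| = (p.-1 * p ^ K.-1)%N.
Proof.
have := card_nonunits_units A; rewrite card_Zpk_nonunits // card_Zq ?prime_power_gt1 //.
have -> : (p ^ K = p ^ K.-1 + p.-1 * p ^ K.-1)%N.
  by rewrite -mulSn (prednK (prime_gt0 hp)) -expnS prednK.
by move=> /eqP; rewrite eqn_add2l => /eqP.
Qed.

Lemma Zpk_val_add (x : A) (j : nat) : (((x + j%:R)%R : A) %% p = (x + j) %% p)%N.
Proof.
rewrite -{1}(natr_Zp x) -natrD val_Zp_nat ?prime_power_gt1 // modn_dvdm //.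
by rewrite dvdn_exp.
Qed.

(** Translation moves the class of j to the nonunits, where it is split off. The cofactor [g] sees
    only the classes below j, so it is common to both formulas; in the second one the distinguished
    factor is merely counted. *)
Lemma wres_step j : (j < p)%N ->
  exists g : nat -> L, (forall n, wres j.+1 n = sermul (wdis k K) g n) /\
    (forall n, wres j n = sermul (fun m => ((p ^ (K.-1 * m))%N)%:R) g n).
Proof.
move=> jp.
(* If x + j is below j modulo p, then x is nonzero modulo p; hence S consists of units. *)
pose S := [set x : A | x + j%:R \in low_residues j].
have Sunit : S \subset units A.
  apply/subsetP => x; rewrite !inE Zpk_val_add => hx; rewrite -[_ \is a _]negbK Zpk_nonunit_dvd.
  by apply/negP => /dvdnP[t ht]; move: hx; rewrite ht modnMDl modn_small // ltnn.
have hS1 x : (x \in S :|: nonunits A) = (x + j%:R \in low_residues j.+1).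
  rewrite !inE Zpk_nonunit_dvd !Zpk_val_add ltnS [RHS]leq_eqVlt orbC; congr (_ || _).
  by rewrite -{2}(modn_small jp) -{2}[j]add0n eqn_modDr mod0n.
pose g m := \sum_(g : {ffun 'I_m -> A} | (mon g).[0] \is a GRing.unit) z ^+ nz cl S (mon g).
have peel w n' := @sum_monic_peel A p%:R K (Zpk_nilp hp K0) (fun x => @Zpk_nonunit p hp K x K0)
  _ cl L z w S n' Sunit.
exists g; split=> n'.
  transitivity (\sum_(c : {ffun 'I_n' -> A}) z ^+ nz cl (S :|: nonunits A) (mon c)).
    rewrite [RHS](sum_monic_translate _ j%:R (fun f => z ^+ nz cl (S :|: nonunits A) f)).
    by apply: eq_bigr => c _; rewrite (nz_translate (redZD hp k0 kK) (mon c) hS1).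
  apply: etrans (peel z n'); apply: eq_bigr => c _; rewrite -exprD; congr (_ ^+ _).
  apply: nzU => [x y|x y]; first by move=> /(redZ_sep hp k0 kK).
  move=> /(subsetP Sunit); rewrite !inE => ux ny.
  rewrite addrC (nonunit_add (Zpk_nilp hp K0) (fun x => @Zpk_nonunit p hp K x K0)) //.
  by rewrite unitrN.
transitivity (\sum_(c : {ffun 'I_n' -> A}) z ^+ nz cl S (mon c) * 1 ^+ nz cl (nonunits _) (mon c)).
  transitivity (\sum_(c : {ffun 'I_n' -> A}) z ^+ nz cl S (mon c)); last first.
    by apply: eq_bigr => c _; rewrite expr1n mulr1.
  rewrite [RHS](sum_monic_translate _ j%:R (fun f => z ^+ nz cl S f)).
  apply: eq_bigr => c _; rewrite (nz_translate (S' := low_residues j) (redZD hp k0 kK)) // => x.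
  by rewrite inE.
rewrite (peel 1 n'); apply: eq_bigr => m _; congr (_ * _).
rewrite (eq_bigr (fun=> 1)) => [|d _]; last by rewrite expr1n.
by rewrite sumr_const card_forall_nonunit card_Zpk_nonunits // -expnM.
Qed.

Lemma wres0 n : wres 0 n = ((p ^ (K * n))%N)%:R.
Proof.
rewrite /wres (eq_bigr (fun=> 1)) => [|c _].
  by rewrite sumr_const card_ffun !card_ord Zp_cast ?prime_power_gt1 // expnM.
rewrite /nz (_ : [set r in low_residues 0 | root (mon c) r] = set0) ?imset0 ?cards0 //.
by apply/setP => x; rewrite !inE ltn0.
Qed.

Lemma wresp n : wres p n = wmon k K n.
Proof.
apply: eq_bigr => c _; congr (_ ^+ nz _ _ _).
by apply/setP => x; rewrite !inE ltn_mod prime_gt0.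
Qed.

Definition scaled_res j n : L := ((p ^ (K.-1 * n))%:R)^-1 *: wres j n.

Lemma pnat_neq0 m : (p ^ m)%:R != 0 :> R.
Proof. by rewrite pnatr_eq0 -lt0n expn_gt0 prime_gt0. Qed.

Lemma sermul_scale (u v : nat -> L) n :
  ((p ^ (K.-1 * n))%:R)^-1 *: sermul u v n =
  sermul (fun m => ((p ^ (K.-1 * m))%:R)^-1 *: u m) (fun m => ((p ^ (K.-1 * m))%:R)^-1 *: v m) n.
Proof.
rewrite scaler_sumr; apply: eq_bigr => i _.
rewrite -scalerAl -scalerAr scalerA -invfM -natrM -expnD -mulnDr subnKC // -ltnS.
exact: ltn_ord.
Qed.

(** After scaling, the plain count is 1 + t + t^2 + ..., the inverse of [om 1]. Eliminating [g], one
    more residue class multiplies the series by 1 - t times that of [betaF]. *)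
Lemma scaled_res_step j : (j < p)%N ->
  sermul (om p%:R) (scaled_res j.+1) =
  sermul (sermul (om 1) (betaF k K)) (sermul (om p%:R) (scaled_res j)).
Proof.
move=> jp; have [g [h1 h2]] := wres_step jp.
pose g' m := ((p ^ (K.-1 * m))%:R)^-1 *: g m.
have -> : scaled_res j.+1 = sermul (betaF k K) g'.
  by apply/funext => n; rewrite /scaled_res h1 sermul_scale.
have e2 : scaled_res j = sermul (fun n => 1 ^+ n) g'.
  apply/funext => n; rewrite /scaled_res h2 sermul_scale; congr (sermul _ _ _).
  apply/funext => m; rewrite expr1n -scaler_nat scalerA mulVf ?pnat_neq0 ?scale1r //.
rewrite e2 sermulCA -[sermul (om 1) _ in RHS]sermulC.
rewrite -sermulA [sermul (om 1) _]sermulCA [sermul (om 1) (sermul _ g')]sermulA sermul_om_geom sermul1f.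
by rewrite sermulCA.
Qed.

Lemma expKn n : (p ^ (K * n) = p ^ n * p ^ (K.-1 * n))%N.
Proof. by rewrite -expnD -mulSn prednK. Qed.

(** The normalisation is p^((K-1)n) on the left and p^(Kn) in [alphaF]; their quotient p^n turns
    A(t) into A(pt). *)
Lemma scaled_resp : scaled_res p = fun n => (p%:R ^+ n) *: alphaF k K n.
Proof.
apply/funext => n; rewrite /scaled_res wresp /alphaF scalerA; congr (_ *: _).
by rewrite expKn natrM invfM mulrA -natrX mulfV ?mul1r ?pnat_neq0.
Qed.

Lemma alphaF_betaF :
  sermul (om p%:R) (fun n => (p%:R ^+ n) *: alphaF k K n) =
  iter p (sermul (sermul (om 1) (betaF k K))) (serone L).
Proof.
rewrite -scaled_resp.
have : forall j, (j <= p)%N -> sermul (om p%:R) (scaled_res j) =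
    iter j (sermul (sermul (om 1) (betaF k K))) (serone L).
  elim=> [_|j IH jp]; last by rewrite scaled_res_step //= IH // ltnW.
  (* For j = 0 the scaled counts are p^n, the coefficients of 1/(1 - pt), which [om p%:R]
     cancels. *)
  rewrite -(sermul_om_geom p%:R) /=; congr (sermul _ _); apply/funext => n.
  rewrite /scaled_res wres0 expKn natrM mulrC -natrX.
  by rewrite mulr_natl -scaler_nat scalerA mulVf ?pnat_neq0 // scale1r.
by apply.
Qed.

(** The unit c of the factorisation absorbs the factor (p - 1) p^(K-1) of the normalisation of
    [primF]; the rest is shared by the two series. *)
Lemma primF_sermul : primF k K = sermul (fun n => (p%:R ^+ n) *: alphaF k K n) (betaF k K).
Proof.
apply/funext => n; rewrite -scaled_resp.
have := @sum_primitive A p%:R K (Zpk_nilp hp K0) (fun x => @Zpk_nonunit p hp K x K0) _ cl L z n.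
rewrite /primF /wprim => ->.
have -> : betaF k K = fun m => ((p ^ (K.-1 * m))%:R)^-1 *: wdis k K m by [].
rewrite /scaled_res -sermul_scale card_Zpk_units.
rewrite (eq_bigr (fun s : 'I_n.+1 => (p.-1 * p ^ K.-1)%:R *: (wres p s * wdis k K (n - s)))).
  rewrite -scaler_sumr scalerA; congr (_ *: _).
  rewrite mulnS expnD mulnA [in LHS]natrM invfM mulrAC mulVf ?mul1r //.
  rewrite pnatr_eq0 muln_eq0 negb_or -!lt0n expn_gt0 (prime_gt0 hp) orTb andbT.
  by have := prime_gt1 hp; lia.
by move=> s _; rewrite wresp mulrnAr scaler_nat.
Qed.

End FiniteLevel.

Lemma sum_split_ffun (L : nmodType) (A : finType) m n (F : {ffun 'I_(m + n) -> A} -> L) :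
  \sum_g F g = \sum_(g1 : {ffun 'I_m -> A}) \sum_(g2 : {ffun 'I_n -> A})
    F [ffun i => match split i with inl a => g1 a | inr b => g2 b end].
Proof.
rewrite pair_big /=.
apply: (reindex (fun t : {ffun 'I_m -> A} * {ffun 'I_n -> A} =>
  [ffun i => match split i with inl a => t.1 a | inr b => t.2 b end])).
exists (fun g : {ffun 'I_(m + n) -> A} => ([ffun a => g (lshift n a)], [ffun b => g (rshift m b)])).
  move=> [g1 g2] _ /=; congr (_, _); apply/ffunP => i; rewrite !ffunE.
    by rewrite (unsplitK (inl i)).
  by rewrite (unsplitK (inr i)).
move=> g _; apply/ffunP => i; rewrite ffunE.
by case: splitP => j ij; rewrite ffunE; congr (g _); apply: val_inj.
Qed.

Lemma sum_decreasing (L : nmodType) (I : finType) (P : nat -> pred I) (f : I -> L) n :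
  (forall j i, P j.+1 i -> P j i) ->
  \sum_(i | P 0%N i) f i =
  \sum_(i | P n i) f i + \sum_(j < n) \sum_(i | P j i && ~~ P j.+1 i) f i.
Proof.
move=> hP; elim: n => [|n IH]; first by rewrite big_ord0 addr0.
rewrite IH big_ord_recr /= addrA addrAC; congr (_ + _).
rewrite (bigID (P n.+1)) /=; congr (_ + _); apply: eq_bigl => i.
by rewrite andbC; case: (boolP (P n.+1 i)) => //= /hP ->.
Qed.

(** * The substitution of p y in distinguished polynomials *)

Section Rescaling.
Variable p : nat.
Hypothesis hp : prime p.
Variables (R : realFieldType) (z : {poly R}).
Local Notation L := {poly R}.

Definition Fint n (c : 'I_n -> int) : {poly int} :=
  'X^n + \sum_(i < n) (p%:Z * c i) *: 'X^i.

Lemma sum_fullfiber M K n (F : {ffun 'I_n -> 'Z_(p ^ K)} -> L) : (0 < K)%N -> (K <= M)%N ->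
  \sum_(b : {ffun 'I_n -> 'Z_(p ^ M)}) F [ffun i => shiftZ p M K 0 (b i)] =
  (\sum_g F g) *+ (p ^ ((M - K) * n)).
Proof.
move=> K0 KM; rewrite (sum_pushforward (fun _ => shiftZ p M K 0)) -sumrMnl.
apply: eq_bigr => g _; congr (_ *+ _).
rewrite (eq_bigr (fun=> p ^ (M - K)))%N ?prod_nat_const ?card_ord ?expnM // => i _.
by rewrite card_shiftZ_fiber // expn0 dvd1n addn0.
Qed.

Lemma shiftZ_int M K e (b : 'Z_(p ^ M)) : shiftZ p M K e b = ((p ^ e)%:Z * (b : nat)%:Z)%:~R.
Proof. by rewrite /shiftZ pmulrn PoszM. Qed.

Lemma map_Fint K n (c : 'I_n -> int) :
  map_poly intr (Fint c) = mon [ffun i => (p%:Z * c i)%:~R] :> {poly 'Z_(p ^ K)}.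
Proof.
rewrite /Fint /mon rmorphD /= map_polyXn /lowp rmorph_sum; congr (_ + _) => /=.
by apply: eq_bigr => i _; rewrite map_polyZ map_polyXn /= ffunE.
Qed.

(** Every nonunit is p a for exactly p residues a, so a uniform vector a gives a uniform
    distinguished polynomial. *)
Lemma betaF_int k K n : (0 < k)%N -> (k <= K)%N ->
  betaF p z k K n = ((p ^ (K * n))%:R)^-1 *:
    \sum_(a : {ffun 'I_n -> 'Z_(p ^ K)}) z ^+ Nint p k K true (Fint (fun i => (a i : nat)%:Z)).
Proof.
move=> k0 kK; have K0 := leq_trans k0 kK.
pose G (d : {ffun 'I_n -> 'Z_(p ^ K)}) := z ^+ nz (redZ p k K) (nonunits _) (mon d).
transitivity (((p ^ (K * n))%:R)^-1 *:
    \sum_(a : {ffun 'I_n -> 'Z_(p ^ K)}) G [ffun i => shiftZ p K K 1 (a i)]); last first.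
  congr (_ *: _); apply: eq_bigr => a _; rewrite Nint_nz // map_Fint.
  suff -> : [ffun i => shiftZ p K K 1 (a i)] = [ffun i => (p%:Z * (a i : nat)%:Z)%:~R] by [].
  by apply/ffunP => i; rewrite !ffunE shiftZ_int expn1.
rewrite (sum_pushforward (fun _ => shiftZ p K K 1)) /betaF /wdis.
transitivity (((p ^ (K * n))%:R)^-1 *: ((\sum_(d : {ffun 'I_n -> 'Z_(p ^ K)} | [forall i, d i \isn't a GRing.unit]) G d) *+ p ^ n)).
  rewrite -scaler_nat scalerA; congr (_ *: _).
  rewrite (expKn p k0 kK) natrM invfM mulrAC mulVf ?mul1r //; exact: pnat_neq0.
congr (_ *: _); rewrite -sumrMnl big_mkcond /=; apply: eq_bigr => d _.
rewrite (eq_bigr (fun i => if (p %| d i)%N then p else 0))%N => [|i _]; last first.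
  by rewrite card_shiftZ_fiber // subnn !expn1.
case: ifP => [/forallP h|/negbT].
  rewrite (eq_bigr (fun=> p)) ?prod_nat_const ?card_ord // => i _.
  by rewrite -(Zpk_nonunit_dvd hp k0 kK) ?h.
rewrite negb_forall => /existsP[i]; rewrite (Zpk_nonunit_dvd hp k0 kK) => hi.
by rewrite (bigD1 i) //= (negbTE hi) mul0n mulr0n.
Qed.

Variables (k K n : nat).
Hypotheses (k1 : (1 < k)%N) (nK : (n + k <= K)%N).
Let k0 : (0 < k)%N := ltnW k1.
Let kK : (k <= K)%N := leq_trans (leq_addl _ _) nK.
Local Notation A := 'Z_(p ^ K).

(** The coefficient of y^i in F(py) is p^(i+1) a_i, so for j <= n this says that p^j divides F(py);
    truncated subtraction leaves no condition when i + 1 >= j. *)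
Definition event j (a : {ffun 'I_n -> A}) := [forall i : 'I_n, p ^ (j - i.+1) %| a i]%N.

(** The nonzero exponents are j - 1, j - 2, ..., 1: this is the origin of binom(j, 2), hence of the
    operator Phi. *)
Lemma prod_event j : (j <= n)%N -> (\prod_(i < n) p ^ (j - i.+1) = p ^ 'C(j, 2))%N.
Proof.
move=> jn; rewrite -expn_sum; congr (_ ^ _)%N.
rewrite -(big_mkord xpredT (fun i => j - i.+1)%N) (@big_cat_nat _ _ _ j) //=.
rewrite [X in (_ + X)%N]big_nat_cond [X in (_ + X)%N]big1 ?addn0; last first.
  by move=> i /andP[/andP[ji _] _]; apply/eqP; rewrite subn_eq0 (leq_trans ji).
rewrite -bin2_sum big_nat_rev /= big_nat_cond [RHS]big_nat_cond; apply: eq_bigr => i.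
by rewrite andbT => /andP[_ ij]; lia.
Qed.

Lemma sum_event j (G : {ffun 'I_n -> A} -> L) : (j <= n)%N ->
  (\sum_(a | event j a) G a) *+ (p ^ 'C(j, 2)) =
  \sum_(b : {ffun 'I_n -> A}) G [ffun i : 'I_n => shiftZ p K K (j - i.+1) (b i)].
Proof.
move=> jn; rewrite (sum_pushforward (fun (i : 'I_n) => shiftZ p K K (j - i.+1))).
rewrite -sumrMnl big_mkcond /=; apply: eq_bigr => a _.
have K0 : (0 < K)%N := leq_trans k0 kK.
rewrite (eq_bigr (fun i : 'I_n => if p ^ (j - i.+1) %| a i then p ^ (j - i.+1) else 0))%N; last first.
  by move=> i _; rewrite card_shiftZ_fiber // ?subnn //; lia.
case: ifP => [/forallP h|/negbT].
  by rewrite (eq_bigr (fun i : 'I_n => p ^ (j - i.+1)))%N ?prod_event // => i _; rewrite h.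
rewrite negb_forall => /existsP[i hi].
by rewrite (bigD1 i) //= (negbTE hi) mul0n mulr0n.
Qed.

(** F(py) divided by p^j when a_i = p^(j-i-1) b_i: the coefficients below index j become the b_i,
    the others keep a positive power of p. *)
Definition Gint j (c : 'I_n -> int) : {poly int} :=
  (p ^ (n - j))%:Z *: 'X^n + \sum_(i < n) ((p ^ (i.+1 - j))%:Z * c i) *: 'X^i.

Definition Gpoly j (g : {ffun 'I_n -> 'Z_(p ^ (K - j))}) : {poly 'Z_(p ^ (K - j))} :=
  p%:R ^+ (n - j) *: 'X^n + \sum_(i < n) (p%:R ^+ (i.+1 - j) * g i) *: 'X^i.

(** Dividing F(py) by p^j costs j digits of K, and passing from multiples of p to all residues costs
    one digit of k. *)
Lemma Nint_event j (b : {ffun 'I_n -> A}) : (j <= n)%N ->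
  Nint p k K true (Fint (fun i : 'I_n => (shiftZ p K K (j - i.+1) (b i) : nat)%:Z)) =
  nz (redZ p k.-1 (K - j)) setT (Gpoly [ffun i => shiftZ p K (K - j) 0 (b i)]).
Proof.
move=> jn; pose F := Fint (fun i : 'I_n => (p ^ (j - i.+1))%:Z * (b i : nat)%:Z).
rewrite (@Nint_eq_map _ _ _ _ _ _ F) //; last first.
  rewrite !map_Fint; congr mon; apply/ffunP => i.
  by rewrite !ffunE intrM -Zq_val [RHS]intrM shiftZ_int.
rewrite (@Nint_rescale _ hp _ _ (K - j) F (Gint j (fun i => (b i : nat)%:Z))) //.
  rewrite Nint_nz //; try lia; congr nz; rewrite /Gint /Gpoly rmorphD rmorph_sum /=.
  rewrite map_polyZ map_polyXn -natrX; congr (_ + _); apply: eq_bigr => i _.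
  by rewrite map_polyZ map_polyXn /= ffunE shiftZ_int expn0 mul1r intrM -natrX.
have pX m : (p ^ m)%:Z = p%:Z ^+ m by rewrite -!natz natrX.
move=> y; have -> : F.[p%:Z * y] = (p ^ j)%:Z * (Gint j (fun i => (b i : nat)%:Z)).[y].
  rewrite /F /Fint /Gint !hornerD !horner_sum mulrDr mulr_sumr; congr (_ + _).
    rewrite hornerZ !hornerXn exprMn mulrA -PoszM -expnD subnKC //.
    by rewrite pX.
  apply: eq_bigr => i _; rewrite !hornerZ !hornerXn exprMn !pX.
  transitivity (p%:Z ^+ (1 + (j - i.+1) + i) * (b i : nat)%:Z * y ^+ i).
    by rewrite !exprD expr1; ring.
  have -> : (1 + (j - i.+1) + i = j + (i.+1 - j))%N by lia.
  by rewrite exprD; ring.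
have jK : (j <= K)%N by lia.
have pK : (p ^ K)%:Z = (p ^ j)%:Z * (p ^ (K - j))%:Z by rewrite -PoszM -expnD subnKC.
by rewrite pK dvdz_mul2l // eqz_nat -lt0n expn_gt0 prime_gt0.
Qed.

Lemma sum_event_Gpoly j (P : pred {ffun 'I_n -> A}) (Q : pred {ffun 'I_n -> 'Z_(p ^ (K - j))}) :
  (j <= n)%N ->
  (forall b : {ffun 'I_n -> A}, P [ffun i : 'I_n => shiftZ p K K (j - i.+1) (b i)] =
             Q [ffun i => shiftZ p K (K - j) 0 (b i)]) ->
  (\sum_(a | event j a && P a) z ^+ Nint p k K true (Fint (fun i => (a i : nat)%:Z)))
      *+ (p ^ 'C(j, 2)) =
  (\sum_(g | Q g) z ^+ nz (redZ p k.-1 (K - j)) setT (Gpoly g)) *+ (p ^ (j * n)).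
Proof.
move=> jn hPQ; rewrite big_mkcondr sum_event //=.
have jK : (j <= K)%N by lia.
pose H (g : {ffun 'I_n -> 'Z_(p ^ (K - j))}) := if Q g then
  z ^+ nz (redZ p k.-1 (K - j)) setT (Gpoly g) else 0.
rewrite [in RHS]big_mkcond /=; have := @sum_fullfiber K (K - j) n H _ _.
rewrite subKn // => <- //; try lia; apply: eq_bigr => b _.
rewrite hPQ /H; case: ifP => // _; rewrite -Nint_event //; congr (_ ^+ Nint _ _ _ _ (Fint _)).
by apply/funext => i; rewrite ffunE.
Qed.

Lemma Gpoly_n (g : {ffun 'I_n -> 'Z_(p ^ (K - n))}) : Gpoly g = mon g.
Proof.
rewrite /Gpoly /mon /lowp subnn expr0 scale1r; congr (_ + _); apply: eq_bigr => i _.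
by rewrite (_ : i.+1 - n = 0)%N ?expr0 ?mul1r //; apply/eqP; rewrite subn_eq0.
Qed.

Lemma event0 : \sum_(a | event 0 a) z ^+ Nint p k K true (Fint (fun i => (a i : nat)%:Z)) =
  \sum_(a : {ffun 'I_n -> A}) z ^+ Nint p k K true (Fint (fun i => (a i : nat)%:Z)).
Proof. by apply: eq_bigl => a; apply/forallP => i; rewrite sub0n expn0 dvd1n. Qed.

Lemma eventS j (a : {ffun 'I_n -> A}) : event j.+1 a -> event j a.
Proof.
move=> /forallP h; apply/forallP => i; apply: dvdn_trans (h i).
by rewrite dvdn_exp2l // leq_sub2r.
Qed.

(** Once p^j divides F(py), divisibility by p^(j+1) means that b_0, ..., b_(j-1) are nonunits;
    otherwise the part of degree < j is primitive. *)
Lemma eventS_shift j (b : {ffun 'I_n -> A}) : (j < n)%N ->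
  event j.+1 [ffun i : 'I_n => shiftZ p K K (j - i.+1) (b i)] =
  [forall i : 'I_n, (i < j)%N ==>
     ([ffun i => shiftZ p K (K - j) 0 (b i)] i \isn't a GRing.unit)].
Proof.
move=> jn; have q1 : (1 < p ^ K)%N by apply: prime_power_gt1 => //; lia.
apply: eq_forallb => i; rewrite !ffunE; case: (ltnP i j) => ij /=.
  have kj0 : (0 < K - j)%N by lia.
  rewrite [in RHS]shiftZ_int expn0 mul1r intr_Zpk_unit // negbK dvdzE /=.
  rewrite /shiftZ val_Zp_nat //.
  have -> : (j.+1 - i.+1 = (j - i.+1).+1)%N by lia.
  rewrite [LHS](_ : _ = (p ^ (j - i.+1).+1 %| p ^ (j - i.+1) * b i)%N); last first.
    rewrite /dvdn modn_dvdm // dvdn_exp2l //; lia.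
  by rewrite expnS mulnC dvdn_pmul2l // expn_gt0 prime_gt0.
by rewrite (_ : j.+1 - i.+1 = 0)%N ?expn0 ?dvd1n // subSS; apply/eqP; rewrite subn_eq0.
Qed.

End Rescaling.

Section RescalingSum.
Variable p : nat.
Hypothesis hp : prime p.
Variables (R : realFieldType) (z : {poly R}).

(** The coefficients from index j on, with the leading one as j < n, are multiples of p and form the
    perturbation U. The sum over the lower coefficients does not depend on them, whence the factor
    p^((K-j)(n-j)). *)
Lemma sum_Gpoly_unit k K n j : (1 < k)%N -> (n + k <= K)%N -> (j < n)%N ->
  \sum_(g : {ffun 'I_n -> 'Z_(p ^ (K - j))} |
       ~~ [forall i : 'I_n, (i < j)%N ==> (g i \isn't a GRing.unit)])
     z ^+ nz (redZ p k.-1 (K - j)) setT (Gpoly g) =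
  (\sum_(s < j) wmon p z k.-1 (K - j) s *+ (p.-1 * p ^ (K - j).-1 * (p ^ (K - j).-1) ^ (j.-1 - s)))
    *+ (p ^ ((K - j) * (n - j))).
Proof.
move=> k1 nK jn; have [l nE] : exists l, n = (j + l.+1)%N by exists (n - j).-1; lia.
subst n; set K' := (K - j)%N.
have k0' : (0 < k.-1)%N by lia.
have kK' : (k.-1 <= K')%N by rewrite /K'; lia.
have K0' := leq_trans k0' kK'.
rewrite big_mkcond sum_split_ffun exchange_big /=.
have -> : (j + l.+1 - j = l.+1)%N by lia.
transitivity (\sum_(g2 : {ffun 'I_l.+1 -> 'Z_(p ^ K')})
  \sum_(s < j) wmon p z k.-1 K' s *+ (p.-1 * p ^ K'.-1 * (p ^ K'.-1) ^ (j.-1 - s))); last first.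
  by rewrite sumr_const card_ffun !card_ord Zp_cast ?prime_power_gt1 // expnM.
apply: eq_bigr => g2 _.
pose U : {poly 'Z_(p ^ K')} := p%:R *: (p%:R ^+ l *: 'X^(j + l.+1) +
   \sum_(i < l.+1) (p%:R ^+ i * g2 i) *: 'X^(j + i)).
have Unu i : U`_i \isn't a GRing.unit.
  by rewrite /U coefZ (pi_nonunit (Zpk_nilp hp K0')).
have := @sum_primitive_perturbed _ _ _ (Zpk_nilp hp K0') (fun x => @Zpk_nonunit p hp K' x K0')
   _ (redZ p k.-1 K') _ z j U Unu.
rewrite (card_Zpk_units hp k0' kK') card_Zpk_nonunits // => <-.
rewrite [in RHS]big_mkcond /=; apply: eq_bigr => g1 _.
have eqc : [forall i : 'I_(j + l.+1), (i < j)%N ==> ([ffun i0 => match split i0 with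
                | inl a => g1 a | inr b => g2 b end] i \isn't a GRing.unit)] =
  [forall i, g1 i \isn't a GRing.unit].
  apply/forallP/forallP => h i.
    by have := h (lshift l.+1 i); rewrite /= ltn_ord ffunE (unsplitK (inl i)).
  apply/implyP => ij; rewrite ffunE; case: splitP => [a _|b hb]; first exact: h.
  by move: ij; rewrite hb ltnNge leq_addr.
rewrite eqc; case: ifP => // _; congr (_ ^+ nz _ _ _).
rewrite /Gpoly big_split_ord /= addrCA; congr (_ + _).
  apply: eq_bigr => i _; rewrite ffunE (unsplitK (inl i)) (_ : i.+1 - j = 0)%N ?mul1r //.
  by apply/eqP; rewrite subn_eq0.
rewrite /U scalerDr scaler_sumr scalerA -exprS addKn; congr (_ + _); apply: eq_bigr => i _.
rewrite ffunE (unsplitK (inr i)) scalerA mulrA -exprS; congr (_ ^+ _ * _ *: _).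
lia.
Qed.

(** With c = K - j the left side collects the upper coefficients, the fibres of reduction modulo
    p^c, the units and coefficients d, the step from binom(j, 2) to binom(j+1, 2), and the
    normalisation of [alphaF]. *)
Lemma rescale_exponent c n j s : (s < j)%N -> (j < n)%N -> (0 < c)%N ->
  (c * (n - j) + j * n + (c.-1 + c.-1 * (j.-1 - s)) + j + c * s = s + (c + j) * n)%N.
Proof.
move=> sj jn c0; have [b jE] : exists b, j = (s + b.+1)%N by exists (j - s).-1; lia.
have [a nE] : exists a, n = (j + a)%N by exists (n - j)%N; lia.
case: c c0 => // c _; rewrite nE addKn jE addnS /= addKn; nia.
Qed.

(** Distinguished polynomials are sorted by the power of p dividing F(py): p^n gives the first term,
    an exact power p^j with j < n the j-th one. There p - 1 comes from the number of units, and
    binom(j+1, 2) is binom(j, 2) + j. *)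
Lemma betaF_rescale k K n : (1 < k)%N -> (n + k <= K)%N ->
  betaF p z k K n = ((p ^ 'C(n, 2))%:R)^-1 *: alphaF p z k.-1 (K - n) n +
    \sum_(j < n) (p.-1%:R / (p ^ 'C(j.+1, 2))%:R) *:
       \sum_(s < j) (p%:R ^+ s) *: alphaF p z k.-1 (K - j) s.
Proof.
move=> k1 nK.
have k0 : (0 < k)%N by lia.
have kK : (k <= K)%N by lia.
have pn0 m : (p ^ m)%:R != 0 :> R by apply: pnat_neq0.
rewrite betaF_int // -event0 //.
rewrite (@sum_decreasing _ _ (fun j => @event p K n j) _ n (fun j a => @eventS p K n j a)) scalerDr.
congr (_ + _).
  have := @sum_event_Gpoly p hp R z k K n k1 nK n predT predT (leqnn n) (fun _ => erefl).
  rewrite (eq_bigl (event n)) => [|a]; last by rewrite andbT.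
  under [in RHS]eq_bigr do rewrite Gpoly_n.
  rewrite -/(wmon p z k.-1 (K - n) n) => /(congr1 (fun x => ((p ^ 'C(n, 2))%:R)^-1 *: x)).
  rewrite -scaler_nat scalerA mulVf // scale1r => ->.
  rewrite /alphaF !scalerA -scaler_nat scalerA; congr (_ *: _).
  have e : (p ^ (K * n))%:R = (p ^ ((K - n) * n))%:R * (p ^ (n * n))%:R :> R.
    by rewrite -natrM -expnD -mulnDl subnK //; lia.
  by rewrite e; field; rewrite !pn0.
rewrite scaler_sumr; apply: eq_bigr => j _.
have jn := ltn_ord j.
set K' := (K - j)%N.
have := @sum_event_Gpoly p hp R z k K n k1 nK j
  (fun a => ~~ event j.+1 a)
  (fun g => ~~ [forall i : 'I_n, (i < j)%N ==> (g i \isn't a GRing.unit)]) (ltnW jn).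
move=> /(_ (fun b => congr1 negb (@eventS_shift p hp k K n k1 nK j b jn))).
rewrite sum_Gpoly_unit // -/K' => /(congr1 (fun x => ((p ^ 'C(j, 2))%:R)^-1 *: x)).
rewrite -[X in _ *: X = _]scaler_nat scalerA mulVf // scale1r => ->.
rewrite -mulrnA -scaler_nat !scalerA !scaler_sumr; apply: eq_bigr => s _.
rewrite -scaler_nat /alphaF !scalerA; congr (_ *: _).
rewrite binS bin1 expnD !natrM.
have e : (p ^ ((K - j) * (n - j)))%:R * (p ^ (j * n))%:R *
    ((p ^ K'.-1)%:R * ((p ^ K'.-1) ^ (j.-1 - s))%:R) * (p ^ j)%:R * (p ^ (K' * s))%:R
   = (p ^ s)%:R * (p ^ (K * n))%:R :> R.
  rewrite -!natrM -expnM -!expnD; congr (_ ^ _)%:R.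
  have sj := ltn_ord s; rewrite -/K'.
  have K'0 : (0 < K')%N by rewrite /K'; lia.
  have KE : K = (K' + j)%N by rewrite /K'; lia.
  by rewrite [in RHS]KE; apply: rescale_exponent.
have {}e : (p ^ (K' * (n - j)))%:R * (p ^ (j * n))%:R *
    ((p ^ K'.-1)%:R * ((p ^ K'.-1) ^ (j.-1 - s))%:R)
   = (p ^ s)%:R * (p ^ (K * n))%:R / (p ^ j)%:R / (p ^ (K' * s))%:R :> R.
  by rewrite -e; field; rewrite !pn0.
transitivity (((p ^ (K * n))%:R^-1 : R) / (p ^ 'C(j, 2))%:R * p.-1%:R * ((p ^ (K' * (n - j)))%:R * (p ^ (j * n))%:R *
    ((p ^ K'.-1)%:R * ((p ^ K'.-1) ^ (j.-1 - s))%:R))); first by ring.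
by rewrite e -natrX; field; rewrite !pn0.
Qed.

End RescalingSum.

Definition Pint n (c : nat -> int) : {poly int} := \sum_(i < n.+1) c i *: 'X^i.

Lemma map_revp (A B : comNzRingType) (f : {rmorphism A -> B}) n (P : {poly A}) :
  map_poly f (revp n P) = revp n (map_poly f P).
Proof.
rewrite /revp rmorph_sum; apply: eq_bigr => i _ /=.
by rewrite map_polyZ map_polyXn coef_map.
Qed.

(** * Counting integral and nonintegral roots together *)

Section TotalCount.
Variable p : nat.
Hypothesis hp : prime p.

(** Roots of the reversed polynomial are inverses of roots, so those divisible by p stand for roots
    outside the p-adic integers, and for infinity. *)
Definition Ntot k K n (c : nat -> int) : nat :=
  (Nint p k K false (Pint n c) + Nint p k K true (revp n (Pint n c)))%N.

Lemma map_Pint K n (c : nat -> int) :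
  map_poly intr (Pint n c) = lowp [ffun i : 'I_n.+1 => (c i)%:~R] :> {poly 'Z_(p ^ K)}.
Proof.
rewrite /Pint /lowp rmorph_sum /=; apply: eq_bigr => i _.
by rewrite map_polyZ map_polyXn /= ffunE.
Qed.

Lemma Ntot_lowp k K n (c : nat -> int) : (0 < k)%N -> (k <= K)%N ->
  let f := [ffun i : 'I_n.+1 => (c i)%:~R] in
  Ntot k K n c = (nz (redZ p k K) setT (lowp f) + nz (redZ p k K) (nonunits _) (revp n (lowp f)))%N.
Proof. by move=> k0 kK f; rewrite /Ntot !Nint_nz // map_revp map_Pint. Qed.

(** The reversal of a monic polynomial has constant term 1, hence unit values at multiples of p: the
    second count vanishes. *)
Lemma Ntot_monic k K n (c : nat -> int) : (0 < k)%N -> (k <= K)%N -> c n = 1 ->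
  Ntot k K n c = nz (redZ p k K) setT (mon [ffun i : 'I_n => (c i)%:~R]).
Proof.
move=> k0 kK cn; have K0 := leq_trans k0 kK; rewrite Ntot_lowp //.
have -> : lowp [ffun i : 'I_n.+1 => (c i)%:~R] =
    mon [ffun i : 'I_n => (c i)%:~R] :> {poly 'Z_(p ^ K)}.
  rewrite /mon /lowp big_ord_recr addrC /= ffunE cn scale1r; congr (_ + _).
  by apply: eq_bigr => i _; rewrite !ffunE.
set h := mon _; rewrite -[RHS]addn0; congr (_ + _)%N.
rewrite /nz (_ : [set r in nonunits _ | root (revp n h) r] = set0) ?imset0 ?cards0 //.
apply/setP => x; rewrite !inE; apply/negbTE/negP => /andP[nx].
have : (revp n h).[x] \is a GRing.unit.
  rewrite (horner_nonunit (Zpk_nilp hp K0) (fun x => @Zpk_nonunit p hp K x K0)) //.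
  rewrite horner_coef0 coef_revp // subn0.
  by have := monicP (monic_mon [ffun i : 'I_n => (c i)%:~R : 'Z_(p ^ K)]); rewrite /lead_coef size_mon /= => ->; rewrite unitr1.
by rewrite rootE => u /eqP h0; move: u; rewrite h0 unitr0.
Qed.

Variables (R : realFieldType) (z : {poly R}).
Local Notation L := {poly R}.

Lemma alphaF_Ntot k K n : (0 < k)%N -> (k <= K)%N ->
  alphaF p z k K n = ((p ^ (K * n))%:R)^-1 *: \sum_(b : {ffun 'I_n -> 'Z_(p ^ K)})
    z ^+ Ntot k K n (fun i => if insub i is Some j then (b j : nat)%:Z else 1).
Proof.
move=> k0 kK; congr (_ *: _); apply: eq_bigr => b _; rewrite Ntot_monic //; last first.
  by rewrite insubN // ltnn.
congr (_ ^+ nz _ _ _).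
suff -> : [ffun i : 'I_n => (if insub (i : nat) is Some j then (b j : nat)%:Z else 1)%:~R] = b by [].
by apply/ffunP => i; rewrite ffunE valK -Zq_val.
Qed.

Lemma betaF_Ntot k K n : (0 < k)%N -> (k <= K)%N ->
  betaF p z k K n = ((p ^ (K * n))%:R)^-1 *: \sum_(b : {ffun 'I_n -> 'Z_(p ^ K)})
    z ^+ Ntot k K n (fun i => if insub i is Some j then p%:Z * (b j : nat)%:Z else 1).
Proof.
move=> k0 kK; rewrite betaF_int //; congr (_ *: _); apply: eq_bigr => b _.
have K0 := leq_trans k0 kK.
rewrite Ntot_monic //; last by rewrite insubN // ltnn.
rewrite Nint_nz // map_Fint; set d := [ffun i => _]; set d' := [ffun i => _].
have -> : d' = d by apply/ffunP => i; rewrite !ffunE valK.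
congr (_ ^+ _); rewrite /nz.
suff -> : [set r in nonunits 'Z_(p ^ K) | root (mon d) r] = [set r in setT | root (mon d) r] by [].
apply/setP => x; rewrite !inE /=; case: (boolP (x \is a GRing.unit)) => //= ux.
apply/esym/negbTE/negP; rewrite rootE => /eqP h0.
have hd : [forall i, d i \isn't a GRing.unit].
  by apply/forallP => i; rewrite ffunE intr_Zpk_unit // negbK dvdz_mulr.
have [Q hQ] := mon_nonunit (fun x => @Zpk_nonunit p hp K x K0) hd.
have : (mon d).[x] \is a GRing.unit.
  by rewrite hQ (horner_pi (Zpk_nilp hp K0) (fun x => @Zpk_nonunit p hp K x K0)) hornerXn unitrX.
by rewrite h0 unitr0.
Qed.

Definition rhoF k K n : L := ((p ^ (K * n.+1))%:R)^-1 *: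
  \sum_(b : {ffun 'I_n.+1 -> 'Z_(p ^ K)}) z ^+ Ntot k K n (fun i => (b (inord i) : nat)%:Z).

Lemma rhoF_nz k K n : (0 < k)%N -> (k <= K)%N ->
  rhoF k K n = ((p ^ (K * n.+1))%:R)^-1 *: \sum_(f : {ffun 'I_n.+1 -> 'Z_(p ^ K)})
   z ^+ (nz (redZ p k K) setT (lowp f) + nz (redZ p k K) (nonunits _) (revp n (lowp f)))%N.
Proof.
move=> k0 kK; congr (_ *: _); apply: eq_bigr => b _; rewrite Ntot_lowp //.
suff -> : [ffun i : 'I_n.+1 => ((b (inord i) : nat)%:Z)%:~R] = b by [].
by apply/ffunP => i; rewrite ffunE inord_val -Zq_val.
Qed.

Lemma Ntot_mulp k K n (c : nat -> int) :
  Ntot k K.+1 n (fun i => p%:Z * c i) = Ntot k K n c.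
Proof.
have pE : Pint n (fun i => p%:Z * c i) = p%:Z *: Pint n c.
  by rewrite /Pint scaler_sumr; apply: eq_bigr => i _; rewrite scalerA.
have dv (F : {poly int}) (r : int) :
    ((p ^ K.+1)%:Z %| (p%:Z *: F).[r])%Z = ((p ^ K)%:Z %| F.[r])%Z.
  by rewrite hornerZ expnS PoszM dvdz_mul2l // eqz_nat -lt0n prime_gt0.
rewrite /Ntot pE revpZ; congr (_ + _)%N; rewrite /Nint; congr #|pred_of_set _|.
  apply/setP => a; rewrite !inE; apply/asboolP/asboolP => -[r [ra hr]].
    by rewrite dv; exists r.
  by rewrite -dv; exists r.
apply/setP => a; rewrite !inE; apply/asboolP/asboolP => -[r [ra hr]].
  by rewrite dv; exists r.
by rewrite -dv; exists r.
Qed.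

(** A polynomial modulo p^(K+1) is either primitive or, with probability p^(-(n+1)), p times a
    uniform polynomial whose roots are tested modulo p^K only. *)
Lemma rhoF_rec k K n : (0 < k)%N -> (k <= K)%N ->
  rhoF k K.+1 n = ((p ^ n.+1)%:R)^-1 *: rhoF k K n +
     (p.-1%:R / (p ^ n.+1)%:R) *: primF p z k K.+1 n.
Proof.
move=> k0 kK; have kK1 := leqW kK; have K0 := leq_trans k0 kK.
have pn0 m : (p ^ m)%:R != 0 :> R by apply: pnat_neq0.
have pm0 : p.-1%:R != 0 :> R.
  by rewrite pnatr_eq0; have := prime_gt1 hp; lia.
rewrite rhoF_nz // (bigID (fun f : {ffun 'I_n.+1 -> 'Z_(p ^ K.+1)} =>
   [forall i, f i \isn't a GRing.unit])) /= -/(wprim p z k K.+1 n) scalerDr.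
congr (_ + _); last first.
  rewrite /primF scalerA; congr (_ *: _); rewrite /= mulSn expnD !natrM.
  by field; rewrite !pn0 pm0.
pose G (f : {ffun 'I_n.+1 -> 'Z_(p ^ K.+1)}) := z ^+ (nz (redZ p k K.+1) setT (lowp f)
     + nz (redZ p k K.+1) (nonunits _) (revp n (lowp f))).
pose H (f : {ffun 'I_n.+1 -> 'Z_(p ^ K)}) := z ^+ (nz (redZ p k K) setT (lowp f)
     + nz (redZ p k K) (nonunits _) (revp n (lowp f))).
have e1 := @sum_pushforward L _ _ n.+1 (fun=> shiftZ p K.+1 K.+1 1) G.
have e2 := @sum_fullfiber p hp R K.+1 K n.+1 H K0 (leqnSn K).
(* Each nonprimitive polynomial is p times b for exactly p^(n+1) vectors b. *)
have e3 : \sum_(a : {ffun 'I_n.+1 -> 'Z_(p ^ K.+1)}) G a *+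
     (\prod_(i < n.+1) #|[pred x | shiftZ p K.+1 K.+1 1 x == a i]|) =
     (\sum_(f : {ffun 'I_n.+1 -> 'Z_(p ^ K.+1)} | [forall i, f i \isn't a GRing.unit]) G f) *+ p ^ n.+1.
  rewrite -sumrMnl [in RHS]big_mkcond /=; apply: eq_bigr => d _.
  rewrite (eq_bigr (fun i => if (p %| d i)%N then p else 0))%N => [|i _]; last first.
    by rewrite card_shiftZ_fiber // subnn !expn1.
  case: ifP => [/forallP h|/negbT].
    rewrite (eq_bigr (fun=> p)) ?prod_nat_const ?card_ord // => i _.
    by rewrite -(Zpk_nonunit_dvd hp k0 kK1) ?h.
  rewrite negb_forall => /existsP[i]; rewrite (Zpk_nonunit_dvd hp k0 kK1) => hi.
  by rewrite (bigD1 i) //= (negbTE hi) mul0n mulr0n.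
have e4 : \sum_(b : {ffun 'I_n.+1 -> 'Z_(p ^ K.+1)}) G [ffun i => shiftZ p K.+1 K.+1 1 (b i)] =
          \sum_(b : {ffun 'I_n.+1 -> 'Z_(p ^ K.+1)}) H [ffun i => shiftZ p K.+1 K 0 (b i)].
  apply: eq_bigr => b _; rewrite /G /H; congr (_ ^+ _).
  pose c i : int := (b (inord i) : nat)%:Z.
  have := Ntot_mulp k K n c; rewrite !Ntot_lowp // => E.
  transitivity (Ntot k K.+1 n (fun i => p%:Z * c i)).
    rewrite Ntot_lowp //; suff -> : [ffun i => shiftZ p K.+1 K.+1 1 (b i)] =
      [ffun i : 'I_n.+1 => (p%:Z * c i)%:~R] by [].
    by apply/ffunP => i; rewrite !ffunE shiftZ_int expn1 /c inord_val.
  rewrite Ntot_mulp Ntot_lowp //; suff -> : [ffun i => shiftZ p K.+1 K 0 (b i)] =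
      [ffun i : 'I_n.+1 => (c i)%:~R] by [].
  by apply/ffunP => i; rewrite !ffunE shiftZ_int expn0 mul1r /c inord_val.
move: e3; rewrite -e1 e4 e2 subSnn mul1n => /(congr1 (fun x => ((p ^ n.+1)%:R)^-1 *: x)).
rewrite -2!scaler_nat !scalerA mulVf // !scale1r => E.
rewrite -[X in _ *: X = _]/(\sum_(f : {ffun 'I_n.+1 -> 'Z_(p ^ K.+1)} | [forall i, f i \isn't a GRing.unit]) G f) -E.
rewrite -scalerA -/(rhoF k K n) rhoF_nz // scalerA; congr (_ *: _).
by rewrite mulSn expnD natrM invfM.
Qed.

End TotalCount.

From mathcomp Require Import finmap all_classical all_reals all_analysis measurable_realfun.
Import Order.TTheory GRing.Theory Num.Theory.
Import numFieldNormedType.Exports.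

(** * Roots in Z_p and Q_p *)

Section PadicDigits.
Variable p : nat.
Hypothesis hp : prime p.
Implicit Types (u w : digits) (x : nat -> int).

Let p_gt0 k : (0 < p ^ k)%N. Proof. by rewrite expn_gt0 prime_gt0. Qed.

Lemma truncdS u k : trunc p u k.+1 = trunc p u k + (u k)%:Z * (p ^ k)%:Z.
Proof. by rewrite /trunc big_ord_recr. Qed.

Lemma truncd0 u : trunc p u 0 = 0.
Proof. by rewrite /trunc big_ord0. Qed.

Lemma truncd1 u : trunc p u 1 = (u 0%N)%:Z.
Proof. by rewrite truncdS truncd0 add0r expn0 mulr1. Qed.

Lemma dvdz_ppow k K : (k <= K)%N -> ((p ^ k)%:Z %| (p ^ K)%:Z)%Z.
Proof. by move=> h; rewrite dvdzE /= dvdn_exp2l. Qed.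

Lemma trunc_coherent u k K : (k <= K)%N -> ((p ^ k)%:Z %| trunc p u K - trunc p u k)%Z.
Proof.
move=> /subnKC <-; elim: (K - k)%N => [|m IH]; first by rewrite addn0 subrr dvdz0.
rewrite addnS truncdS addrAC rpredD // dvdz_mull // dvdz_ppow // leq_addr //.
Qed.

Lemma trunc_bounds u k : is_Zp p u -> 0 <= trunc p u k < (p ^ k)%:Z.
Proof.
move=> hu; elim: k => [|k IH]; first by rewrite truncd0.
rewrite truncdS; have := hu k; move: IH (p_gt0 k); rewrite expnS PoszM.
move: (trunc p u k) (u k) (p ^ k)%N => t d q /andP[t0 tq] q0 dp.
rewrite addr_ge0 //=.
have : d%:Z * q%:Z + q%:Z <= p%:Z * q%:Z.
  by rewrite -!PoszM -PoszD lez_nat -mulSnr leq_mul2r dp orbT.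
by apply: lt_le_trans; rewrite addrC ltrD2l.
Qed.

Lemma dvdz_small (q : nat) (a b : int) : 0 <= a < q%:Z -> 0 <= b < q%:Z ->
  (q%:Z %| a - b)%Z -> a = b.
Proof.
move=> /andP[a0 aq] /andP[b0 bq]; rewrite -eqz_mod_dvd => /eqP.
by rewrite !modz_small // ?a0 ?b0 // ?aq ?bq.
Qed.

Lemma trunc_inj u w : is_Zp p u -> is_Zp p w ->
  (forall k, ((p ^ k)%:Z %| trunc p u k - trunc p w k)%Z) -> u = w.
Proof.
move=> hu hw h; have E k : trunc p u k = trunc p w k.
  by apply: (dvdz_small (trunc_bounds k hu) (trunc_bounds k hw)).
apply/funext => k; have := E k.+1; rewrite !truncdS E => /addrI /eqP.
rewrite -!PoszM eqz_nat eqn_pmul2r // => /eqP //.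
Qed.

(** Digit k is read off the residue of x (k+1) modulo p^(k+1); coherence keeps the lower digits
    unchanged. *)
Lemma digits_of_coherent x : (forall k, ((p ^ k)%:Z %| x k.+1 - x k)%Z) ->
  exists2 u, is_Zp p u & forall k, ((p ^ k)%:Z %| trunc p u k - x k)%Z.
Proof.
move=> hx; pose y k : nat := `|(x k %% (p ^ k)%:Z)%Z|%N.
have yE k : (y k)%:Z = (x k %% (p ^ k)%:Z)%Z.
  by rewrite /y gez0_abs // modz_ge0 // eqz_nat -lt0n.
have yl k : (y k < p ^ k)%N.
  by rewrite -ltz_nat yE; have := @ltz_pmod (x k) (p ^ k)%:Z; apply; rewrite ltz_nat.
have ymod k : (y k.+1 %% p ^ k = y k)%N.
  apply/eqP; rewrite -eqz_nat -modz_nat !yE.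
  rewrite eqz_mod_dvd.
  have -> : (x k.+1 %% (p ^ k.+1)%:Z)%Z - x k =
      (x k.+1 - x k) - (x k.+1 %/ (p ^ k.+1)%:Z)%Z * (p ^ k.+1)%:Z.
    by rewrite {2}(divz_eq (x k.+1) (p ^ k.+1)%:Z); ring.
  by rewrite rpredB // dvdz_mull // dvdz_ppow.
exists (fun k => y k.+1 %/ p ^ k)%N.
  by move=> k; rewrite ltn_divLR // -expnS.
move=> k; suff -> : trunc p (fun k => y k.+1 %/ p ^ k)%N k = (y k)%:Z.
  by rewrite yE -eqz_mod_dvd modz_mod.
elim: k => [|k IH].
  rewrite truncd0; have := yl 0%N; rewrite expn0; by case: (y 0%N).
by rewrite truncdS IH [in RHS](divn_eq (y k.+1) (p ^ k)) ymod PoszD PoszM addrC.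
Qed.

Definition Ppad n (c : nat -> digits) K : {poly int} := Pint n (fun i => trunc p (c i) K).

Lemma Ppad_congr n c k K (r s : int) : (k <= K)%N -> ((p ^ k)%:Z %| r - s)%Z ->
  ((p ^ k)%:Z %| (Ppad n c K).[r] - (Ppad n c k).[s])%Z.
Proof.
case: k => [|k] kK; first by rewrite expn0 dvd1z.
have q1 : (1 < p ^ k.+1)%N by apply: prime_power_gt1.
rewrite -!intr_Zq_eq // => /eqP E; rewrite -!horner_map /= E.
apply/eqP; congr _.[_]; rewrite /Ppad !map_Pint.
suff -> : [ffun i : 'I_n.+1 => (trunc p (c i) K)%:~R] =
  [ffun i : 'I_n.+1 => (trunc p (c i) k.+1)%:~R] :> {ffun 'I_n.+1 -> 'Z_(p ^ k.+1)} by [].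
apply/ffunP => i; rewrite !ffunE; apply/eqP; rewrite intr_Zq_eq //.
exact: trunc_coherent.
Qed.

Definition zroot n c u := forall K, ((p ^ K)%:Z %| (Ppad n c K).[trunc p u K])%Z.

Definition Zroots n c (b : bool) : set digits :=
  [set u | [/\ is_Zp p u, zroot n c u & b -> u 0%N = 0%N]].

Lemma dvdz_congr (q : int) (a b : int) : (q %| a - b)%Z -> (q %| a)%Z = (q %| b)%Z.
Proof. by move=> h; rewrite -[a](subrK b) rpredDl. Qed.

Definition class_has_root n c b k K (a : int) := exists r : int,
  [/\ ((p ^ k)%:Z %| r - a)%Z, b -> (p%:Z %| r)%Z & ((p ^ K)%:Z %| (Ppad n c K).[r])%Z].

Lemma class_has_root_anti n c b k K K' a : (K <= K')%N ->
  class_has_root n c b k K' a -> class_has_root n c b k K a.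
Proof.
move=> KK' [r [ra br hr]]; exists r; split=> //.
have e : ((p ^ K)%:Z %| r - r)%Z by rewrite subrr dvdz0.
rewrite -(dvdz_congr (Ppad_congr n c KK' e)).
exact: dvdz_trans (dvdz_ppow KK') hr.
Qed.

(** There are p subclasses: if each failed at some level, all would fail at the largest of these
    levels, where the class still has a root. *)
Lemma class_split n (c : nat -> digits) b k a : (forall K, class_has_root n c b k K a) ->
  exists2 d : nat, (d < p)%N & forall K, class_has_root n c b k.+1 K (a + d%:Z * (p ^ k)%:Z).
Proof.
move=> h; apply: contrapT => hn.
have /choice [f hf] : forall d : 'I_p, exists K, ~ class_has_root n c b k.+1 K (a + (d : nat)%:Z * (p ^ k)%:Z).
  move=> d; apply: contrapT => hd; apply: hn; exists d => // K.
  by apply: contrapT => hK; apply: hd; exists K.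
have [r [ra br hr]] := h (\max_d f d)%N.
have [t ht] := dvdzP ra.
pose d := `|(t %% p%:Z)%Z|%N.
have p0 : p%:Z != 0 by rewrite eqz_nat -lt0n prime_gt0.
have dE : d%:Z = (t %% p%:Z)%Z by rewrite /d gez0_abs // modz_ge0.
have dp : (d < p)%N by rewrite -ltz_nat dE ltz_pmod // ltz_nat prime_gt0.
apply: (hf (Ordinal dp)); apply: (@class_has_root_anti _ _ _ _ _ (\max_d f d)%N).
  exact: leq_bigmax.
exists r; split=> //=.
have -> : r - (a + d%:Z * (p ^ k)%:Z) = (t - d%:Z) * (p ^ k)%:Z.
  by rewrite opprD addrA ht mulrBl.
rewrite expnS PoszM dvdz_mul // -eqz_mod_dvd dE modz_mod //.
Qed.

(* Compactness: extend the class digit by digit (Koenig's lemma). *)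
Lemma class_has_padic_root n (c : nat -> digits) (b : bool) k a : (forall K, class_has_root n c b k K a) ->
  exists2 u, Zroots n c b u & ((p ^ k)%:Z %| trunc p u k - a)%Z.
Proof.
move=> h.
have /choice [f hf] : forall t : nat * int, exists d : nat,
    (forall K, class_has_root n c b t.1 K t.2) ->
    (d < p)%N /\ (forall K, class_has_root n c b t.1.+1 K (t.2 + d%:Z * (p ^ t.1)%:Z)).
  move=> t; have [ht|ht] := pselect (forall K, class_has_root n c b t.1 K t.2).
    by have [d dp hd] := class_split ht; exists d.
  by exists 0%N.
pose s := fix s m := if m is m'.+1 then s m' + (f ((k + m')%N, s m'))%:Z * (p ^ (k + m'))%:Z else a.
have hs m : forall K, class_has_root n c b (k + m) K (s m).
  elim: m => [|m IH]; first by rewrite addn0.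
  by rewrite addnS; have [] := hf ((k + m)%N, s m) IH.
(* Reindexed so that [x j] is a class modulo p^j for j >= k; below k truncated subtraction keeps the
   value [a]. *)
pose x j := s (j - k)%N.
have xcl j : forall K, class_has_root n c b j K (x j).
  move=> K; have [r [ra br hr]] := hs (j - k)%N K; exists r; split=> //.
  by apply: dvdz_trans ra; apply: dvdz_ppow; lia.
have xcoh j : ((p ^ j)%:Z %| x j.+1 - x j)%Z.
  rewrite /x; case: (leqP k j) => kj; last first.
    have -> : (j.+1 - k = 0)%N by apply/eqP; rewrite subn_eq0.
    have -> : (j - k = 0)%N by apply/eqP; rewrite subn_eq0 ltnW.
    by rewrite subrr dvdz0.
  rewrite subSn //= addrAC subrr add0r dvdz_mull // dvdz_ppow //; lia.
have [u hu ux] := digits_of_coherent xcoh.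
exists u; last by have := ux k; rewrite /x subnn.
split=> // [K|bT].
  have [r [ra _ hr]] := xcl K K.
  suff e : ((p ^ K)%:Z %| trunc p u K - r)%Z by rewrite (dvdz_congr (Ppad_congr n c (leqnn K) e)).
  have -> : trunc p u K - r = (trunc p u K - x K) - (r - x K) by ring.
  by rewrite rpredB.
have [r [ra br _]] := xcl 1%N 1%N.
have : (p%:Z %| trunc p u 1)%Z.
  rewrite -[trunc p u 1](subrK r) rpredD //; last exact: br.
  have -> : trunc p u 1 - r = (trunc p u 1 - x 1%N) - (r - x 1%N) by ring.
  by have := ux 1%N; rewrite expn1 in ra * => ux1; rewrite rpredB.
rewrite truncd1 dvdzE /= => /dvdnP [m um].
have := hu 0%N; rewrite um; case: m {um} => // m; rewrite mulSn; lia.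
Qed.

Lemma dvdz_cancel m K (a b : int) : ~~ ((p ^ m)%:Z %| a)%Z ->
  ((p ^ K)%:Z %| a * b)%Z -> ((p ^ (K - m))%:Z %| b)%Z.
Proof.
rewrite !dvdzE abszM /=; move: `|a|%N `|b|%N => {}a {}b ha hab.
case: (posnP b) => [->|b0]; first exact: dvdn0.
case: (posnP a) => [a0|a0]; first by rewrite a0 dvdn0 in ha.
move: ha hab; rewrite !pfactor_dvdn ?muln_gt0 ?a0 ?b0 // lognM // -ltnNge.
by move: (logn p a) (logn p b) => x y; lia.
Qed.

(** Quantitative form of the bound on the number of roots: dividing out r0 and cancelling r - r0,
    whose valuation is below m, costs at most m digits per root. *)
Lemma coef_dvdz_of_roots (rs : seq int) m K (F : {poly int}) :
  (size F <= size rs)%N ->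
  pairwise (fun a b => ~~ ((p ^ m)%:Z %| a - b)%Z) rs ->
  {in rs, forall r, ((p ^ K)%:Z %| F.[r])%Z} ->
  forall i, ((p ^ (K - m * size rs))%:Z %| F`_i)%Z.
Proof.
elim: rs K F => [|r0 rs IH] K F /=.
  by rewrite leqn0 size_poly_eq0 => /eqP -> _ _ i; rewrite coef0 dvdz0.
move=> sF /andP[/allP hr0 hrs] hF i.
have : root (F - (F.[r0])%:P) r0 by rewrite rootE !hornerE subrr.
move/factor_theorem => [q hq].
have FE : F = q * ('X - r0%:P) + (F.[r0])%:P by rewrite -hq subrK.
have sq : (size q <= size rs)%N.
  have [->|q0] := eqVneq q 0; first by rewrite size_poly0.
  have : (size (F - (F.[r0])%:P)%R <= (size rs).+1)%N.
    apply: leq_trans (size_polyD _ _) _; rewrite size_polyN geq_max sF /=.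
    by apply: leq_trans (size_polyC_leq1 _) _.
  by rewrite hq size_Mmonic ?monicXsubC // size_XsubC addn2.
have qi := IH (K - m)%N q sq hrs.
have {}qi : forall i, ((p ^ (K - m * (size rs).+1))%:Z %| q`_i)%Z.
  move=> j; rewrite mulnS subnDA; apply: qi => r rin.
  apply: (@dvdz_cancel m K (r - r0)); first by rewrite -opprB rpredN hr0.
  have -> : (r - r0) * q.[r] = F.[r] - F.[r0].
    by rewrite {1}FE !hornerE addrK mulrC.
  by rewrite rpredB // hF // inE ?eqxx // rin orbT.
have d0 : ((p ^ (K - m * (size rs).+1))%:Z %| F.[r0])%Z.
  by apply: dvdz_trans (hF r0 (mem_head _ _)); apply: dvdz_ppow; apply: leq_subr.
rewrite FE coefD mulrBr coefB coefMX coefMC coefC.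
apply: rpredD; last by case: ifP => _; rewrite ?dvdz0.
by apply: rpredB; [case: ifP => _; rewrite ?dvdz0|rewrite dvdz_mulr].
Qed.

Lemma digits_separated (s : seq digits) : {in s, forall u, is_Zp p u} ->
  exists m, {in s &, forall u w, u != w -> forall K, (m <= K)%N ->
    ~~ ((p ^ m)%:Z %| trunc p u K - trunc p w K)%Z}.
Proof.
move=> hs.
have /choice [f hf] : forall uw : digits * digits, exists m,
    is_Zp p uw.1 -> is_Zp p uw.2 -> uw.1 != uw.2 ->
    ~~ ((p ^ m)%:Z %| trunc p uw.1 m - trunc p uw.2 m)%Z.
  move=> [u w] /=.
  have [[m hm]|h] := pselect (exists m, ~~ ((p ^ m)%:Z %| trunc p u m - trunc p w m)%Z).
    by exists m.
  exists 0%N => hu hw; case/eqP; apply: trunc_inj => // k.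
  by apply: contrapT => hk; apply: h; exists k; apply/negP.
exists (\max_(u <- s) \max_(w <- s) f (u, w))%N => u w us ws uw K mK.
have fm : (f (u, w) <= \max_(u <- s) \max_(w <- s) f (u, w))%N.
  apply: leq_trans (@leq_bigmax_seq _ s xpredT (fun u => \max_(w <- s) f (u, w))%N u us isT).
  exact: (@leq_bigmax_seq _ s xpredT (fun w => f (u, w)) w ws isT).
have := hf (u, w) (hs _ us) (hs _ ws) uw; apply: contraNN => h.
have h' := dvdz_trans (dvdz_ppow fm) h.
have -> : trunc p u (f (u, w)) - trunc p w (f (u, w)) = (trunc p u K - trunc p w K)
   - (trunc p u K - trunc p u (f (u, w))) + (trunc p w K - trunc p w (f (u, w))) by ring.
have fK := leq_trans fm mK.
by apply: rpredD; [apply: rpredB => //|]; apply: trunc_coherent.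
Qed.

Lemma Zroots_size n c b (s : seq digits) : uniq s -> {in s, forall u, Zroots n c b u} ->
  (exists2 i, (i <= n)%N & exists K, ~ ((p ^ K)%:Z %| trunc p (c i) K)%Z) ->
  (size s <= n)%N.
Proof.
move=> us hs [i ni [K0 hK0]]; rewrite leqNgt; apply/negP => sn.
have [m hm] : exists m, {in s &, forall u w, u != w -> forall K, (m <= K)%N ->
    ~~ ((p ^ m)%:Z %| trunc p u K - trunc p w K)%Z}.
  by apply: digits_separated => u /hs [].
(* The summand [m * size s] pays for the digits lost in the divisions, so that K0 remain; K >= m
   keeps the truncated roots separated. *)
pose K := (K0 + m * size s + m)%N.
pose rs := [seq trunc p u K | u <- s].
have srs : size rs = size s by rewrite size_map.
apply: hK0.
have : ((p ^ (K - m * size rs))%:Z %| (Ppad n c K)`_i)%Z.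
  apply: coef_dvdz_of_roots.
  - rewrite srs; apply: leq_trans sn; rewrite /Ppad /Pint.
    apply: leq_trans (size_sum _ _ _) _; apply/bigmax_leqP => j _.
    by apply: leq_trans (size_scale_leq _ _) _; rewrite size_polyXn.
  - rewrite pairwise_map; move: us; rewrite uniq_pairwise.
    apply: (sub_in_pairwise (P := mem s)) => [u w uin win uw|]; last exact/allP.
    by apply: hm => //; rewrite /K leq_addl.
  by move=> r /mapP[u uin ->]; have [_ + _] := hs u uin; apply.
have -> : (Ppad n c K)`_i = trunc p (c i) K.
  rewrite /Ppad /Pint coef_sum (bigD1 (Ordinal (ni : (i < n.+1)%N))) //= big1 ?addr0.
    by rewrite coefZ coefXn eqxx mulr1.
  move=> j ji; rewrite coefZ coefXn; case: eqP => [ij|]; last by rewrite mulr0.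
  by case/eqP: ji; apply: val_inj.
rewrite srs => h; have KK : (K0 <= K)%N by rewrite /K -addnA leq_addr.
rewrite -(dvdz_congr (trunc_coherent (c i) KK)).
by apply: dvdz_trans h; apply: dvdz_ppow; rewrite /K; lia.
Qed.

(** The degree bound provides a duplicate-free list of roots of maximal length, which must contain
    every root. *)
Lemma Zroots_list n c b :
  (exists2 i, (i <= n)%N & exists K, ~ ((p ^ K)%:Z %| trunc p (c i) K)%Z) ->
  exists s : seq digits, [/\ uniq s, (size s <= n)%N & forall u, (u \in s) <-> Zroots n c b u].
Proof.
move=> hc.
pose P m := `[< exists s : seq digits, [/\ uniq s, size s = m & {in s, forall u, Zroots n c b u}] >].
have P0 : exists m, P m by exists 0%N; apply/asboolP; exists [::].
have Pn m : P m -> (m <= n)%N.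
  by move=> /asboolP[s [us <- hs]]; apply: Zroots_size us hs hc.
case: (ex_maxnP P0 Pn) => m /asboolP[s [us sm hs]] hmax.
exists s; split=> //; first by apply: Zroots_size us hs hc.
move=> u; split=> [/hs //|hu]; apply: contrapT => /negP nus.
have /hmax : P m.+1.
  apply/asboolP; exists (u :: s); split; rewrite /= ?nus ?us ?sm //.
  by move=> w; rewrite inE => /predU1P[->|/hs].
by rewrite ltnn.
Qed.

Lemma Nint_Ppad n c b k K : (0 < k)%N ->
  Nint p k K b (Ppad n c K) =
  #|[set a : 'Z_(p ^ k) | `[< class_has_root n c b k K (a : nat)%:Z >]]|.
Proof.
move=> k0; rewrite /Nint; congr #|pred_of_set _|; apply/setP => a; rewrite !inE.
have e (r : int) : r%:~R = a <-> ((p ^ k)%:Z %| r - (a : nat)%:Z)%Z.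
  rewrite -intr_Zq_eq ?prime_power_gt1 // -Zq_val; split=> [->|/eqP //]; exact: eqxx.
by apply/asboolP/asboolP => -[r [/e ra br hr]]; exists r; split=> //; apply/e.
Qed.

Definition residues k (s : seq digits) : nat :=
  size (undup [seq (trunc p u k)%:~R : 'Z_(p ^ k) | u <- s]).

Lemma residues_le k s : (residues k s <= size s)%N.
Proof. by rewrite -(size_map (fun u => (trunc p u k)%:~R : 'Z_(p ^ k)) s) size_undup. Qed.

Lemma residues_eventually s : uniq s -> {in s, forall u, is_Zp p u} ->
  exists k0, forall k, (k0 <= k)%N -> residues k s = size s.
Proof.
move=> us /digits_separated[m hm]; exists m.+1 => k mk.
rewrite /residues undup_id ?size_map // map_inj_in_uniq // => u w uin win /eqP.
rewrite intr_Zq_eq ?prime_power_gt1 //; last by apply: leq_ltn_trans mk.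
move=> h; apply/eqP; apply: contraT => uw.
have := hm u w uin win uw k (ltnW mk); rewrite (dvdz_trans _ h) //.
by apply: dvdz_ppow; apply: ltnW.
Qed.

(** By compactness each class modulo p^k contains a p-adic root or has no root modulo some p^K; the
    classes being finite in number, one level serves them all. *)
Lemma Nint_eventually n c b k s : (0 < k)%N -> (forall u, (u \in s) <-> Zroots n c b u) ->
  exists K0, forall K, (K0 <= K)%N -> Nint p k K b (Ppad n c K) = residues k s.
Proof.
move=> k0 hs; have q1 := prime_power_gt1 hp k0.
have /choice [f hf] : forall a : 'Z_(p ^ k), exists K0, 
    (exists2 u, u \in s & (trunc p u k)%:~R = a) \/ ~ class_has_root n c b k K0 (a : nat)%:Z.
  move=> a; have [h|h] := pselect (forall K, class_has_root n c b k K (a : nat)%:Z).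
    exists 0%N; left; have [u hu ua] := class_has_padic_root h; exists u; first exact/hs.
    by apply/eqP; rewrite [X in _ == X]Zq_val intr_Zq_eq.
  by move/existsNP: h => [K hK]; exists K; right.
exists (\max_a f a)%N => K hK; rewrite Nint_Ppad // /residues.
rewrite -(card_uniqP (undup_uniq _)); apply: eq_card => a; rewrite inE mem_undup.
apply/asboolP/mapP => [h|[u us ->]].
  case: (hf a) => [[u us ua]|[]]; first by exists u.
  by apply: class_has_root_anti h; apply: leq_trans hK; apply: leq_bigmax.
have [hu ru bu] := (hs u).1 us.
(* This integer has to be in the right class modulo p^k and also a root modulo p^K. *)
exists (trunc p u (maxn k K)); split.
- rewrite -intr_Zq_eq // -Zq_val intr_Zq_eq //.
  by apply: trunc_coherent; rewrite leq_maxl.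
- move=> bT; have : ((p ^ 1)%:Z %| trunc p u (maxn k K) - trunc p u 1)%Z.
    by apply: trunc_coherent; rewrite leq_max k0.
  by rewrite truncd1 bu // subr0 expn1.
have e : ((p ^ K)%:Z %| trunc p u (maxn k K) - trunc p u K)%Z.
  by apply: trunc_coherent; rewrite leq_maxr.
by rewrite (dvdz_congr (Ppad_congr n c (leqnn K) e)).
Qed.

End PadicDigits.

Lemma card_fset_set_seq (T U : choiceType) (A : set T) (l : seq U) (psi : T -> U) :
  uniq l -> (forall x, A x -> psi x \in l) ->
  (forall x y, A x -> A y -> psi x = psi y -> x = y) ->
  (forall t, t \in l -> exists2 x, A x & psi x = t) ->
  (#|` fset_set A|)%fset = size l.
Proof.
move=> ul hA hinj hsurj.
have /choice [g hg] : forall t : seq_sub l, exists x, A x /\ psi x = val t.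
  by move=> t; have [x Ax xt] := hsurj _ (valP t); exists x.
pose l' := [seq g t | t <- enum {: seq_sub l}].
have ginj : injective g.
  by move=> s t E; apply: val_inj; rewrite -(hg s).2 -(hg t).2 E.
have ul' : uniq l' by rewrite map_inj_uniq // enum_uniq.
have -> : A = [set` [fset x | x in l']%fset]%classic.
  apply/seteqP; split=> x /=; rewrite !inE /=; last first.
    by move=> /mapP[t _ ->]; have [] := hg t.
  move=> Ax; apply/mapP; exists (SeqSub (hA x Ax)); first by rewrite mem_enum.
  by have [Ag pg] := hg (SeqSub (hA x Ax)); apply: hinj => //; rewrite pg.
by rewrite set_fsetK card_fseq undup_id // size_map -cardE card_seq_sub.
Qed.

(** * Roots in Q_p and inversion of units *)

Section QpPoints.
Variable p : nat.
Hypothesis hp : prime p.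
Implicit Types (u w : digits).

Definition shiftd v u : digits := fun i => if (i < v)%N then 0%N else u (i - v)%N.

Lemma trunc_shiftd v u k : trunc p (shiftd v u) k = (p ^ v)%:Z * trunc p u (k - v).
Proof.
elim: k => [|k IH]; first by rewrite sub0n !truncd0 mulr0.
rewrite truncdS IH /shiftd; case: ltnP => kv.
  have -> : (k.+1 - v = k - v)%N by lia.
  by rewrite mul0r addr0.
rewrite subSn // truncdS mulrDr; congr (_ + _); rewrite mulrCA; congr (_ * _).
by rewrite -PoszM -expnD subnKC.
Qed.

Lemma trunc_shiftd_congr v u k :
  ((p ^ k)%:Z %| trunc p (shiftd v u) k - (p ^ v)%:Z * trunc p u k)%Z.
Proof.
rewrite trunc_shiftd -mulrBr; apply: (@dvdz_trans ((p ^ v)%:Z * (p ^ (k - v))%:Z)).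
  by rewrite -PoszM -expnD; apply: dvdz_ppow; lia.
by apply: dvdz_mul => //; rewrite -opprB rpredN trunc_coherent // leq_subr.
Qed.

Lemma is_Zp_shiftd v u : is_Zp p u -> is_Zp p (shiftd v u).
Proof. by move=> hu i; rewrite /shiftd; case: ifP => // _; apply: prime_gt0. Qed.

Lemma shiftd_neq0 v u : shiftd v u v = u 0%N.
Proof. by rewrite /shiftd ltnn subnn. Qed.

Lemma shiftd_inj v v' u u' : u 0%N != 0%N -> u' 0%N != 0%N ->
  shiftd v u = shiftd v' u' -> v = v' /\ u = u'.
Proof.
move=> u0 u0' E.
have vv : v = v'.
  apply/eqP; rewrite eqn_leq; apply/andP; split; rewrite leqNgt; apply/negP => h.
    by move: u0'; rewrite -(shiftd_neq0 v') -E /shiftd h.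
  by move: u0; rewrite -(shiftd_neq0 v) E /shiftd h.
split=> //; apply/funext => i; have := congr1 (fun f : digits => f (i + v)%N) E.
by rewrite -vv /shiftd ltnNge leq_addl /= addnK.
Qed.

Lemma shiftd_surj w : is_Zp p w -> w <> (fun=> 0%N) ->
  exists v u, [/\ is_Zp p u, u 0%N != 0%N & w = shiftd v u].
Proof.
move=> hw w0.
have ex : exists i, w i != 0%N.
  apply: contrapT => h; apply: w0; apply/funext => i; apply/eqP; apply: contraT => hi.
  by case: h; exists i.
case: (ex_minnP ex) => v hv hmin; exists v, (fun i => w (i + v)%N); split=> //.
apply/funext => i; rewrite /shiftd; case: ltnP => iv; last by rewrite subnK.
by apply/eqP; apply: contraT => /hmin; rewrite leqNgt iv.
Qed.

Lemma unit_trunc u k : is_Zp p u -> u 0%N != 0%N -> (0 < k)%N ->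
  (trunc p u k)%:~R \is a @GRing.unit 'Z_(p ^ k).
Proof.
move=> hu u0 k0; rewrite intr_Zpk_unit //; apply/negP => h.
have : (p%:Z %| trunc p u 1)%Z.
  have := trunc_coherent p u k0; rewrite expn1 => /dvdz_congr <- //.
rewrite truncd1 dvdzE /= => /dvdn_leq; have := hu 0%N; lia.
Qed.

Definition inverse_digits u w := is_Zp p w /\
  forall k, (0 < k)%N -> (trunc p u k)%:~R * (trunc p w k)%:~R = 1 :> 'Z_(p ^ k).

(** An inverse modulo p^(k+1) reduces to the unique inverse modulo p^k, so the inverses of the
    truncations form a coherent sequence. *)
Lemma inverse_digits_ex u : is_Zp p u -> u 0%N != 0%N -> exists w, inverse_digits u w.
Proof.
move=> hu u0.
pose x k : int := (((trunc p u k)%:~R : 'Z_(p ^ k))^-1 : nat)%:Z.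
have xE k : (0 < k)%N -> (trunc p u k)%:~R * (x k)%:~R = 1 :> 'Z_(p ^ k).
  by move=> k0; rewrite /x -Zq_val divrr ?unit_trunc.
have [w hw wx] : exists2 w, is_Zp p w & forall k, ((p ^ k)%:Z %| trunc p w k - x k)%Z.
  apply: (digits_of_coherent hp) => -[|k]; first by rewrite expn0 dvd1z.
  have q1 : (1 < p ^ k.+1)%N by apply: prime_power_gt1.
  rewrite -intr_Zq_eq //; apply/eqP/(mulrI (unit_trunc hu u0 (ltn0Sn k))).
  rewrite xE //; have /eqP := xE k.+2 isT.
  rewrite -intrM -[X in _ == X]/(1%:~R) intr_Zq_eq ?prime_power_gt1 //.
  move=> /(dvdz_trans (dvdz_ppow p (leqnSn _))); rewrite -intr_Zq_eq // intrM => /eqP E.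
  rewrite -[RHS]/(1%:~R) -E; congr (_ * _); apply/eqP; rewrite intr_Zq_eq // -opprB rpredN.
  exact: trunc_coherent.
exists w; split=> // k k0; have E : (trunc p w k)%:~R = (x k)%:~R :> 'Z_(p ^ k).
  by apply/eqP; rewrite intr_Zq_eq ?prime_power_gt1.
by rewrite E xE.
Qed.

Lemma inverse_digits_unit u w : inverse_digits u w -> w 0%N != 0%N.
Proof.
move=> [hw h]; apply/eqP => w0; have := h 1%N isT.
rewrite [trunc p w 1]truncd1 w0 mulr0 => /eqP; rewrite eq_sym oner_eq0 //.
Qed.

Lemma inverse_digits_sym u w : is_Zp p u -> inverse_digits u w -> inverse_digits w u.
Proof. by move=> hu [hw h]; split=> // k k0; rewrite mulrC h. Qed.

Lemma inverse_digits_uniq u w w' : inverse_digits u w -> inverse_digits u w' -> w = w'.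
Proof.
move=> [hw h] [hw' h']; apply: (trunc_inj hp) => // -[|k]; first by rewrite expn0 dvd1z.
have q1 : (1 < p ^ k.+1)%N by apply: prime_power_gt1.
rewrite -intr_Zq_eq //; apply/eqP.
transitivity ((trunc p w k.+1)%:~R * ((trunc p u k.+1)%:~R * (trunc p w' k.+1)%:~R) : 'Z_(p ^ k.+1)).
  by rewrite h' // mulr1.
by rewrite mulrCA mulrA h // mul1r.
Qed.

Lemma inverse_digits_fun : exists inv : digits -> digits,
  forall u, is_Zp p u -> u 0%N != 0%N -> inverse_digits u (inv u).
Proof.
have /choice [f hf] : forall u, exists w, is_Zp p u -> u 0%N != 0%N -> inverse_digits u w.
  move=> u; have [[h1 h2]|h] := pselect (is_Zp p u /\ u 0%N != 0%N).
    by have [w hw] := inverse_digits_ex h1 h2; exists w.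
  by exists u => h1 h2; case: h.
by exists f.
Qed.

Lemma revp_Pint n (c : nat -> int) : revp n (Pint n c) = Pint n (fun i => c (n - i)%N).
Proof.
rewrite /Pint revp_sum (reindex_inj rev_ord_inj) /=; apply: eq_bigr => i _.
rewrite revpZ revpXn subSS ?leq_subr // subKn // -ltnS //.
Qed.

Lemma scaled_value_pos n c v u k :
  ((p ^ k)%:Z %| scaled_value p n c (Posz v) u k)%Z =
  ((p ^ k)%:Z %| (Ppad p n c k).[trunc p (shiftd v u) k])%Z.
Proof.
have -> : scaled_value p n c v u k = (Ppad p n c k).[(p ^ v)%:Z * trunc p u k].
  rewrite /scaled_value /Ppad /Pint horner_sum; apply: eq_bigr => i _ /=.
  rewrite hornerZ hornerXn exprMn -mulrA; congr (_ * (_ * _)).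
  by rewrite expnM -!natz natrX.
have e := trunc_shiftd_congr v u k.
by rewrite -(dvdz_congr (Ppad_congr hp n c (leqnn k) e)).
Qed.

(** For x = p^(-v) u and w = 1/u, p^(vn) f(x) is u^n times the reversed polynomial at p^v w = 1/x,
    and u^n is a unit. *)
Lemma scaled_value_neg n c v u w k : (0 < v)%N -> is_Zp p u -> inverse_digits u w ->
  ((p ^ k)%:Z %| scaled_value p n c (- (Posz v)) u k)%Z =
  ((p ^ k)%:Z %| (Ppad p n (fun i => c (n - i)%N) k).[trunc p (shiftd v w) k])%Z.
Proof.
move=> v0 hu [hw h]; case: k => [|k]; first by rewrite expn0 !dvd1z.
have e := trunc_shiftd_congr v w k.+1.
rewrite (dvdz_congr (Ppad_congr hp n (fun i => c (n - i)%N) (leqnn k.+1) e)).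
have q1 : (1 < p ^ k.+1)%N by apply: prime_power_gt1.
rewrite -!intr_Zq_eq0 //.
set t : 'Z_(p ^ k.+1) := (trunc p u k.+1)%:~R; set t' : 'Z_(p ^ k.+1) := (trunc p w k.+1)%:~R.
have tt : t * t' = 1 by apply: h.
suff -> : (scaled_value p n c (- v%:Z) u k.+1)%:~R =
  t ^+ n * ((Ppad p n (fun i => c (n - i)%N) k.+1).[(p ^ v)%:Z * trunc p w k.+1])%:~R :> 'Z_(p ^ k.+1).
  have ut : t ^+ n * t' ^+ n = 1 by rewrite -exprMn tt expr1n.
  apply/eqP/eqP => [E|->]; last by rewrite mulr0.
  by have := congr1 (fun y => t' ^+ n * y) E; rewrite mulr0 mulrA [t' ^+ n * _]mulrC ut mul1r.
rewrite /scaled_value /Ppad /Pint horner_sum !rmorph_sum mulr_sumr /=.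
rewrite [RHS](reindex_inj rev_ord_inj) /=; apply: eq_bigr => i _.
have iN : (i <= n)%N by rewrite -ltnS.
rewrite hornerZ hornerXn exprMn subSS subKn // !rmorphM !rmorphXn /= -/t -/t'.
have -> : (0 <= - v%:Z) = false by rewrite oppr_ge0 lez_nat leqn0; case: v v0 {e}.
rewrite abszN /= [in RHS]mulrCA -mulrA; congr (_ * _).
rewrite [in RHS]mulrCA exprM; congr (_ * _).
have -> : t ^+ n = t ^+ i * t ^+ (n - i) by rewrite -exprD subnKC.
by rewrite -mulrA -exprMn tt expr1n mulr1.
Qed.

(** Integral roots correspond to their digits, nonintegral roots x to the digits of 1/x. The leading
    coefficient is nonzero, since otherwise 0 would be a root of the reversed polynomial that is no
    inverse. *)
Lemma nroots_Zroots n c (s1 s2 : seq digits) :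
  (exists K, ~ ((p ^ K)%:Z %| trunc p (c n) K)%Z) ->
  uniq s1 -> uniq s2 -> (forall u, (u \in s1) <-> Zroots p n c false u) ->
  (forall u, (u \in s2) <-> Zroots p n (fun i => c (n - i)%N) true u) ->
  nroots p n c = (size s1 + size s2)%N.
Proof.
move=> [K0 hK0] us1 us2 hs1 hs2.
have [inv hinv] := inverse_digits_fun.
have trunc_zero k : trunc p (fun=> 0%N) k = 0.
  by rewrite /trunc big1 // => i _; rewrite mul0r.
have Pad0 n' c' k : (Ppad p n' c' k).[0] = trunc p (c' 0%N) k.
  rewrite /Ppad /Pint horner_sum big_ord_recl /= hornerZ hornerXn expr0 mulr1.
  by rewrite big1 ?addr0 // => i _; rewrite hornerZ hornerXn expr0n mulr0.
(* [Negz v] is -(v+1), so the inverse has valuation v + 1. *)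
pose psi (x : option (int * digits)) : bool * digits := match x with
  | None => (true, fun=> 0%N)
  | Some (Posz v, u) => (true, shiftd v u)
  | Some (Negz v, u) => (false, shiftd v.+1 (inv u)) end.
pose l := [seq (true, w) | w <- s1] ++ [seq (false, w) | w <- s2].
have it : injective (fun w : digits => (true, w)) by move=> a b [].
have jf : injective (fun w : digits => (false, w)) by move=> a b [].
have memt w : ((true, w) \in l) = (w \in s1).
  rewrite mem_cat (mem_map it) orbC (_ : (_ \in _) = false) //.
  by apply/negbTE/negP => /mapP[].
have memf w : ((false, w) \in l) = (w \in s2).
  rewrite mem_cat (mem_map jf) (_ : (_ \in _) = false) //.
  by apply/negbTE/negP => /mapP[].
have -> : (size s1 + size s2)%N = size l by rewrite size_cat !size_map.
apply: (@card_fset_set_seq _ _ _ _ psi).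
- rewrite cat_uniq (map_inj_uniq it) (map_inj_uniq jf) us1 us2 andbT /=.
  by apply/hasPn => x /mapP[w _ ->]; apply/negP => /mapP[].
- case=> [[[v|v] u]|] /=.
  + move=> [hu [u0 hr]]; rewrite memt; apply/hs1; split=> //; first exact: is_Zp_shiftd.
    by move=> k; rewrite -scaled_value_pos.
  + move=> [hu [u0 hr]]; rewrite memf; apply/hs2; have hi := hinv u hu u0.
    split=> //; first by apply: is_Zp_shiftd; have [] := hi.
    by move=> k; rewrite -(scaled_value_neg n c k (ltn0Sn v) hu hi) -NegzE.
  move=> h; rewrite memt; apply/hs1; split=> //; first by move=> i; apply: prime_gt0.
  by move=> k; rewrite trunc_zero Pad0.
- case=> [[[v|v] u]|] [[[v'|v'] u']|] //=.
  + by move=> [hu [u0 _]] [hu' [u0' _]] [] /(shiftd_inj u0 u0')[-> ->].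
  + move=> [hu [u0 _]] _ [] /(congr1 (fun f : digits => f v)); rewrite shiftd_neq0 => E.
    by rewrite E in u0.
  + move=> [hu [u0 _]] [hu' [u0' _]] [].
    have h1 := hinv u hu u0; have h2 := hinv u' hu' u0'.
    move=> /(shiftd_inj (inverse_digits_unit h1) (inverse_digits_unit h2))[[->] E].
    have := inverse_digits_sym hu' h2; rewrite -E => h3.
    by rewrite (inverse_digits_uniq (inverse_digits_sym hu h1) h3).
  + move=> _ [hu [u0 _]] [] /(congr1 (fun f : digits => f v')); rewrite shiftd_neq0 => E.
    by rewrite -E in u0.
move=> [[] w]; rewrite ?memt ?memf.
  move=> /hs1 [hw rw _]; have [w0|w0] := pselect (w = fun=> 0%N).
    exists None => //=; last by rewrite w0.
    by move=> k; have := rw k; rewrite w0 trunc_zero Pad0.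
  have [v [u [hu u0 wE]]] := shiftd_surj hw w0.
  exists (Some (Posz v, u)); last by rewrite wE.
  by split=> //; split=> // k; rewrite scaled_value_pos -wE.
move=> /hs2 [hw rw /(_ isT) w00].
have w0 : w <> (fun=> 0%N).
  by move=> w0; apply: hK0; have := rw K0; rewrite w0 trunc_zero Pad0 subn0.
have [v [u' [hu' u0' wE]]] := shiftd_surj hw w0.
have h' := hinv u' hu' u0'; have u0 := inverse_digits_unit h'.
have hu : is_Zp p (inv u') by case: h'.
have h := hinv _ hu u0.
have ii : inv (inv u') = u' by apply: (inverse_digits_uniq h (inverse_digits_sym hu' h')).
(* Digit 0 of [w] vanishes, which excludes valuation 0. *)
case: v wE => [|v] wE.
  by move: w00; rewrite wE shiftd_neq0 => u'0; rewrite u'0 in u0'.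
exists (Some (Negz v, inv u')); last by rewrite /= ii wE.
split=> //; split=> // k; rewrite NegzE.
by rewrite (scaled_value_neg n c k (ltn0Sn v) hu h) ii -wE.
Qed.

(** The pointwise input of the two limits: constancy in K for fixed k, then a bound 2n uniform in k
    and constancy in k. *)
Lemma Ntot_eventually n (c : nat -> digits) :
  (exists K, ~ ((p ^ K)%:Z %| trunc p (c n) K)%Z) ->
  exists N : nat -> nat,
   [/\ forall k, (0 < k)%N -> exists K0, forall K, (K0 <= K)%N ->
         Ntot p k K n (fun i => trunc p (c i) K) = N k,
       forall k, (N k <= n + n)%N &
       exists k0, forall k, (k0 <= k)%N -> N k = nroots p n c].
Proof.
move=> hcn.
have [s1 [us1 ss1 hs1]] := Zroots_list hp false (ex_intro2 _ _ n (leqnn n) hcn).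
have [s2 [us2 ss2 hs2]] : exists s : seq digits, [/\ uniq s, (size s <= n)%N &
    forall u, (u \in s) <-> Zroots p n (fun i => c (n - i)%N) true u].
  by apply: Zroots_list => //; exists 0%N; rewrite ?subn0.
exists (fun k => residues p k s1 + residues p k s2)%N; split.
- move=> k k0.
  have [K1 h1] := Nint_eventually hp k0 hs1.
  have [K2 h2] := Nint_eventually hp k0 hs2.
  exists (maxn K1 K2) => K; rewrite geq_max => /andP[hK1 hK2].
  by rewrite /Ntot revp_Pint -/(Ppad p n c K) -/(Ppad p n (fun i => c (n - i)%N) K) h1 // h2.
- by move=> k; rewrite leq_add // (leq_trans (residues_le _ _ _)).
have [k1 h1] : exists k0, forall k, (k0 <= k)%N -> residues p k s1 = size s1.
  by apply: residues_eventually => // u /hs1[].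
have [k2 h2] : exists k0, forall k, (k0 <= k)%N -> residues p k s2 = size s2.
  by apply: residues_eventually => // u /hs2[].
exists (maxn k1 k2) => k; rewrite geq_max => /andP[hk1 hk2].
by rewrite h1 // h2 // (nroots_Zroots hcn us1 us2 hs1 hs2).
Qed.

End QpPoints.

(** * Integrals of functions of finitely many digits *)

Local Open Scope classical_set_scope.

Section NullSets.
Variables (d : measure_display) (T : measurableType d) (R : realType).
Variable mu : {measure set T -> \bar R}.
Import HBNNSimple.

(** The integral of an arbitrary nonnegative [f] is a supremum over simple functions below it, and
    setting such a function to 0 off D' does not change its integral. In this form it applies to the
    number of roots, whose measurability is only established off a null set. *)
Lemma ge0_integral_null (D D' : set T) (f : T -> \bar R) :
  measurable D -> measurable D' -> D' `<=` D -> mu (D `\` D') = 0%E ->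
  (forall x, D x -> (0 <= f x)%E) -> (\int[mu]_(x in D) f x = \int[mu]_(x in D') f x)%E.
Proof.
move=> mD mD' D'D D0 f0.
have f0' x : D' x -> (0 <= f x)%E by move=> /D'D /f0.
rewrite !ge0_integralE //; apply/eqP; rewrite eq_le; apply/andP; split; last first.
  apply: le_ereal_sup => _ [h /= hf <-]; exists h => //= x; apply: le_trans (hf x) _.
  rewrite /patch; case: ifPn => [/set_mem /D'D Dx|_]; first by rewrite mem_set.
  by case: ifPn => // /set_mem /f0.
apply: ge_ereal_sup => _ [h /= hf <-].
apply: ereal_sup_ubound; exists (proj_nnsfun h mD') => /=.
  move=> x; rewrite /proj_nnsfun /= mindicE /patch; case: ifPn => [/set_mem D'x|_]; last by rewrite mulr0.
  by rewrite mulr1; have := hf x; rewrite /patch mem_set //; apply: D'D.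
rewrite -!integralT_nnsfun; apply: ge0_ae_eq_integral => //.
  - exact/measurable_EFinP.
- exact/measurable_EFinP.
- by move=> x _; rewrite lee_fin.
- by move=> x _; rewrite lee_fin.
exists (D `\` D'); split=> //; first exact: measurableD.
move=> x /= /not_implyP [_ hx]; split; apply: contrapT => hx'; apply: hx.
  have h0 : h x = 0.
    apply/eqP; rewrite eq_le fun_ge0 andbT -lee_fin; have := hf x.
    by rewrite /patch memNset.
  by rewrite /proj_nnsfun /= h0 mul0r.
by move: hx' => /contrapT D'x; rewrite /proj_nnsfun /= mindicE mem_set // mulr1.
Qed.

End NullSets.

(** * Functions constant on intervals of length 1/q *)

Section StepFunctions.
Variable R : realType.
Local Notation mu := (@lebesgue_measure R).
Local Notation D01 := (`[0%R, 1%R[%classic : set R).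

Definition cell (q i : nat) : set R := `[i%:R / q%:R, i.+1%:R / q%:R[%classic.
Definition step (q : nat) (g : nat -> R) (x : R) : R := \sum_(i < q) g i * \1_(cell q i) x.
Definition flo (q : nat) (x : R) : nat := `|Num.floor (x * q%:R)|%N.

Lemma floE q x : D01 x -> (flo q x)%:Z = Num.floor (x * q%:R).
Proof.
move=> /=; rewrite in_itv /= => /andP[x0 _]; rewrite /flo gez0_abs //.
by rewrite floor_ge0 mulr_ge0 // ler0n.
Qed.

Lemma flo_lt q x : (0 < q)%N -> D01 x -> (flo q x < q)%N.
Proof.
move=> q0 Dx; rewrite -ltz_nat floE //; move: Dx => /=; rewrite in_itv /= => /andP[x0 x1].
rewrite floor_lt_int -pmulrn; have q0' : 0 < q%:R :> R by rewrite ltr0n.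
by rewrite -[X in _ < X]mul1r ltr_pM2r.
Qed.

Lemma cell_flo q x i : (0 < q)%N -> D01 x -> cell q i x <-> flo q x = i.
Proof.
move=> q0 Dx; have q0' : 0 < q%:R :> R by rewrite ltr0n.
rewrite /cell /= in_itv /= ler_pdivrMr // ltr_pdivlMr //.
split=> [/andP[h1 h2]|<-].
  apply/eqP; rewrite -eqz_nat floE //; apply/eqP/floor_def.
  by rewrite -pmulrn h1 /= -PoszD addn1 -pmulrn.
have := floor_itv (x * q%:R); rewrite -floE // -PoszD addn1 -!pmulrn => /andP[-> ->] //.
Qed.

Lemma step_flo q g x : (0 < q)%N -> D01 x -> step q g x = g (flo q x).
Proof.
move=> q0 Dx; rewrite /step (bigD1 (Ordinal (flo_lt q0 Dx))) //= big1 ?addr0.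
  by rewrite indicE mem_set ?mulr1 //; apply/cell_flo.
move=> i ii; rewrite indicE memNset ?mulr0 // => /(cell_flo i q0 Dx) E.
by case/eqP: ii; apply: val_inj; rewrite /= E.
Qed.

Lemma measurable_step q g (D : set R) : measurable_fun D (EFin \o step q g).
Proof.
apply/measurable_EFinP; rewrite /step.
apply: measurable_sum => i; apply: measurable_funM => //.
by apply: measurable_indic; apply: measurable_itv.
Qed.

Lemma step_ge0 q g x : (forall i, 0 <= g i) -> 0 <= step q g x.
Proof. by move=> g0; apply: sumr_ge0 => i _; rewrite mulr_ge0 // indicE ler0n. Qed.

Lemma measurable_D01 : measurable D01. Proof. exact: measurable_itv. Qed.

Lemma integral_step q g : (0 < q)%N -> (forall i, 0 <= g i) ->
  (\int[mu]_(x in D01) (step q g x)%:E = (q%:R^-1 * \sum_(i < q) g i)%:E)%E.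
Proof.
move=> q0 g0; have q0' : 0 < q%:R :> R by rewrite ltr0n.
have mc (i : nat) : measurable (cell q i) by apply: measurable_itv.
rewrite /step; under eq_integral do rewrite -sumEFin.
rewrite ge0_integral_sum //=; first last.
- by move=> i x _; rewrite lee_fin mulr_ge0 // indicE ler0n.
- move=> i; apply/measurable_EFinP; apply: measurable_funM => //.
  refine (measurable_indic (mc i)).
rewrite mulr_sumr -sumEFin; apply: eq_bigr => i _.
under eq_integral do rewrite EFinM.
rewrite ge0_integralZl //; last 2 first.
- apply/measurable_EFinP; refine (measurable_indic (mc i)).
- by rewrite lee_fin.
rewrite integral_indic; [|exact: measurable_D01|exact: mc].
have -> : (cell q i `&` D01 = cell q i)%classic.
  apply/seteqP; split=> [x []//|x cx]; split=> //; move: cx; rewrite /cell /= !in_itv /=.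
  move=> /andP[h1 h2]; apply/andP; split.
    by apply: le_trans h1; rewrite divr_ge0 // ler0n.
  by apply: lt_le_trans h2 _; rewrite ler_pdivrMr // mul1r ler_nat ltn_ord.
have E : mu (cell q i) = (q%:R^-1)%:E.
  rewrite /cell; apply: etrans (lebesgue_measure_itv _) _.
  rewrite /= lte_fin ltr_pM2r ?invr_gt0 // ltr_nat ltnSn -EFinD; congr (_%:E).
  by rewrite -natr1; field; rewrite gt_eqF.
by rewrite [X in (_ * X)%E](_ : _ = (q%:R^-1)%:E) // -EFinM mulrC.
Qed.

End StepFunctions.

(** * Uniform vectors modulo p^K from the digits of a uniform point *)

Section DigitAverages.
Variables (R : realType) (p : nat).
Hypothesis hp : prime p.
Local Notation mu := (@lebesgue_measure R).
Local Notation D01 := (`[0%R, 1%R[%classic : set R).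

Lemma floor_divn (y : R) (n : nat) : (0 < n)%N ->
  Num.floor (y / n%:R) = (Num.floor y %/ n%:Z)%Z.
Proof.
move=> n0; have n0' : 0 < n%:R :> R by rewrite ltr0n.
apply/floor_def; set i := Num.floor y.
have := floor_itv y; rewrite -/i => /andP[i1 i2].
rewrite ler_pdivlMr // ltr_pdivrMr //.
have h1 : (i %/ n%:Z)%Z * n%:Z <= i by apply: lez_floor; rewrite eqz_nat -lt0n.
have h2 : i + 1 <= ((i %/ n%:Z)%Z + 1) * n%:Z.
  by rewrite lezD1 ltz_ceil // ltz_nat.
apply/andP; split.
  by apply: le_trans i1; rewrite -[n%:R]/(n%:Z%:~R) -intrM ler_int.
by apply: lt_le_trans i2 _; rewrite -[n%:R]/(n%:Z%:~R) -intrM ler_int.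
Qed.

Definition dig M i m : nat := ((i %/ p ^ (M - m.+1)) %% p)%N.

Lemma digit_flo M (x : R) m : D01 x -> (m < M)%N -> digit p x m = dig M (flo (p ^ M) x) m.
Proof.
move=> Dx mM; rewrite /digit /dig.
have p0 : (0 < p ^ (M - m.+1))%N by rewrite expn_gt0 prime_gt0.
have -> : x * p%:R ^+ m.+1 = (x * (p ^ M)%:R) / (p ^ (M - m.+1))%:R.
  rewrite -(subnKC mM) addKn expnD natrM mulrA mulfK ?natrX //.
  by rewrite -natrX pnatr_eq0 -lt0n expn_gt0 prime_gt0.
by rewrite floor_divn // -floE // divz_nat modz_nat.
Qed.

Lemma dig_inj M i i' : (i < p ^ M)%N -> (i' < p ^ M)%N ->
  (forall m, (m < M)%N -> dig M i m = dig M i' m) -> i = i'.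
Proof.
move=> iM iM' h; suff H m : (m <= M)%N -> (i %/ p ^ (M - m) = i' %/ p ^ (M - m))%N.
  by have := H M (leqnn M); rewrite subnn expn0 !divn1.
elim: m => [_|m IH mM]; first by rewrite subn0 !divn_small.
have e : (p ^ (M - m) = p ^ (M - m.+1) * p)%N by rewrite -expnSr; congr (_ ^ _)%N; lia.
have := IH (ltnW mM); rewrite e !divnMA => E.
by rewrite (divn_eq (i %/ _) p) E -[((i %/ _) %% p)%N]/(dig M i m) h // -divn_eq.
Qed.

Variables (N K : nat).
Hypothesis K0 : (0 < K)%N.
Let M := (N * K)%N.

Definition coordn (i j : nat) : digits := fun l => dig M i (j + N * l).
Definition coord_vec (i : nat) : {ffun 'I_N -> 'Z_(p ^ K)} :=
  [ffun j : 'I_N => (trunc p (coordn i j) K)%:~R].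
Definition coord_trunc (x : R) : {ffun 'I_N -> 'Z_(p ^ K)} :=
  [ffun j : 'I_N => (trunc p (Defs.coord p N x j) K)%:~R].

Lemma is_Zp_coordn i j : is_Zp p (coordn i j).
Proof. by move=> l; rewrite /coordn /dig ltn_mod prime_gt0. Qed.

Lemma coord_index (j l : nat) : (j < N)%N -> (l < K)%N -> (j + N * l < M)%N.
Proof.
move=> jN lK; apply: (@leq_trans (N * l.+1)%N); first by rewrite mulnS ltn_add2r.
by rewrite /M leq_mul2l lK orbT.
Qed.

(** Digit m is digit m / N of coordinate m mod N, so the N coordinates modulo p^K determine the
    first NK digits. There are p^(NK) cells and as many vectors, so a uniform cell gives a uniform
    vector. *)
Lemma coord_vec_inj i i' : (i < p ^ M)%N -> (i' < p ^ M)%N -> coord_vec i = coord_vec i' -> i = i'.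
Proof.
move=> iM iM' E; have q1 := prime_power_gt1 hp K0.
apply: (dig_inj iM iM') => m mM.
have N0 : (0 < N)%N by move: mM; rewrite /M; case: (N).
have jN : (m %% N < N)%N by rewrite ltn_mod.
have lK : (m %/ N < K)%N by rewrite ltn_divLR // mulnC.
have {}E : trunc p (coordn i (m %% N)) K = trunc p (coordn i' (m %% N)) K.
  have := congr1 (fun f : {ffun 'I_N -> 'Z_(p ^ K)} => f (Ordinal jN)) E.
  rewrite !ffunE /= => /eqP; rewrite intr_Zq_eq // => h.
  by apply: (dvdz_small _ _ h); apply: trunc_bounds => //; apply: is_Zp_coordn.
have E' k : (k <= K)%N -> trunc p (coordn i (m %% N)) k = trunc p (coordn i' (m %% N)) k.
  move=> kK; apply: (@dvdz_small (p ^ k)); try exact: (trunc_bounds hp _ (is_Zp_coordn _ _)).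
  have h1 := trunc_coherent p (coordn i (m %% N)) kK.
  have h2 := trunc_coherent p (coordn i' (m %% N)) kK.
  have -> : trunc p (coordn i (m %% N)) k - trunc p (coordn i' (m %% N)) k =
    (trunc p (coordn i' (m %% N)) K - trunc p (coordn i' (m %% N)) k) -
    (trunc p (coordn i (m %% N)) K - trunc p (coordn i (m %% N)) k) by rewrite E; ring.
  exact: rpredB.
have := E' _ lK; rewrite !truncdS E' 1?ltnW // => /addrI /eqP.
rewrite -!PoszM eqz_nat eqn_pmul2r ?expn_gt0 ?prime_gt0 // /coordn => /eqP.
by rewrite mulnC addnC -divn_eq.
Qed.

Lemma coord_trunc_flo x : D01 x -> coord_trunc x = coord_vec (flo (p ^ M) x).
Proof.
move=> Dx; apply/ffunP => j; rewrite !ffunE; congr (_%:~R).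
rewrite /trunc; apply: eq_bigr => l _; congr (Posz _ * _).
by rewrite /Defs.coord /coordn (@digit_flo M x _ Dx) // coord_index.
Qed.

Lemma sum_coord_vec (L : nmodType) (G : {ffun 'I_N -> 'Z_(p ^ K)} -> L) :
  \sum_(i < p ^ M) G (coord_vec i) = \sum_b G b.
Proof.
pose f (i : 'I_(p ^ M)) := coord_vec i.
have finj : injective f.
  by move=> i i' E; apply: val_inj; apply: (coord_vec_inj (ltn_ord i) (ltn_ord i') E).
have fbij : bijective f.
  apply: inj_card_bij => //; rewrite card_ffun !card_ord Zp_cast ?prime_power_gt1 //.
  by rewrite /M mulnC expnM.
by rewrite (reindex f) //; apply: onW_bij.
Qed.

(** Realises an average over vectors modulo p^K as an integral, so that all levels K live on the
    same interval. *)
Definition avg_step (G : {ffun 'I_N -> 'Z_(p ^ K)} -> R) : R -> R :=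
  step (p ^ M) (fun i => G (coord_vec i)).

Lemma avg_stepE G x : D01 x -> avg_step G x = G (coord_trunc x).
Proof. by move=> Dx; rewrite /avg_step step_flo ?expn_gt0 ?prime_gt0 // coord_trunc_flo. Qed.

Lemma integral_avg_step G : (forall b, 0 <= G b) ->
  (\int[mu]_(x in D01) (avg_step G x)%:E = (((p ^ (K * N))%:R)^-1 * \sum_b G b)%:E)%E.
Proof.
move=> G0; rewrite /avg_step integral_step ?expn_gt0 ?prime_gt0 // sum_coord_vec.
by rewrite /M mulnC.
Qed.

End DigitAverages.

Section EventualLimits.
Variables (d : measure_display) (T : measurableType d) (R : realType).
Variable mu : {measure set T -> \bar R}.

Lemma cvg_integral_eventually (D : set T) (f : nat -> T -> R) (g : T -> R) (C : R) :
  measurable D -> (mu D < +oo)%E -> (forall K, measurable_fun D (EFin \o f K)) ->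
  (forall K x, D x -> 0 <= f K x <= C) ->
  (forall x, D x -> exists K0, forall K, (K0 <= K)%N -> f K x = g x) ->
  [/\ measurable_fun D (EFin \o g), (\int[mu]_(x in D) (g x)%:E)%E \is a fin_num &
   (fun K => \int[mu]_(x in D) (f K x)%:E)%E @ \oo --> (\int[mu]_(x in D) (g x)%:E)%E].
Proof.
move=> mD Dfin mf fC fg.
have fcvg x : D x -> (fun K => (f K x)%:E) @ \oo --> (g x)%:E.
  move=> Dx; apply: cvg_near_cst; have [K0 hK0] := fg x Dx.
  by exists K0 => // K /= hK; rewrite hK0.
have mg : measurable_fun D (EFin \o g).
  by apply: (emeasurable_fun_cvg (fun K => EFin \o f K)).
have iC : mu.-integrable D (EFin \o cst C).
  apply/integrableP; split; first exact/measurable_EFinP.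
  rewrite (eq_integral (cst `|C|%:E)) //= integral_cst //.
  by rewrite lte_mul_pinfty // lee_fin.
have gC x : D x -> 0 <= g x <= C.
  by move=> Dx; have [K0 hK0] := fg x Dx; rewrite -(hK0 K0) // fC.
have ig : mu.-integrable D (EFin \o g).
  apply: (le_integrable mD mg _ iC) => x Dx /=; rewrite lee_fin.
  have /andP[g0 g1] := gC x Dx; rewrite !ger0_norm //; exact: le_trans g1.
split=> //; first exact: integrable_fin_num.
apply: (@dominated_cvg _ _ _ mu D mD (fun K => EFin \o f K) (EFin \o g) (EFin \o cst C)) => //.
move=> K x Dx /=; rewrite lee_fin; have /andP[f0 f1] := fC K x Dx.
by rewrite ger0_norm.
Qed.

End EventualLimits.

Section Limits.
Variables (R : realType) (p : nat).
Hypothesis hp : prime p.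
Local Notation mu := (@lebesgue_measure R).
Local Notation D01 := (`[0%R, 1%R[%classic : set R).

Definition average (N d : nat) (H : forall K, {ffun 'I_N -> 'Z_(p ^ K)} -> nat) K : R :=
  ((p ^ (K * N))%:R)^-1 * \sum_b ('C(H K b, d))%:R.

(** Dominated convergence is applied twice: in K for fixed k, with a bound depending on k, and then
    in k, with the uniform bound B. The set D leaves out a null set where the pointwise convergence
    may fail. *)
Lemma expect_limit (N d B : nat) (X : R -> nat) (D : set R)
    (H : nat -> forall K, {ffun 'I_N -> 'Z_(p ^ K)} -> nat) (bound : nat -> nat) :
  measurable D -> D `<=` D01 -> mu (D01 `\` D) = 0%E ->
  (forall k K b, (0 < k)%N -> (H k K b <= bound k)%N) ->
  (forall x, D x -> exists Nx : nat -> nat,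
     [/\ forall k, (0 < k)%N -> exists K0, forall K, (K0 <= K)%N ->
           H k K (coord_trunc p N K x) = Nx k,
         forall k, (Nx k <= B)%N &
         exists k0, forall k, (k0 <= k)%N -> Nx k = X x]) ->
  exists e : nat -> R,
    (forall k, (0 < k)%N -> average d (H k) @ \oo --> e k) /\
    e @ \oo --> expect (fun x => ('C(X x, d))%:R : R).
Proof.
move=> mD DD mu0 Hb HX.
have Dfin : (mu D < +oo)%E.
  apply: (@le_lt_trans _ _ (mu D01)); first by apply: (le_measure mu); rewrite ?inE //; exact: (measurable_D01 R).
  by rewrite [mu _]lebesgue_measure_itv /= lte_fin ltr01 sube0 ltry.
have /choice [Nx hNx] : forall x, exists Nx : nat -> nat, D x ->
     [/\ forall k, (0 < k)%N -> exists K0, forall K, (K0 <= K)%N ->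
           H k K (coord_trunc p N K x) = Nx k,
         forall k, (Nx k <= B)%N &
         exists k0, forall k, (k0 <= k)%N -> Nx k = X x].
  move=> x; have [Dx|nDx] := pselect (D x); last by exists (fun=> 0%N).
  by have [Nx h] := HX x Dx; exists Nx.
(* The shift to K + 1 makes every level positive. *)
pose f k K x : R := @avg_step R p N K.+1 (fun b => ('C(H k K.+1 b, d))%:R) x.
pose F k x : R := ('C(Nx x k, d))%:R.
have level k : (0 < k)%N -> [/\ measurable_fun D (EFin \o F k),
   (\int[mu]_(x in D) (F k x)%:E)%E \is a fin_num &
   (fun K => \int[mu]_(x in D) (f k K x)%:E)%E @ \oo --> (\int[mu]_(x in D) (F k x)%:E)%E].
  move=> k0; apply: (@cvg_integral_eventually _ _ R mu D (f k) (F k) ('C(bound k, d))%:R mD Dfin).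
  - by move=> K; apply: measurable_step.
  - move=> K x Dx; rewrite /f avg_stepE //; last exact: DD.
    by rewrite ler0n ler_nat leq_bin2l // Hb.
  move=> x Dx; have [h1 _ _] := hNx x Dx; have [K0 hK0] := h1 k k0.
  exists K0 => K hK; rewrite /f avg_stepE //; last exact: DD.
  by rewrite /F hK0 // leqW.
pose e k : R := fine (\int[mu]_(x in D) (F k x)%:E)%E.
exists e; split.
  move=> k k0; have [_ Ffin Fcvg] := level k k0.
  rewrite -(cvg_shiftS (average d (H k))).
  have -> : [sequence average d (H k) n.+1]_n =
     fine \o (fun K => \int[mu]_(x in D) (f k K x)%:E)%E.
    apply/funext => K /=.
    rewrite -(@ge0_integral_null _ _ R mu D01 D) //.
      by rewrite integral_avg_step.
    by move=> x _; rewrite lee_fin; apply: step_ge0.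
  by apply: fine_cvg; rewrite /e fineK.
have [_ Xfin Xcvg] : [/\ measurable_fun D (EFin \o (fun x => ('C(X x, d))%:R : R)),
   (\int[mu]_(x in D) (('C(X x, d))%:R : R)%:E)%E \is a fin_num &
   (fun k => \int[mu]_(x in D) (F k.+1 x)%:E)%E @ \oo -->
      (\int[mu]_(x in D) (('C(X x, d))%:R : R)%:E)%E].
  apply: (@cvg_integral_eventually _ _ R mu D (fun k => F k.+1) (fun x => ('C(X x, d))%:R) ('C(B, d))%:R mD Dfin).
  - by move=> k; have [] := level k.+1 isT.
  - move=> k x Dx; have [_ h2 _] := hNx x Dx.
    by rewrite /F ler0n ler_nat leq_bin2l.
  move=> x Dx; have [_ _ [k0 hk0]] := hNx x Dx; exists k0 => k hk.
  by rewrite /F hk0 // leqW.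
rewrite -(cvg_shiftS e) /expect.
rewrite (@ge0_integral_null _ _ R mu D01 D) //.
by apply: (fine_cvg (f := fun k => \int[mu]_(x in D) (F k.+1 x)%:E)%E); rewrite fineK.
Qed.

End Limits.

(** * Passage to the limit *)

Section IteratedLimits.
Variable R : realType.
Implicit Types (u v : nat -> nat -> R) (l : R).

(* The limit over [k] of the limits over [K]. *)
Definition lim2 u l := exists (k0 : nat) (e : nat -> R),
  (forall k, (k0 <= k)%N -> u k @ \oo --> e k) /\ e @ \oo --> l.

Lemma cvg_eventually_eq (f g : nat -> R) l (K0 : nat) :
  (forall K, (K0 <= K)%N -> f K = g K) -> f @ \oo --> l -> g @ \oo --> l.
Proof.
move=> fg; apply: cvg_trans; apply: near_eq_cvg.
by exists K0 => // K /= hK; rewrite fg.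
Qed.

Lemma lim2_eq u v l (k0 : nat) (K0 : nat -> nat) :
  (forall k K, (k0 <= k)%N -> (K0 k <= K)%N -> u k K = v k K) -> lim2 u l -> lim2 v l.
Proof.
move=> uv [k1 [e [ue el]]]; exists (maxn k0 k1), e; split=> // k.
rewrite geq_max => /andP[h0 h1]; apply: (@cvg_eventually_eq (u k) _ _ (K0 k)); last exact: ue.
by move=> K; apply: uv.
Qed.

Lemma lim2_uniq u l l' : lim2 u l -> lim2 u l' -> l = l'.
Proof.
move=> [k0 [e [ue el]]] [k1 [e' [ue' el']]].
have : e' @ \oo --> l.
  apply: (@cvg_eventually_eq e _ _ (maxn k0 k1)) => // k; rewrite geq_max => /andP[h0 h1].
  exact: cvg_unique (ue k h0) (ue' k h1).
by move=> h; apply: cvg_unique h el'.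
Qed.

Lemma lim2_cst l : lim2 (fun _ _ => l) l.
Proof. by exists 0%N, (fun=> l); split=> [k _|]; apply: cvg_cst. Qed.

Lemma lim2D u v l l' : lim2 u l -> lim2 v l' -> lim2 (fun k K => u k K + v k K) (l + l').
Proof.
move=> [k0 [e [ue el]]] [k1 [e' [ue' el']]]; exists (maxn k0 k1), (fun k => e k + e' k).
split=> [k|]; last exact: cvgD.
by rewrite geq_max => /andP[h0 h1]; apply: cvgD; [apply: ue|apply: ue'].
Qed.

Lemma lim2M u v l l' : lim2 u l -> lim2 v l' -> lim2 (fun k K => u k K * v k K) (l * l').
Proof.
move=> [k0 [e [ue el]]] [k1 [e' [ue' el']]]; exists (maxn k0 k1), (fun k => e k * e' k).
split=> [k|]; last exact: cvgM.
by rewrite geq_max => /andP[h0 h1]; apply: cvgM; [apply: ue|apply: ue'].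
Qed.

Lemma lim2Z (a : R) u l : lim2 u l -> lim2 (fun k K => a * u k K) (a * l).
Proof. by apply: lim2M; apply: lim2_cst. Qed.

Lemma lim2_sum (I : Type) (r : seq I) (u : I -> nat -> nat -> R) (l : I -> R) :
  (forall i, lim2 (u i) (l i)) -> lim2 (fun k K => \sum_(i <- r) u i k K) (\sum_(i <- r) l i).
Proof.
move=> h; elim: r => [|i r IH].
  by rewrite big_nil; under [X in lim2 X _]eq2_fun do rewrite big_nil; apply: lim2_cst.
by rewrite big_cons; under [X in lim2 X _]eq2_fun do rewrite big_cons; apply: lim2D.
Qed.

Lemma cvg_subn (f : nat -> R) l j : f @ \oo --> l -> (fun K => f (K - j)%N) @ \oo --> l.
Proof.
move=> fl; rewrite -(cvg_shiftn j); apply: cvg_trans fl; apply: near_eq_cvg.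
by exists 0%N => // K _ /=; rewrite addnK.
Qed.

Lemma lim2_subn u l j : lim2 u l -> lim2 (fun k K => u k (K - j)%N) l.
Proof. by move=> [k0 [e [ue el]]]; exists k0, e; split=> // k hk; apply/cvg_subn/ue. Qed.

(** Absorbs the digits lost in [betaF_rescale]: neither shift is visible in the limit. *)
Lemma lim2_pred u l j : lim2 u l -> lim2 (fun k K => u k.-1 (K - j)%N) l.
Proof.
move=> [k0 [e [ue el]]]; exists k0.+1, (fun k => e k.-1); split=> [k hk|].
  by apply/cvg_subn/ue; case: k hk.
by rewrite -cvg_shiftS.
Qed.

End IteratedLimits.

Section Expectations.
Variables (R : realType) (p : nat).
Hypothesis hp : prime p.
Local Notation mu := (@lebesgue_measure R).
Local Notation D01 := (`[0%R, 1%R[%classic : set R).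

Definition onez : {poly R} := 1 + 'X.

Lemma coef_onez m d : (onez ^+ m)`_d = ('C(m, d))%:R.
Proof.
rewrite /onez exprDn coef_sum; case: (ltnP d m.+1) => dm.
  rewrite (bigD1 (Ordinal dm)) //= big1 ?addr0.
    by rewrite coefMn expr1n mul1r coefXn eqxx.
  move=> i id; rewrite coefMn expr1n mul1r coefXn (_ : (d == i) = false) ?mul0rn //.
  by apply/negbTE; apply: contra id => /eqP E; apply/eqP/val_inj.
rewrite bin_small // big1 // => i _; rewrite coefMn expr1n mul1r coefXn.
by rewrite (_ : (d == i) = false) ?mul0rn // gtn_eqF // (leq_trans _ dm).
Qed.

Lemma coef_average N d K (H : forall K, {ffun 'I_N -> 'Z_(p ^ K)} -> nat) :
  (((p ^ (K * N))%:R)^-1 *: \sum_b onez ^+ (H K b))`_d = average R d H K.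
Proof.
rewrite coefZ coef_sum /average; congr (_ * _); apply: eq_bigr => b _.
by rewrite coef_onez.
Qed.

Lemma Ntot_congr k K n (c c' : nat -> int) : (0 < k)%N -> (k <= K)%N ->
  (forall i, (i <= n)%N -> (c i)%:~R = (c' i)%:~R :> 'Z_(p ^ K)) ->
  Ntot p k K n c = Ntot p k K n c'.
Proof.
move=> k0 kK h; rewrite !Ntot_lowp //=.
suff -> : [ffun i : 'I_n.+1 => (c i)%:~R] = [ffun i : 'I_n.+1 => (c' i)%:~R] :> {ffun 'I_n.+1 -> 'Z_(p ^ K)} by [].
by apply/ffunP => i; rewrite !ffunE h // -ltnS.
Qed.

Lemma Ntot_le k K n c : (Ntot p k K n c <= #|'Z_(p ^ k)| + #|'Z_(p ^ k)|)%N.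
Proof. by apply: leq_add; apply: max_card. Qed.

Lemma expect_lim2 (N n d : nat) (c : R -> nat -> digits) (D : set R)
    (F : forall K, {ffun 'I_N -> 'Z_(p ^ K)} -> nat -> int) :
  measurable D -> D `<=` D01 -> mu (D01 `\` D) = 0%E ->
  (forall x, D x -> exists K, ~ ((p ^ K)%:Z %| trunc p (c x n) K)%Z) ->
  (forall K x i, (0 < K)%N -> D x -> (i <= n)%N ->
     (F K (coord_trunc p N K x) i)%:~R = (trunc p (c x i) K)%:~R :> 'Z_(p ^ K)) ->
  lim2 (fun k K => (((p ^ (K * N))%:R)^-1 *: \sum_b onez ^+ Ntot p k K n (F K b))`_d)
    (expect (fun x => ('C(nroots p n (c x), d))%:R : R)).
Proof.
move=> mD DD mu0 cn hF.
have [|x Dx|e [h1 h2]] := @expect_limit R p hp N d (n + n) (fun x => nroots p n (c x)) D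
  (fun k K b => Ntot p k K n (F K b)) (fun k => #|'Z_(p ^ k)| + #|'Z_(p ^ k)|)%N mD DD mu0.
- by move=> k K b _; apply: Ntot_le.
- have [Nx [n1 n2 n3]] := Ntot_eventually hp (cn x Dx); exists Nx; split=> // k k0.
  have [K0 hK0] := n1 k k0; exists (maxn k K0) => K; rewrite geq_max => /andP[kK hK].
  rewrite -(hK0 K hK); apply: Ntot_congr => // i ni.
  by apply: hF => //; apply: leq_trans kK.
exists 1%N, e; split=> // k k0.
have -> : (fun K => (((p ^ (K * N))%:R)^-1 *: \sum_b onez ^+ Ntot p k K n (F K b))`_d) =
   average R d (fun K b => Ntot p k K n (F K b)).
  by apply/funext => K; exact: (@coef_average N d K (fun K b => Ntot p k K n (F K b))).
exact: h1.
Qed.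

Lemma one_digits_trunc K : (0 < K)%N -> trunc p one_digits K = 1.
Proof.
by case: K => // K _; rewrite /trunc big_ord_recl big1 ?addr0.
Qed.

Lemma one_digits_neq0 : exists K, ~ ((p ^ K)%:Z %| trunc p one_digits K)%Z.
Proof.
exists 1%N; rewrite one_digits_trunc // expn1 dvdz1 /=; have := prime_gt1 hp.
by case: (p) => [|[]].
Qed.

Lemma alpha_lim2 n d :
  lim2 (fun k K => (alphaF p onez k K n)`_d) (alpha R p n d).
Proof.
apply: (@lim2_eq _ _ _ _ 1%N id); last first.
  apply: (@expect_lim2 n n d _ D01 (fun K b i => if insub i is Some j then (b j : nat)%:Z else 1)) => //.
  - by rewrite setDv measure0.
  - by move=> x _; rewrite ltnn; apply: one_digits_neq0.
  move=> K x i K0 Dx ni; case: insubP => [j ij <-|].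
    by rewrite /= ltn_ord ffunE -Zq_val.
  by move=> /negbTE ->; rewrite one_digits_trunc.
by move=> k K k0 kK; rewrite alphaF_Ntot.
Qed.

Lemma beta_lim2 n d :
  lim2 (fun k K => (betaF p onez k K n)`_d) (beta R p n d).
Proof.
apply: (@lim2_eq _ _ _ _ 1%N id); last first.
  apply: (@expect_lim2 n n d _ D01 (fun K b i => if insub i is Some j then p%:Z * (b j : nat)%:Z else 1)) => //.
  - by rewrite setDv measure0.
  - by move=> x _; rewrite ltnn; apply: one_digits_neq0.
  move=> K x i K0 Dx ni; case: insubP => [j ij <-|].
    rewrite /= ltn_ord ffunE intrM -Zq_val -intrM; apply/eqP; rewrite intr_Zq_eq ?prime_power_gt1 //.
    case: K K0 => // K _.
    (* [times_p] inserts a digit 0, so K + 1 digits of the product use only K digits of the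
       coordinate; the next digit would contribute a multiple of p^(K+1). *)
    have -> : trunc p (times_p (Defs.coord p n x j)) K.+1 = p%:Z * trunc p (Defs.coord p n x j) K.
      rewrite /trunc big_ord_recl /= mul0r add0r mulr_sumr; apply: eq_bigr => l _.
      by rewrite /bump /= add1n expnS PoszM mulrCA.
    rewrite -mulrBr expnS PoszM dvdz_mul //.
    by apply: trunc_coherent.
  by move=> /negbTE ->; rewrite one_digits_trunc.
by move=> k K k0 kK; rewrite betaF_Ntot.
Qed.

End Expectations.

(** * The general model, off the null set of vanishing leading coefficient *)

Section GeneralPolynomials.
Variables (R : realType) (p : nat).
Hypothesis hp : prime p.
Local Notation mu := (@lebesgue_measure R).
Local Notation D01 := (`[0%R, 1%R[%classic : set R).

Lemma card_last_eq (A : finType) n (a : A) :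
  #|[pred g : {ffun 'I_n.+1 -> A} | g ord_max == a]| = (#|A| ^ n)%N.
Proof.
pose F (i : 'I_n.+1) : pred A := fun x => (i == ord_max) ==> (x == a).
transitivity #|family F|.
  apply: eq_card => g; apply/idP/familyP => [h i|/(_ ord_max)].
    by rewrite unfold_in /F; apply/implyP => /eqP ->.
  by rewrite unfold_in /F eqxx.
rewrite card_family foldrE big_map big_enum big_ord_recr /=.
have -> : #|F ord_max| = 1%N.
  by rewrite -(card1 a); apply: eq_card => x; rewrite !inE /F eqxx.
rewrite muln1 (eq_bigr (fun=> #|A|)) ?prod_nat_const ?card_ord // => i _.
by apply: eq_card => x; rewrite !inE unfold_in /F -val_eqE /= ltn_eqF.
Qed.

Variable n : nat.

Definition lead_zero K (b : {ffun 'I_n.+1 -> 'Z_(p ^ K)}) : R := (b ord_max == 0)%:R.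

(* Inputs whose leading coefficient vanishes modulo every power of [p]. *)
Definition lead_null : set R :=
  D01 `&` \bigcap_K [set x | avg_step (@lead_zero K.+1) x = 1].

Lemma measurable_lead_null : measurable lead_null.
Proof.
apply: measurableI; first exact: measurable_itv.
apply: bigcapT_measurable => K.
have mf : measurable_fun setT (avg_step (@lead_zero K.+1)).
  by apply/measurable_EFinP; apply: measurable_step.
rewrite -[X in measurable X]setTI.
exact: (mf measurableT [set 1] (measurable_set1 _)).
Qed.

(** The leading coefficient is uniform modulo p^(K+1), so it vanishes there with probability
    p^(-(K+1)). *)
Lemma lead_null_le K : (mu lead_null <= ((p ^ K.+1)%:R^-1)%:E)%E.
Proof.
have q1 := prime_power_gt1 hp (ltn0Sn K).
have -> : mu lead_null = (\int[mu]_(x in lead_null) (avg_step (@lead_zero K.+1) x)%:E)%E.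
  rewrite (eq_integral (cst 1%E)) ?integral_cst ?mul1e //; first exact: measurable_lead_null.
  by move=> x /set_mem [_ hx]; rewrite (hx K).
apply: (@le_trans _ _ (\int[mu]_(x in D01) (avg_step (@lead_zero K.+1) x)%:E)%E).
  apply: ge0_subset_integral => //.
  - exact: measurable_lead_null.
  - exact: measurable_step.
  - by move=> x _; rewrite lee_fin; apply: step_ge0 => i; apply: ler0n.
  by move=> x [].
rewrite integral_avg_step //.
rewrite lee_fin /lead_zero -natr_sum.
have -> : (\sum_(b : {ffun 'I_n.+1 -> 'Z_(p ^ K.+1)}) (b ord_max == 0%R))%N = ((p ^ K.+1) ^ n)%N.
  rewrite -[in RHS](card_Zq q1) -(card_last_eq n (0 : 'Z_(p ^ K.+1))) -sum1_card.
  by rewrite [in RHS]big_mkcond /=; apply: eq_bigr => b _; rewrite inE; case: (_ == _).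
rewrite expnM expnS natrM invfM -mulrA mulVf ?mulr1 //.
by rewrite pnatr_eq0 -lt0n !expn_gt0 prime_gt0.
Qed.

Lemma mu_lead_null : mu lead_null = 0%E.
Proof.
apply/eqP; rewrite eq_le measure_ge0 andbT; apply/lee_addgt0Pr => e e0; rewrite add0e.
have [K hK] : exists K : nat, (p ^ K.+1)%:R^-1 <= e.
  exists (Num.bound e^-1).
  have h : e^-1 < (Num.bound e^-1)%:R by apply: archi_boundP; rewrite invr_ge0 ltW.
  rewrite -[X in _ <= X]invrK lef_pV2 ?posrE ?invr_gt0 ?ltr0n ?expn_gt0 ?prime_gt0 //.
  apply: le_trans (ltW h) _; rewrite ler_nat; apply: ltnW; apply: (@leq_trans (Num.bound e^-1).+2) => //.
  exact: (ltn_expl _ (prime_gt1 hp)).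
by apply: le_trans (lead_null_le K) _; rewrite lee_fin.
Qed.

Lemma rho_lim2 d : lim2 (fun k K => (rhoF p (onez R) k K n)`_d) (rho R p n d).
Proof.
apply: (@expect_lim2 R p hp n.+1 n d (fun x => Defs.coord p n.+1 x) (D01 `\` lead_null)
   (fun K b i => (b (inord i) : nat)%:Z)).
- by apply: measurableD; [exact: measurable_itv|exact: measurable_lead_null].
- by move=> x [].
- rewrite setDD; apply/eqP; rewrite eq_le measure_ge0 andbT -mu_lead_null.
  apply: (le_measure mu); rewrite ?inE; last by move=> x [].
    by apply: measurableI; [exact: measurable_itv|exact: measurable_lead_null].
  exact: measurable_lead_null.
- move=> x [Dx nx]; apply: contrapT => h; apply: nx; split=> // K _ /=.
  rewrite avg_stepE // /lead_zero ffunE; suff -> : (trunc p (Defs.coord p n.+1 x (@ord_max n)) K.+1)%:~R == 0 :> 'Z_(p ^ K.+1) by [].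
  rewrite intr_Zq_eq0 ?prime_power_gt1 //; apply: contrapT => hK; apply: h; by exists K.+1.
by move=> K x i K0 Dx ni; rewrite ffunE inordK // -Zq_val.
Qed.

End GeneralPolynomials.

(** * Coefficientwise limits of series *)

Section SeriesLimits.
Variable R : realType.
Local Notation L := {poly R}.
Implicit Types (F G : nat -> nat -> nat -> L) (f g : nat -> nat -> R).

Definition serlim F f := forall n d, lim2 (fun k K => (F k K n)`_d) (f n d).

Lemma serlim_uniq F f g : serlim F f -> serlim F g -> f = g.
Proof.
by move=> hf hg; apply/funext => n; apply/funext => d; apply: lim2_uniq (hf n d) (hg n d).
Qed.

Lemma serlim_eq F G f k0 (K0 : nat -> nat) :
  (forall k K, (k0 <= k)%N -> (K0 k <= K)%N -> F k K = G k K) -> serlim F f -> serlim G f.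
Proof.
by move=> FG hf n d; apply: (@lim2_eq _ _ _ _ k0 K0 _ (hf n d)) => k K h1 h2; rewrite FG.
Qed.

Lemma serlim_mul F G f g : serlim F f -> serlim G g ->
  serlim (fun k K => sermul (F k K) (G k K)) (fps2_mul f g).
Proof.
move=> hf hg n d; apply: (@lim2_eq _ (fun k K =>
   \sum_(i < n.+1) \sum_(j < d.+1) (F k K i)`_j * (G k K (n - i)%N)`_(d - j)) _ _ 0%N id).
  by move=> k K _ _; rewrite /sermul coef_sum; apply: eq_bigr => i _; rewrite coefM.
apply: lim2_sum => i; apply: lim2_sum => j; exact: lim2M.
Qed.

Lemma serlim_fps_mul (a : nat -> R) F f : serlim F f ->
  serlim (fun k K => sermul (fun n => (a n)%:P) (F k K)) (fun n d => fps_mul a (f ^~ d) n).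
Proof.
move=> hf n d; apply: (@lim2_eq _ (fun k K =>
   \sum_(i < n.+1) a i * (F k K (n - i)%N)`_d) _ _ 0%N id).
  by move=> k K _ _; rewrite /sermul coef_sum; apply: eq_bigr => i _; rewrite coefCM.
by apply: lim2_sum => i; apply: lim2Z.
Qed.

Lemma serlim_scale (a : nat -> R) F f : serlim F f ->
  serlim (fun k K n => a n *: F k K n) (fun n d => a n * f n d).
Proof.
move=> hf n d; apply: (@lim2_eq _ (fun k K => a n * (F k K n)`_d) _ _ 0%N id).
  by move=> k K _ _; rewrite coefZ.
exact: lim2Z.
Qed.

Lemma serlim_one : serlim (fun _ _ => serone L) (@fps2_one R).
Proof.
move=> n d; rewrite /serone /fps2_one; case: (n == 0%N) => /=.
  by rewrite coef1; apply: lim2_cst.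
by rewrite coef0; apply: lim2_cst.
Qed.

Lemma serlim_iter F f m : serlim F f ->
  serlim (fun k K => iter m (sermul (F k K)) (serone L)) (fps2_exp f m).
Proof.
move=> hf; elim: m => [|m IH]; first exact: serlim_one.
exact: serlim_mul hf IH.
Qed.

Lemma om_polyC (a : R) : om (a%:P) = fun n => (one_minus a n)%:P.
Proof.
by apply/funext => n; rewrite /om /one_minus; case: (n == 0%N) => //; case: (n == 1%N); rewrite ?polyCN.
Qed.

End SeriesLimits.

(** * The identities in the limit *)

Section Identities.
Variables (R : realType) (p : nat).
Hypothesis hp : prime p.
Local Notation L := {poly R}.
Local Notation z := (onez R).

Let aF k K := alphaF p z k K.
Let bF k K := betaF p z k K.

Lemma serlim_alpha : serlim aF (alpha R p). Proof. by move=> n d; apply: alpha_lim2. Qed.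
Lemma serlim_beta : serlim bF (beta R p). Proof. by move=> n d; apply: beta_lim2. Qed.

Lemma serlim_serB : serlim (fun k K => sermul (om 1) (bF k K)) (serB R p).
Proof.
have -> : om (1 : L) = fun n => (one_minus 1 n)%:P by rewrite -om_polyC polyC1.
exact: serlim_fps_mul serlim_beta.
Qed.

Lemma sermul_om_scale (f : nat -> L) :
  sermul (om p%:R) (fun n => p%:R ^+ n *: f n) = fun n => (p%:R : R) ^+ n *: sermul (om 1) f n.
Proof.
rewrite !sermul_om; apply/funext => -[|n] //.
rewrite scalerBr mul1r exprS; congr (_ - _).
by rewrite -polyC_natr mul_polyC scalerA.
Qed.

Lemma serlim_serA :
  serlim (fun k K => sermul (om p%:R) (fun n => p%:R ^+ n *: aF k K n)) (serA R p).
Proof.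
apply: (@serlim_eq _ (fun k K n => p%:R ^+ n *: sermul (om 1) (aF k K) n) _ _ 0%N id).
  by move=> k K _ _; rewrite sermul_om_scale.
have -> : om (1 : L) = fun n => (one_minus 1 n)%:P by rewrite -om_polyC polyC1.
exact: serlim_scale (serlim_fps_mul _ serlim_alpha).
Qed.

Lemma serA_exp : serA R p = fps2_exp (serB R p) p.
Proof.
apply: serlim_uniq (serlim_iter p serlim_serB).
apply: (@serlim_eq _ _ _ _ 1%N id _ serlim_serA) => k K k0 kK.
exact: alphaF_betaF.
Qed.

(** Put q = p^(n+1). Solving [rhoF_rec] for [primF] gives q/(p-1) times the difference of [rhoF] at
    K and 1/q times [rhoF] at K - 1. Both tend to [rho], and (q - 1)/(p - 1) = 1 + p + ... + p^n. *)
Lemma serlim_prim :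
  serlim (fun k K => primF p z k K) (fun n d => (\sum_(i < n.+1) p%:R ^+ i) * rho R p n d).
Proof.
move=> n d; set q : R := (p ^ n.+1)%:R; set m : R := p.-1%:R.
have q0 : q != 0 by apply: pnat_neq0.
have m0 : m != 0 by rewrite /m pnatr_eq0; have := prime_gt1 hp; lia.
have mE : m = p%:R - 1.
  by rewrite /m -[in RHS](prednK (prime_gt0 hp)) -addn1 natrD addrK.
have E : (\sum_(i < n.+1) p%:R ^+ i) = q / m * (1 - q^-1) :> R.
  have := subrX1 (p%:R : R) n.+1; rewrite -mE -natrX -/q => h.
  apply: (mulfI m0); rewrite -h; field.
  by rewrite q0 m0.
rewrite E; have hr := rho_lim2 R hp n d.
apply: (@lim2_eq _ (fun k K => q / m * ((rhoF p z k K n)`_d + (- q^-1) * (rhoF p z k (K - 1)%N n)`_d))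
   _ _ 1%N (fun k => k.+1)).
  move=> k [|K] k0 kK //; rewrite subn1 /= rhoF_rec // coefD (coefZ q^-1) (coefZ (m / q)).
  by field; rewrite q0 m0.
rewrite -[X in lim2 _ X]mulrA; apply: lim2Z; rewrite mulrBl mul1r -mulNr; apply: lim2D => //.
by apply: lim2Z; exact: (lim2_subn 1 hr).
Qed.

Lemma serlim_serR :
  serlim (fun k K => sermul (sermul (om 1) (om p%:R)) (primF p z k K)) (serR R p).
Proof.
have -> : sermul (om 1) (om p%:R) = fun n => (fps_mul (one_minus 1) (one_minus p%:R) n)%:P :> L.
  rewrite -polyC1 -polyC_natr !om_polyC; apply/funext => n.
  by rewrite /sermul /fps_mul rmorph_sum; apply: eq_bigr => i _; rewrite rmorphM.
exact: serlim_fps_mul serlim_prim.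
Qed.

Lemma serR_mul : serR R p = fps2_mul (serA R p) (serB R p).
Proof.
apply: serlim_uniq (serlim_mul serlim_serA serlim_serB).
apply: (@serlim_eq _ _ _ _ 1%N id _ serlim_serR) => k K k0 kK.
rewrite primF_sermul // [sermul (om 1) (om _)]sermulC -sermulA [sermul (om 1) (sermul _ _)]sermulCA.
by rewrite sermulA.
Qed.

(** Commutativity is inherited from [sermul] through uniqueness of limits. *)
Lemma serAB_comm : fps2_mul (serA R p) (serB R p) = fps2_mul (serB R p) (serA R p).
Proof.
apply: serlim_uniq (serlim_mul serlim_serB serlim_serA).
by apply: (@serlim_eq _ _ _ _ 0%N id _ (serlim_mul serlim_serA serlim_serB)) => k K _ _; rewrite sermulC.
Qed.

Lemma beta_alpha n d : beta R p n d = ((p ^ 'C(n, 2))%:R)^-1 * alpha R p n d +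
  \sum_(j < n) (p.-1%:R / (p ^ 'C(j.+1, 2))%:R) * \sum_(s < j) p%:R ^+ s * alpha R p s d.
Proof.
apply: lim2_uniq (serlim_beta n d) _.
apply: (@lim2_eq _ (fun k K => ((p ^ 'C(n, 2))%:R)^-1 * (aF k.-1 (K - n)%N n)`_d +
  \sum_(j < n) (p.-1%:R / (p ^ 'C(j.+1, 2))%:R) *
     \sum_(s < j) p%:R ^+ s * (aF k.-1 (K - j)%N s)`_d) _ _ 2%N (fun k => n + k)%N).
  move=> k K k1 nK; rewrite /bF betaF_rescale // coefD; congr (_ + _).
    by rewrite (coefZ ((p ^ 'C(n, 2))%:R^-1)).
  rewrite [RHS]coef_sum; apply: eq_bigr => j _; rewrite (coefZ (p.-1%:R / _)); congr (_ * _).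
  by rewrite [RHS]coef_sum; apply: eq_bigr => s _; rewrite (coefZ (p%:R ^+ s)).
apply: lim2D; first by apply: lim2Z; exact: (lim2_pred n (serlim_alpha n d)).
apply: lim2_sum => j; apply: lim2Z; apply: lim2_sum => s; apply: lim2Z.
exact: (lim2_pred j (serlim_alpha s d)).
Qed.

Lemma fps_mul_one_minus (a : R) (f : nat -> R) n :
  fps_mul (one_minus a) f n = if n is m.+1 then f m.+1 - a * f m else f 0%N.
Proof.
rewrite /fps_mul; case: n => [|n]; first by rewrite big_ord1 mul1r.
rewrite big_ord_recl /= mul1r subn0; congr (_ + _); rewrite big_ord_recl /= big1 ?addr0.
  by rewrite mulNr subSS subn0.
by move=> i _; rewrite mul0r.
Qed.

Lemma genA_coef d n :
  genA R p d n = if n is m.+1 then alpha R p m.+1 d - alpha R p m d else alpha R p 0 d.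
Proof. by rewrite /genA fps_mul_one_minus; case: n => // n; rewrite mul1r. Qed.

Lemma genB_coef d n :
  genB R p d n = if n is m.+1 then beta R p m.+1 d - beta R p m d else beta R p 0 d.
Proof. by rewrite /genB fps_mul_one_minus; case: n => // n; rewrite mul1r. Qed.

(** A difference of consecutive cases of [beta_alpha] keeps one summand in j. As binom(n+2, 2) =
    binom(n+1, 2) + n + 1, subtracting p^(-(n+1)) times the preceding difference cancels the inner
    sums up to (p-1) p^n alpha_n; with p^n alpha_n from the first terms this makes p^(n+1)
    alpha_n. *)
Lemma genB_genA d :
  fps_sub (genB R p d) (fps_shift (fps_scale (p%:R)^-1 (genB R p d))) =
  Phi p (fps_sub (genA R p d) (fps_shift (fps_scale p%:R (genA R p d)))).
Proof.
have p0 : (p%:R : R) != 0 by rewrite pnatr_eq0 -lt0n prime_gt0.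
have mE : p.-1%:R = p%:R - 1 :> R.
  by rewrite -[in RHS](prednK (prime_gt0 hp)) -addn1 natrD addrK.
apply/funext => n; rewrite /fps_sub /Phi /fps_shift /fps_scale.
case: n => [|[|n]].
- rewrite genA_coef genB_coef beta_alpha big_ord0 bin0n expn0 expr0.
  by move: (alpha _ _ _ _) => a; rewrite invr1 !mul1r addr0.
- rewrite 2!genA_coef 2!genB_coef 2!beta_alpha big_ord_recl !big_ord0.
  have -> : 'C(1, 2) = 0%N by [].
  rewrite bin0n expn0.
  move: (alpha R p 1 d) (alpha R p 0 d) (p.-1%:R / _ : R) (p%:R : R) => a1 a0 c x.
  rewrite !expr0 invr1.
  ring.
rewrite 2!genA_coef 2!genB_coef 3!beta_alpha 3!big_ord_recr /= mE.
have -> : 'C(n.+2, 2) = ('C(n, 2) + n + n.+1)%N by rewrite binS bin1 binS bin1.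
have -> : 'C(n.+1, 2) = ('C(n, 2) + n)%N by rewrite binS bin1.
move: (\sum_(i < n) p%:R ^+ i * alpha R p i d) => T.
move: (\sum_(i < n) _) => S.
move: (alpha R p n d) (alpha R p n.+1 d) (alpha R p n.+2 d) => a0 a1 a2.
rewrite !natrX exprVn [p%:R ^+ (_ + n.+1)]exprD [p%:R ^+ (_ + n)]exprD exprS.
have := expf_neq0 n p0; have := expf_neq0 'C(n, 2) p0; move: p0.
move: (p%:R : R) => x; move: (x ^+ 'C(n, 2)) (x ^+ n) => y w x0 y0 w0.
by field; rewrite x0 w0 y0.
Qed.

End Identities.


Theorem theorem1p1 (R : realType) (p : nat) (hp : prime p) :
  [/\ serA R p = fps2_exp (serB R p) p,
      serR R p = fps2_mul (serA R p) (serB R p),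
      serR R p = fps2_exp (serB R p) p.+1 &
      forall d : nat,
        fps_sub (genB R p d) (fps_shift (fps_scale (p%:R)^-1 (genB R p d)))
        = Phi p (fps_sub (genA R p d) (fps_shift (fps_scale p%:R (genA R p d))))].
Proof.
have hA := serA_exp R hp; have hR := serR_mul R hp.
split=> //; last by move=> d; apply: genB_genA.
by rewrite hR serAB_comm // hA.
Qed.
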